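(* Let $E^d$ be either $\mathbb{R}^d$ or $\mathbb{Z}^d$, with dual group $\hat E^d$. Let $M$ be a weakly stationary random measure on $E^d$ with spectral measure $S$ on $\hat E^d$, and let $A\subset E^d$. Then $M$ is perfectly interpolable from $A$ if and only if for every $\varphi\in L^2(S)\setminus\{0\}$ one has $\mathrm{Sp}(\varphi S)\cap A\neq\emptyset$, where the Fourier transform and the spectrum $\mathrm{Sp}$ are understood in the sense of tempered distributions.
   Context: $E^d=\mathbb{R}^d$ (with Lebesgue measure) has dual $\hat E^d=\mathbb{R}^d$; $E^d=\mathbb{Z}^d$ (with counting measure) has dual $\hat E^d=\mathbb{T}^d$, $\mathbb{T}=\{e^{is}:s\in[-\pi,\pi)\}$. For $B\subset E^d$, $\mathcal{C}_c^b(B)$ is the class of bounded measurable functions on $E^d$ with bounded support, supported in $B$. A weakly stationary random measure $M$ on $\mathbb{R}^d$ is a collection of complex square integrable random variables $M(f)$, $f\in\mathcal{C}_c^b(\mathbb{R}^d)$, on a probability space $(\Omega,\mathbf{P})$ such that (i) $M$ a.s. induces a complex-valued measure on each compact set, and (ii) $\mathrm{Var}(M(\tau_x f))=\mathrm{Var}(M(f))$ for every translation $\tau_x$, $x\in\mathbb{R}^d$. On $\mathbb{Z}^d$ it is a random field $(M_m)_{m\in\mathbb{Z}^d}$ of centred square integrable random variables with $M(f)=\sum_m M_m f(m)$ and $\mathrm{Var}(M(\tau_m f))=\mathrm{Var}(M(f))$ for $m\in\mathbb{Z}^d$ and $f$ with finite support. Fourier transform: $\hat f(u)=\int_{\mathbb{R}^d}e^{-iu\cdot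 x}f(x)\,dx$, $u\in\mathbb{R}^d$, if $E^d=\mathbb{R}^d$; $\hat f(u)=\sum_{k\in\mathbb{Z}^d}u^k f(k)$, $u\in\mathbb{T}^d$, with $u^k=u_1^{k_1}\cdots u_d^{k_d}$, if $E^d=\mathbb{Z}^d$. The spectral measure $S$ of $M$ is the non-negative symmetric measure on $\hat E^d$ such that $\mathrm{Var}(M(f))=(2\pi)^{-d}\int_{\hat E^d}|\hat f|^2\,dS$ for all $f\in\mathcal{C}_c^b(E^d)$. It satisfies $\int_{\mathbb{R}^d}(1+\|u\|)^{-d-1}S(du)<\infty$ if $\hat E^d=\mathbb{R}^d$, and $S(\mathbb{T}^d)<\infty$ if $\hat E^d=\mathbb{T}^d$. $M$ is perfectly interpolable from $A$ (equivalently, linearly maximally rigid on $A^c$) if for every $f\in\mathcal{C}_c^b(A^c)$ there are $h_n\in\mathcal{C}_c^b(A)$, $n\ge1$, such that $M(h_n)\to M(f)$ in $L^2(\mathbf{P})$. $\mathrm{Sp}(\varphi S)$ is the support of the Fourier transform of the complex measure $\varphi S$ (as a tempered distribution on $\mathbb{R}^d$, or as the function $m\mapsto\int_{\mathbb{T}^d}u^m\varphi(u)S(du)$ on $\mathbb{Z}^d$).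
   Formalization: On R^d the ''if'' part is stated only for open A (it fails for A={0}, M=Z·Lebesgue), and perfect interpolability is that of the centred M(f)−E M(f) (uncentred it fails for M=Lebesgue, A empty). ''Only if'' keeps arbitrary A; the Z^d case is unchanged. *)

(* Defs.v *)
From HB Require Import structures.
From mathcomp Require Import all_boot all_order all_algebra.
From mathcomp Require Import all_classical all_reals all_analysis.
From mathcomp.real_closed Require Import complex.

Set Implicit Arguments.
Unset Strict Implicit.
Unset Printing Implicit Defensive.
Import Order.TTheory GRing.Theory Num.Theory.
Import numFieldNormedType.Exports.
Local Open Scope classical_set_scope.
Local Open Scope ring_scope.

(* Row vectors carry the product sigma-algebra of their coordinates, as
   [n.-tuple T] does; on 'rV[R]_n these are the Borel sets of R^n. *)
Definition measure_rV_display : measure_display -> measure_display.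
Proof. exact. Qed.

Section measurable_rV.
Context {d} {T : measurableType d}.
Variable n : nat.

Let coors : 'I_n -> 'rV[T]_n -> T := fun i x => x ord0 i.

Let rV_set0 : g_sigma_preimage coors set0.
Proof. exact: sigma_algebra0. Qed.

Let rV_setC A : g_sigma_preimage coors A -> g_sigma_preimage coors (~` A).
Proof. exact: sigma_algebraC. Qed.

Let rV_bigcup (F : _^nat) : (forall i, g_sigma_preimage coors (F i)) ->
  g_sigma_preimage coors (\bigcup_i (F i)).
Proof. exact: sigma_algebra_bigcup. Qed.

HB.instance Definition _ := @isMeasurable.Build (measure_rV_display d)
  'rV[T]_n (g_sigma_preimage coors) rV_set0 rV_setC rV_bigcup.

Lemma measurable_coord (i : 'I_n) :
  measurable_fun [set: 'rV[T]_n] (fun x : 'rV[T]_n => x ord0 i).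
Proof.
move=> _ Y mY; rewrite setTI; apply: sub_sigma_algebra => /=.
rewrite -bigcup_seq/=; exists i => /=; first by rewrite mem_index_enum.
by exists Y => //; rewrite setTI.
Qed.

Lemma measurable_fun_rVP d1 (T1 : measurableType d1) (f : T1 -> 'rV[T]_n) :
  (forall i, measurable_fun [set: T1] (fun x => f x ord0 i)) ->
  measurable_fun [set: T1] f.
Proof.
move=> mf; have H : g_sigma_preimage (fun i => coors i \o f) `<=` measurable.
  apply: smallest_sub; first exact: sigma_algebra_measurable.
  rewrite -bigcup_seq; apply: bigcup_sub => i _.
  by move=> A [B mB <-]; exact: mf.
move: H; rewrite g_sigma_preimage_comp => H _ A mA.
by apply: H; exists A.
Qed.

End measurable_rV.

Section lebesgue_rV.
Context {R : realType}.
Local Open Scope ereal_scope.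

Definition cons_rV n (p : measurableTypeR R * 'rV[R]_n) : 'rV[R]_n.+1 :=
  \row_i (if unlift ord0 i is Some j then p.2 ord0 j else p.1).

Lemma measurable_cons_rV n : measurable_fun setT (@cons_rV n).
Proof.
apply: measurable_fun_rVP => i.
case: (unliftP ord0 i) => [j|] ->.
  under eq_fun do rewrite mxE liftK.
  apply: (@measurableT_comp _ _ _ _ _ _ (fun x : 'rV[R]_n => x ord0 j)) => //.
  exact: measurable_coord.
under eq_fun do rewrite mxE unlift_none.
exact: measurable_fst.
Qed.

HB.instance Definition _ n := isMeasurableFun.Build _ _ _ _ (@cons_rV n)
  (@measurable_cons_rV n).

Section step.
Variables (n : nat) (m : {sigma_finite_measure set 'rV[R]_n -> \bar R}).

Definition lebesgue_step : set 'rV[R]_n.+1 -> \bar R :=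
  pushforward ((@lebesgue_measure R) \x m) (@cons_rV n).


Let lebesgue_step0 : lebesgue_step set0 = 0.
Proof. exact: measure0. Qed.

Let lebesgue_step_ge0 A : 0 <= lebesgue_step A.
Proof. exact: measure_ge0. Qed.

Let lebesgue_step_semi_sigma_additive : semi_sigma_additive lebesgue_step.
Proof.
exact: (@measure_semi_sigma_additive _ _ _
  (pushforward ((@lebesgue_measure R) \x m) (@cons_rV n))).
Qed.

HB.instance Definition _ := isMeasure.Build _ _ _ lebesgue_step
  lebesgue_step0 lebesgue_step_ge0 lebesgue_step_semi_sigma_additive.

Lemma lebesgue_stepX (A : set R) (B : set 'rV[R]_n) :
  measurable A -> measurable B ->
  lebesgue_step [set x : 'rV[R]_n.+1 | A (x ord0 ord0) /\ B (\row_i x ord0 (lift ord0 i))] =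
  lebesgue_measure A * m B.
Proof.
move=> mA mB; rewrite -product_measure1E//; congr (_ \x _).
apply/seteqP; split => -[a b] /=; rewrite mxE unlift_none => -[? H];
  split => //; move: H; congr B; apply/rowP => i; rewrite !mxE liftK//.
Qed.

Let lebesgue_step_sigma_finite : sigma_finite setT lebesgue_step.
Proof.
have /sigma_finiteP[F [TF ndF Foo]] := sigma_finiteT (@lebesgue_measure R).
have /sigma_finiteP[G [TG ndG Goo]] := sigma_finiteT m.
exists (fun k => [set x : 'rV[R]_n.+1 | F k (x ord0 ord0) /\
                          G k (\row_i x ord0 (lift ord0 i))]).
  apply/esym; rewrite -subTset => x _.
  have [i _ Fi] : (\bigcup_k F k) (x ord0 ord0) by rewrite -TF.
  have [j _ Gj] : (\bigcup_k G k) (\row_i x ord0 (lift ord0 i)) by rewrite -TG.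
  exists (maxn i j) => //; split.
  - by move: Fi; exact/subsetPset/ndF/leq_maxl.
  - by move: Gj; exact/subsetPset/ndG/leq_maxr.
move=> k; have [? ?] := Foo k; have [? ?] := Goo k; split.
  apply: measurableI.
    rewrite -[X in measurable X]setTI.
    exact: (@measurable_coord _ (measurableTypeR R) n.+1 ord0).
  rewrite -[X in measurable X]setTI.
  apply: (_ : measurable_fun setT (fun x : 'rV[R]_n.+1 =>
     \row_i x ord0 (lift ord0 i))) => //.
  apply: measurable_fun_rVP => i; under eq_fun do rewrite mxE.
  exact: measurable_coord.
by rewrite lebesgue_stepX// lte_mul_pinfty// ge0_fin_numE.
Qed.

HB.instance Definition _ := Measure_isSigmaFinite.Build _ _ _ lebesgue_step
  lebesgue_step_sigma_finite.

End step.

(* d-dimensional Lebesgue measure, as an iterated product of [lebesgue_measure]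
   transported along R * 'rV_n -> 'rV_n.+1. *)
Fixpoint lebesgue_rV n : {sigma_finite_measure set 'rV[R]_n -> \bar R} :=
  match n with
  | 0 => \d_(0%R : 'rV[R]_0)
  | n.+1 => lebesgue_step (lebesgue_rV n)
  end.

End lebesgue_rV.

Local Open Scope complex_scope.
Local Notation normc := ComplexField.Normc.normc.

Section complex_valued.
Context {R : realType}.

Definition cexpi (t : R) : R[i] := cos t +i* sin t.

Context {d} {T : measurableType d}.

Definition cmeasurable (f : T -> R[i]) :=
  measurable_fun setT (fun x => complex.Re (f x)) /\
  measurable_fun setT (fun x => complex.Im (f x)).

Definition cintegral (mu : {measure set T -> \bar R}) (D : set T)
    (f : T -> R[i]) : R[i] :=
  (\int[mu]_(x in D) complex.Re (f x)) +i* (\int[mu]_(x in D) complex.Im (f x)).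

Definition sqnormL2 (mu : {measure set T -> \bar R}) (f : T -> R[i]) : \bar R :=
  (\int[mu]_x ((normc (f x)) ^+ 2)%:E)%E.

Definition square_integrable (mu : {measure set T -> \bar R})
    (f : T -> R[i]) :=
  cmeasurable f /\ (sqnormL2 mu f < +oo)%E.

Definition nonzeroL2 (mu : {measure set T -> \bar R}) (f : T -> R[i]) :=
  square_integrable mu f /\ ~ {ae mu, forall x, f x = 0}.

Definition expectationC (P : probability T R) (X : T -> R[i]) : R[i] :=
  cintegral P setT X.

Definition varianceC (P : probability T R) (X : T -> R[i]) : \bar R :=
  sqnormL2 P (fun w => X w - expectationC P X).

End complex_valued.

(* The unit circle, whose Borel sigma-algebra is generated by the real and
   imaginary parts. *)
Record circle (R : realType) := Circle {
  circle_val :> R[i] ;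
  circleP : normc circle_val == 1 }.

HB.instance Definition _ (R : realType) := [isSub for @circle_val R].
HB.instance Definition _ (R : realType) := [Choice of circle R by <:].

Section circle.
Context {R : realType}.

Definition circle1 : circle R :=
  Circle (introT eqP (@ComplexField.Normc.normc1 R)).

HB.instance Definition _ := isPointed.Build (circle R) circle1.

Let circle_Re (z : circle R) : measurableTypeR R := complex.Re (circle_val z).
Let circle_Im (z : circle R) : measurableTypeR R := complex.Im (circle_val z).

Let circle_set0 : g_sigma_preimageU circle_Re circle_Im set0.
Proof. exact: sigma_algebra0. Qed.

Let circle_setC A : g_sigma_preimageU circle_Re circle_Im A ->
  g_sigma_preimageU circle_Re circle_Im (~` A).
Proof. exact: sigma_algebraC. Qed.

Let circle_bigcup (F : _^nat) :
  (forall i, g_sigma_preimageU circle_Re circle_Im (F i)) ->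
  g_sigma_preimageU circle_Re circle_Im (\bigcup_i (F i)).
Proof. exact: sigma_algebra_bigcup. Qed.

HB.instance Definition _ := @isMeasurable.Build default_measure_display
  (circle R) (g_sigma_preimageU circle_Re circle_Im)
  circle_set0 circle_setC circle_bigcup.

Lemma normcV_circle (z : circle R) : normc (circle_val z)^-1 == 1.
Proof. by rewrite ComplexField.Normc.normcV (eqP (circleP z)) invr1. Qed.

Definition circleV (z : circle R) : circle R := Circle (normcV_circle z).

End circle.

(* The notions shared by R^d and Z^d: [Cb B] is the class of test functions on
   [E] supported in [B], and a random measure is represented by the map sending
   a function [f] on [E] to the random variable [M f]; only its values on test
   functions are meaningful. *)
Section interpolation.
Context {R : realType} {d} {Omega : measurableType d} (P : probability Omega R).
Context {E : Type} (Cb : set E -> (E -> R[i]) -> Prop).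
Implicit Type M : (E -> R[i]) -> Omega -> R[i].

Definition perfectly_interpolable M (A : set E) :=
  forall f, Cb (~` A) f ->
  exists h : (E -> R[i])^nat, (forall n, Cb A (h n)) /\
    sqnormL2 P (fun w => M (h n) w - M f w) @[n --> \oo] --> 0%E.

(* [M] need not have mean zero on R^d, and the spectral measure does not see
   the mean, so the characterization concerns f |-> M(f) - E[M(f)].  This is
   [M] itself as soon as E[M(f)] = 0 for all test functions f. *)
Definition centering M : (E -> R[i]) -> Omega -> R[i] :=
  fun f w => M f w - expectationC P (M f).

End interpolation.

Section euclidean.
Context {R : realType} {d : nat}.
Implicit Types (x u : 'rV[R]_d) (f : 'rV[R]_d -> R[i]).

Definition dot u x : R := \sum_(i < d) u ord0 i * x ord0 i.

Definition enorm u : R := Num.sqrt (dot u u).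

Definition Ccb (B : set 'rV[R]_d) f :=
  [/\ cmeasurable f,
      exists K : R, forall x, normc (f x) <= K,
      bounded_set [set x | f x != 0] &
      forall x, ~ B x -> f x = 0].

Definition shift_rV x f : 'rV[R]_d -> R[i] := fun y => f (y - x).

Definition fourier f : 'rV[R]_d -> R[i] :=
  fun u => cintegral (lebesgue_rV d) setT (fun x => cexpi (- dot u x) * f x).

Section random_measure.
Context {dO} {Omega : measurableType dO} (P : probability Omega R).
Variable M : ('rV[R]_d -> R[i]) -> Omega -> R[i].

(* By the Jordan decomposition, the complex measures on [K] are the
   combinations (mu1 - mu2) + i (mu3 - mu4) of finite measures. *)
Definition induces_complex_measures (w : Omega) :=
  forall K : set 'rV[R]_d, compact K ->
  exists mu1 mu2 mu3 mu4 : {finite_measure set 'rV[R]_d -> \bar R},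
  forall f, Ccb K f ->
    M f w = cintegral mu1 K f - cintegral mu2 K f
            + 'i * (cintegral mu3 K f - cintegral mu4 K f).

Definition weakly_stationary_measure :=
  [/\ forall f, Ccb setT f -> square_integrable P (M f),
      {ae P, forall w, induces_complex_measures w} &
      forall f x, Ccb setT f ->
        varianceC P (M (shift_rV x f)) = varianceC P (M f)].

(* The integrability condition is implied by the variance formula; it makes
   [phi S] a tempered distribution for every [phi] in L^2(S). *)
Definition spectral_measure (S : {measure set 'rV[R]_d -> \bar R}) :=
  [/\ forall B : set 'rV[R]_d, measurable B -> S [set u | B (- u)] = S B,
      (\int[S]_u ((1 + enorm u) ^- d.+1)%:E < +oo)%E &
      forall f, Ccb setT f -> varianceC P (M f) =
        (((2 * pi) ^- d)%:E * sqnormL2 S (fourier f))%E].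

End random_measure.

(* Tempered distributions are represented by functionals whose values matter
   only on smooth, rapidly decreasing functions. *)
Definition distribution_of (phi : 'rV[R]_d -> R[i])
    (S : {measure set 'rV[R]_d -> \bar R}) : ('rV[R]_d -> R[i]) -> R[i] :=
  fun psi => cintegral S setT (fun u => psi u * phi u).

Definition fourier_distribution (D : ('rV[R]_d -> R[i]) -> R[i]) :
  ('rV[R]_d -> R[i]) -> R[i] := fun psi => D (fourier psi).

(* C^oo: the iterated partial derivatives of all orders exist and are
   continuous. *)
Definition partial (s : seq 'I_d) (f : 'rV[R]_d -> R) : 'rV[R]_d -> R :=
  foldr (fun i g => 'D_(delta_mx ord0 i) g) f s.

Definition smooth (f : 'rV[R]_d -> R) := forall s : seq 'I_d,
  continuous (partial s f) /\
  forall i x, derivable (partial s f) x (delta_mx ord0 i).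

Definition test_function (U : set 'rV[R]_d) (psi : 'rV[R]_d -> R[i]) :=
  [/\ smooth (fun x => complex.Re (psi x)), smooth (fun x => complex.Im (psi x)),
      compact (closure [set x | psi x != 0]) &
      closure [set x | psi x != 0] `<=` U].

(* [x] lies outside the support iff [D] vanishes on some open neighbourhood
   of [x]. *)
Definition support_distribution (D : ('rV[R]_d -> R[i]) -> R[i]) :
  set 'rV[R]_d :=
  [set x | forall U, open U -> U x -> exists2 psi, test_function U psi &
     D psi != 0].

Definition Sp (phi : 'rV[R]_d -> R[i]) (S : {measure set 'rV[R]_d -> \bar R}) :=
  support_distribution (fourier_distribution (distribution_of phi S)).

End euclidean.

Section lattice.
Context {R : realType} {d : nat}.
Implicit Types (k m : 'rV[int]_d) (u : 'rV[circle R]_d)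
  (f : 'rV[int]_d -> R[i]).

Definition Ccb_lattice (B : set 'rV[int]_d) f :=
  finite_set [set m | f m != 0] /\ forall m, ~ B m -> f m = 0.

Definition shift_lattice m f : 'rV[int]_d -> R[i] := fun k => f (k - m).

Definition torus_exp u k : R[i] :=
  \prod_(j < d) circle_val (u ord0 j) ^ (k ord0 j).

Definition fourier_lattice f : 'rV[circle R]_d -> R[i] :=
  fun u => \sum_(k \in setT) torus_exp u k * f k.

Section random_field.
Context {dO} {Omega : measurableType dO} (P : probability Omega R).
Variable M : 'rV[int]_d -> Omega -> R[i].

Definition field_measure : ('rV[int]_d -> R[i]) -> Omega -> R[i] :=
  fun f w => \sum_(m \in setT) M m w * f m.

Definition weakly_stationary_field :=
  [/\ forall m, square_integrable P (M m),
      forall m, expectationC P (M m) = 0 &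
      forall f m, Ccb_lattice setT f ->
        varianceC P (field_measure (shift_lattice m f)) =
        varianceC P (field_measure f)].

Definition spectral_measure_lattice
    (S : {measure set 'rV[circle R]_d -> \bar R}) :=
  [/\ forall B : set 'rV[circle R]_d, measurable B ->
        S [set u | B (map_mx circleV u)] = S B,
      (S setT < +oo)%E &
      forall f, Ccb_lattice setT f -> varianceC P (field_measure f) =
        (((2 * pi) ^- d)%:E * sqnormL2 S (fourier_lattice f))%E].

End random_field.

Definition Sp_lattice (phi : 'rV[circle R]_d -> R[i])
    (S : {measure set 'rV[circle R]_d -> \bar R}) : set 'rV[int]_d :=
  [set m | cintegral S setT (fun u => torus_exp u m * phi u) != 0].

End lattice.

(* Main.v *)
From HB Require Import structures.
Require Import Defs.
From mathcomp Require Import all_boot all_order all_algebra.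
From mathcomp Require Import all_classical all_reals all_analysis.
From mathcomp.real_closed Require Import complex.
From mathcomp Require Import measurable_realfun ring lra.

(** By the variance formula, M is perfectly interpolable from A iff every f^ with f
    supported off A lies in the closure in L^2(S) of {h^ : h supported in A}; by
    projection in L^2(S), what matters are the phi in L^2(S) such that
    L(h) := int h^ phi dS vanishes for all h supported in A.

    On Z^d, L(h) is a finite combination of Fourier coefficients of phi S, so L
    vanishes on the h supported in A iff Sp(phi S) misses A; if M is interpolable
    from A, then all coefficients vanish by density, and phi = 0.

    On R^d with A open, the test functions on A are among the h, so Sp(phi S)
    misses A whenever L vanishes on A.  Conversely, suppose that Sp(phi S) misses A
    and let W be its open complement, so that L(psi) = 0 for test functions psi
    supported near any point of W.  To pass to bounded measurable functions one
    needs L to be closed under bounded pointwise limits with common bounded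
    support: for such (h_n), the h_n^ are bounded in L^2(S) by a gliding hump
    argument (every series sum_i +-4^-i h_(s i) has its transform in L^2(S)), and
    boundedness with pointwise convergence gives weak convergence.  Smooth bumps
    then yield indicators of boxes, and monotone classes yield L = 0 on all
    functions supported in W.  Interpolability adds those supported off W, so that
    L = 0.  Testing with translates of indicators of small cubes shows that
    the measure f^ phi S has zero Fourier transform, hence phi = 0. *)

Set Implicit Arguments.
Unset Strict Implicit.
Unset Printing Implicit Defensive.
Import Order.TTheory GRing.Theory Num.Theory.
Import numFieldNormedType.Exports.
Local Open Scope classical_set_scope.
Local Open Scope ring_scope.
Local Open Scope complex_scope.
Local Notation normc := ComplexField.Normc.normc.
Local Notation Re := complex.Re.
Local Notation Im := complex.Im.

(** * Complex-valued functions and L^2 *)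

Section complex_arith.
Context {R : realType}.
Implicit Types z w : R[i].

(** The obstacle on R^d is that test functions are merely bounded and measurable while S may be
    infinite. The transform of such an f need not decay fast enough for the integrability condition
    on S to put it in L^2(S); that it lies there is known only from the variance formula, one f at a
    time and without any estimate. This is why a uniform boundedness argument stands where dominated
    convergence would be expected, and why only weak limits are sought: it is enough that the
    pairings with phi pass to the limit.

    Openness of A is a genuine restriction in the converse on R^d. If M is X times Lebesgue measure,
    with X a nonzero centred random variable, then S is a multiple of the unit mass at 0, and Sp(phi
    S) is the whole of R^d for every nonzero phi; yet a nonempty Lebesgue-null set A carries no
    information on M. *)

Definition csq z : R := Re z ^+ 2 + Im z ^+ 2.

Lemma normc_sqr z : normc z ^+ 2 = csq z.
Proof. by case: z => a b; rewrite /normc sqr_sqrtr// addr_ge0// sqr_ge0. Qed.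

Lemma csq_ge0 z : 0 <= csq z.
Proof. by rewrite addr_ge0// sqr_ge0. Qed.

Lemma cReD z w : Re (z + w) = Re z + Re w. Proof. by case: z; case: w. Qed.
Lemma cImD z w : Im (z + w) = Im z + Im w. Proof. by case: z; case: w. Qed.
Lemma cReN z : Re (- z) = - Re z. Proof. by case: z. Qed.
Lemma cImN z : Im (- z) = - Im z. Proof. by case: z. Qed.
Lemma cReB z w : Re (z - w) = Re z - Re w. Proof. by rewrite cReD cReN. Qed.
Lemma cImB z w : Im (z - w) = Im z - Im w. Proof. by rewrite cImD cImN. Qed.
Lemma cReM z w : Re (z * w) = Re z * Re w - Im z * Im w.
Proof. by case: z; case: w. Qed.
Lemma cImM z w : Im (z * w) = Re z * Im w + Im z * Re w.
Proof. by case: z; case: w => * /=; rewrite addrC. Qed.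

Definition ReImE := (cReB, cImB, cReD, cImD, cReN, cImN, cReM, cImM).

Lemma complex_eqP z w : Re z = Re w -> Im z = Im w -> z = w.
Proof. by case: z; case: w => a b c d /= -> ->. Qed.

Lemma csqM z w : csq (z * w) = csq z * csq w.
Proof. by rewrite /csq !ReImE; ring. Qed.

Lemma csqD_le z w : csq (z + w) <= 2 * csq z + 2 * csq w.
Proof.
rewrite /csq !ReImE -subr_ge0.
rewrite (_ : _ - _ = (Re z - Re w) ^+ 2 + (Im z - Im w) ^+ 2); last by ring.
by rewrite addr_ge0// sqr_ge0.
Qed.

Lemma csqN z : csq (- z) = csq z.
Proof. by rewrite /csq !ReImE !sqrrN. Qed.

Lemma normr_Re_le z : `|Re z| <= normc z.
Proof.
rewrite -ler_sqr ?nnegrE//; last by case: z => a b; rewrite sqrtr_ge0.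
by rewrite real_normK ?num_real// normc_sqr lerDl sqr_ge0.
Qed.

Lemma normr_Im_le z : `|Im z| <= normc z.
Proof.
rewrite -ler_sqr ?nnegrE//; last by case: z => a b; rewrite sqrtr_ge0.
by rewrite real_normK ?num_real// normc_sqr lerDr sqr_ge0.
Qed.

Lemma normc_ge0 z : 0 <= normc z.
Proof. by case: z => a b; exact: sqrtr_ge0. Qed.

Lemma Re_mulC (a : R) z : Re (a%:C * z) = a * Re z.
Proof. by rewrite cReM mul0r subr0. Qed.

Lemma Im_mulC (a : R) z : Im (a%:C * z) = a * Im z.
Proof. by rewrite cImM mul0r addr0. Qed.

Lemma normcC (a : R) : normc a%:C = `|a|.
Proof. by rewrite /normc/= expr0n addr0 sqrtr_sqr. Qed.

Lemma normc_le_csq z K : 0 <= K -> (normc z <= K) = (csq z <= K ^+ 2).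
Proof. by move=> K0; rewrite -normc_sqr ler_sqr// nnegrE// normc_ge0. Qed.

Lemma cvg_csq (h : nat -> R[i]) z : Re (h n) @[n --> \oo] --> Re z ->
  Im (h n) @[n --> \oo] --> Im z -> csq (h n) @[n --> \oo] --> csq z.
Proof. by move=> h1 h2; exact: (cvgD (cvgM h1 h1) (cvgM h2 h2)). Qed.

Lemma cvg_normc_le (h : nat -> R[i]) z K : (forall n, normc (h n) <= K) ->
  Re (h n) @[n --> \oo] --> Re z -> Im (h n) @[n --> \oo] --> Im z -> normc z <= K.
Proof.
move=> hK h1 h2; have K0 : 0 <= K by exact: le_trans (normc_ge0 _) (hK 0%N).
have c := cvg_csq h1 h2; rewrite normc_le_csq// -(cvg_lim _ c)//; apply: limr_le.
  by apply/cvg_ex; eexists; exact: c.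
by apply: nearW => n; rewrite -normc_le_csq.
Qed.
End complex_arith.

Section complex_integrals.
Context {R : realType} {d} {T : measurableType d}.
Implicit Types (mu : {measure set T -> \bar R}) (f g : T -> R[i]) (D : set T).

Lemma cmeasurable_cst (c : R[i]) : cmeasurable (fun _ : T => c).
Proof. by split; exact: measurable_cst. Qed.

Lemma cmeasurableD f g : cmeasurable f -> cmeasurable g ->
  cmeasurable (fun x => f x + g x).
Proof.
move=> [f1 f2] [g1 g2]; split; under eq_fun do rewrite ?cReD ?cImD;
  exact: measurable_funD.
Qed.

Lemma cmeasurableM f g : cmeasurable f -> cmeasurable g ->
  cmeasurable (fun x => f x * g x).
Proof.
move=> [f1 f2] [g1 g2]; split; under eq_fun do rewrite ?cReM ?cImM.
  by apply: measurable_funB; exact: measurable_funM.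
by apply: measurable_funD; exact: measurable_funM.
Qed.

Lemma cmeasurableZ (c : R[i]) f : cmeasurable f -> cmeasurable (fun x => c * f x).
Proof. by move=> mf; apply: cmeasurableM => //; exact: cmeasurable_cst. Qed.

Lemma cmeasurableN f : cmeasurable f -> cmeasurable (fun x => - f x).
Proof.
by move=> mf; under eq_fun do rewrite -mulN1r; exact: cmeasurableZ.
Qed.

Lemma cmeasurableB f g : cmeasurable f -> cmeasurable g ->
  cmeasurable (fun x => f x - g x).
Proof. by move=> mf mg; apply: cmeasurableD => //; exact: cmeasurableN. Qed.

Lemma cmeasurableC (f : T -> R) : measurable_fun setT f ->
  cmeasurable (fun x => (f x)%:C).
Proof. by move=> mf; split => //=; exact: measurable_cst. Qed.

Lemma cmeasurable_indic D : measurable D -> cmeasurable (fun x => (\1_D x : R)%:C).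
Proof. by move=> mD; apply: cmeasurableC; exact: measurable_indic. Qed.

Lemma measurable_csq f : cmeasurable f -> measurable_fun setT (fun x => csq (f x)).
Proof.
by move=> [f1 f2]; apply: measurable_funD; exact: measurable_funX.
Qed.

Lemma cmeasurable_sum I (s : seq I) (f : I -> T -> R[i]) :
  (forall i, cmeasurable (f i)) -> cmeasurable (fun x => \sum_(i <- s) f i x).
Proof.
move=> mf; elim: s => [|i s ih].
  by under eq_fun do rewrite big_nil; exact: cmeasurable_cst.
by under eq_fun do rewrite big_cons; exact: cmeasurableD.
Qed.

Lemma cmeasurable_lim (f : nat -> T -> R[i]) g : (forall n, cmeasurable (f n)) ->
  (forall x, Re (f n x) @[n --> \oo] --> Re (g x)) ->
  (forall x, Im (f n x) @[n --> \oo] --> Im (g x)) -> cmeasurable g.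
Proof.
move=> mf f1 f2; split.
- apply: (measurable_fun_cvg (h := fun n x => Re (f n x))) => //.
  by move=> n; have [] := mf n.
- apply: (measurable_fun_cvg (h := fun n x => Im (f n x))) => //.
  by move=> n; have [] := mf n.
Qed.

Lemma measurable_csqE D f : cmeasurable f ->
  measurable_fun D (fun x => (csq (f x))%:E).
Proof.
by move=> mf; apply/measurable_EFinP; apply: measurable_funTS; exact: measurable_csq.
Qed.

Definition cintegrable mu D f :=
  mu.-integrable D (EFin \o (fun x => Re (f x))) /\
  mu.-integrable D (EFin \o (fun x => Im (f x))).

Lemma cintegralD mu D f g : measurable D ->
  cintegrable mu D f -> cintegrable mu D g ->
  cintegral mu D (fun x => f x + g x) = cintegral mu D f + cintegral mu D g.
Proof.
move=> mD [f1 f2] [g1 g2]; rewrite /cintegral.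
apply: complex_eqP; rewrite ?cReD ?cImD /=.
  by rewrite -RintegralD//; apply: eq_Rintegral => x _; rewrite cReD.
by rewrite -RintegralD//; apply: eq_Rintegral => x _; rewrite cImD.
Qed.

Lemma cintegrableD mu D f g : measurable D ->
  cintegrable mu D f -> cintegrable mu D g ->
  cintegrable mu D (fun x => f x + g x).
Proof.
move=> mD [f1 f2] [g1 g2]; split.
  rewrite (_ : _ \o _ = (EFin \o (fun x => Re (f x))) \+ (EFin \o (fun x => Re (g x)))).
    exact: integrableD.
  by apply/funext => x /=; rewrite cReD.
rewrite (_ : _ \o _ = (EFin \o (fun x => Im (f x))) \+ (EFin \o (fun x => Im (g x)))).
  exact: integrableD.
by apply/funext => x /=; rewrite cImD.
Qed.

Lemma integrable_lin mu D (a b : R) (f g : T -> R) : measurable D ->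
  mu.-integrable D (EFin \o f) -> mu.-integrable D (EFin \o g) ->
  mu.-integrable D (EFin \o (fun x => a * f x + b * g x)).
Proof.
move=> mD f1 g1.
rewrite (_ : _ \o _ = (fun x => (a%:E * (EFin \o f) x)%E) \+ (fun x => (b%:E * (EFin \o g) x)%E)).
  by apply: integrableD => //; exact: integrableZl.
by apply/funext => x.
Qed.

Lemma Rintegral_lin mu D (a b : R) (f g : T -> R) : measurable D ->
  mu.-integrable D (EFin \o f) -> mu.-integrable D (EFin \o g) ->
  (\int[mu]_(x in D) (a * f x + b * g x) =
   a * \int[mu]_(x in D) f x + b * \int[mu]_(x in D) g x)%R.
Proof.
move=> mD f1 g1; rewrite RintegralD//.
- by rewrite !RintegralZl.
- by have := integrableZl mD a f1; exact: eq_integrable.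
- by have := integrableZl mD b g1; exact: eq_integrable.
Qed.

Lemma cintegrableZ mu D (c : R[i]) f : measurable D ->
  cintegrable mu D f -> cintegrable mu D (fun x => c * f x).
Proof.
move=> mD [f1 f2]; split.
  have := integrable_lin (Re c) (- Im c) mD f1 f2.
  by apply: eq_integrable => // x _ /=; rewrite cReM mulNr.
have := integrable_lin (Re c) (Im c) mD f2 f1.
by apply: eq_integrable => // x _ /=; rewrite cImM.
Qed.

Lemma cintegralZ mu D (c : R[i]) f : measurable D -> cintegrable mu D f ->
  cintegral mu D (fun x => c * f x) = c * cintegral mu D f.
Proof.
move=> mD [f1 f2]; apply: complex_eqP; rewrite ?cReM ?cImM /=.
  rewrite -mulNr -Rintegral_lin//.
  by apply: eq_Rintegral => x _; rewrite cReM mulNr.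
rewrite -Rintegral_lin//.
by apply: eq_Rintegral => x _; rewrite cImM.
Qed.

Lemma cintegrableN mu D f : measurable D ->
  cintegrable mu D f -> cintegrable mu D (fun x => - f x).
Proof.
by move=> mD mf; under eq_fun do rewrite -mulN1r; exact: cintegrableZ.
Qed.

Lemma cintegralB mu D f g : measurable D ->
  cintegrable mu D f -> cintegrable mu D g ->
  cintegral mu D (fun x => f x - g x) = cintegral mu D f - cintegral mu D g.
Proof.
move=> mD mf mg; rewrite cintegralD//; last exact: cintegrableN.
by congr (_ + _); rewrite -[in RHS]mulN1r -cintegralZ//; congr cintegral;
  apply/funext => x; rewrite mulN1r.
Qed.

End complex_integrals.

Ltac energy_side := solve
  [ by move=> ? _; rewrite ?mule_ge0 ?lee_fin ?csq_ge0
  | by repeat first [apply: emeasurable_funD | apply: measurable_funeM];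
    apply: measurable_csqE; repeat first [assumption|exact: cmeasurableD|exact: cmeasurableB] ].

Section energy.
Context {R : realType} {d} {T : measurableType d}.
Implicit Types (mu : {measure set T -> \bar R}) (f g : T -> R[i]) (D : set T).

(** The squared L^2 norm over [D], written with [csq] so that pointwise estimates are polynomial in
    real and imaginary parts. The domain is a parameter because the gliding hump argument cuts down
    to sets of finite measure. *)
Definition energy mu D f : \bar R := (\int[mu]_(x in D) (csq (f x))%:E)%E.

Lemma sqnormL2E mu f : sqnormL2 mu f = energy mu setT f.
Proof. by apply: eq_integral => x _; rewrite normc_sqr. Qed.

Lemma energy_ge0 mu D f : (0 <= energy mu D f)%E.
Proof. by apply: integral_ge0 => x _; rewrite lee_fin csq_ge0. Qed.

(** The weights are free so that one estimate serves both |f + g|^2 <= 2|f|^2 + 2|g|^2 and the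
    unbalanced split with weights 4/3 and 4 used for geometric tails. *)
Lemma energy_linear_le mu D f g h (a b : R) : measurable D ->
  0 <= a -> 0 <= b -> cmeasurable f -> cmeasurable g -> cmeasurable h ->
  (forall x, D x -> csq (h x) <= a * csq (f x) + b * csq (g x)) ->
  (energy mu D h <= a%:E * energy mu D f + b%:E * energy mu D g)%E.
Proof.
move=> mD a0 b0 mf mg mh fgh.
rewrite /energy -!ge0_integralZl//; try energy_side.
rewrite -ge0_integralD//; try energy_side.
apply: ge0_le_integral => //.
all: try energy_side.
Qed.

Lemma energyD_le mu D f g : measurable D -> cmeasurable f -> cmeasurable g ->
  (energy mu D (fun x => (f x + g x)%R) <=
   2%:E * energy mu D f + 2%:E * energy mu D g)%E.
Proof.
move=> mD mf mg; apply: energy_linear_le => //; first exact: cmeasurableD.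
by move=> x _; exact: csqD_le.
Qed.

Lemma energyZ mu D f (c : R[i]) : measurable D -> cmeasurable f ->
  energy mu D (fun x => (c * f x)%R) = ((csq c)%:E * energy mu D f)%E.
Proof.
move=> mD mf; rewrite /energy -ge0_integralZl//; try energy_side; last by rewrite lee_fin csq_ge0.
by apply: eq_integral => x _; rewrite csqM EFinM.
Qed.

Lemma energyN mu D f : energy mu D (fun x => - f x) = energy mu D f.
Proof. by apply: eq_integral => x _; rewrite csqN. Qed.

Lemma energy_parallelogram mu D f g : measurable D ->
  cmeasurable f -> cmeasurable g ->
  (energy mu D (fun x => (f x + g x)%R) + energy mu D (fun x => (f x - g x)%R) =
   2%:E * energy mu D f + 2%:E * energy mu D g)%E.
Proof.
move=> mD mf mg; rewrite /energy -!ge0_integralZl//; try energy_side.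
rewrite -!ge0_integralD//; try energy_side.
by apply: eq_integral => x _; rewrite -!EFinM -!EFinD /csq !ReImE; congr EFin; ring.
Qed.

(** Fatou's lemma: the squared moduli converge pointwise, so their limit inferior is the squared
    modulus of the limit. The bound is asked for large n only, because it is applied to differences
    with a fixed term, which are controlled beyond that term. *)
Lemma energy_fatou mu D (f : nat -> T -> R[i]) g (C : R) : measurable D ->
  (forall n, cmeasurable (f n)) ->
  (forall x, D x -> Re (f n x) @[n --> \oo] --> Re (g x)) ->
  (forall x, D x -> Im (f n x) @[n --> \oo] --> Im (g x)) ->
  (\forall n \near \oo, (energy mu D (f n) <= C%:E)%E) -> (energy mu D g <= C%:E)%E.
Proof.
move=> mD mf f1 f2 [N _ fC].
have h x : D x -> limn_einf (fun n => (csq (f n x))%:E) = (csq (g x))%:E.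
  move=> Dx; suff : (csq (f n x))%:E @[n --> \oo] --> (csq (g x))%:E.
    by move/cvg_limn_einf_sup => [].
  apply: cvg_EFin; first by near=> n.
  exact: cvg_csq (f1 x Dx) (f2 x Dx).
have := @fatou _ _ _ mu D mD (fun n x => (csq (f n x))%:E)
  (fun n => measurable_csqE (mf n)).
have p n x : D x -> (0 <= (csq (f n x))%:E)%E by rewrite lee_fin csq_ge0.
move=> /(_ p); rewrite (eq_integral (fun x => (csq (g x))%:E)); last first.
  by move=> x; rewrite inE => /h.
move=> /le_trans; apply; rewrite limn_einf_lim; apply: lime_le.
  exact: is_cvg_einfs.
apply: nearW => n; apply: le_trans (fC (maxn n N) _); last exact: leq_maxr.
by apply: ereal_inf_lbound; exists (maxn n N) => //=; exact: leq_maxl.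
Unshelve. all: by end_near.
Qed.

Lemma square_integrableP mu f :
  square_integrable mu f <-> cmeasurable f /\ (energy mu setT f < +oo)%E.
Proof. by rewrite /square_integrable sqnormL2E. Qed.

Lemma square_integrableD mu f g : square_integrable mu f ->
  square_integrable mu g -> square_integrable mu (fun x => f x + g x).
Proof.
move=> /square_integrableP[mf f2] /square_integrableP[mg g2].
apply/square_integrableP; split; first exact: cmeasurableD.
apply: le_lt_trans (energyD_le mu measurableT mf mg) _.
by rewrite lte_add_pinfty// lte_mul_pinfty.
Qed.

Lemma square_integrableZ mu c f : square_integrable mu f ->
  square_integrable mu (fun x => c * f x).
Proof.
move=> /square_integrableP[mf f2]; apply/square_integrableP.
split; first exact: cmeasurableZ.
by rewrite energyZ// lte_mul_pinfty// lee_fin csq_ge0.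
Qed.

Lemma square_integrableN mu f : square_integrable mu f ->
  square_integrable mu (fun x => - f x).
Proof. by move=> h; under eq_fun do rewrite -mulN1r; exact: square_integrableZ. Qed.

Lemma square_integrableB mu f g : square_integrable mu f ->
  square_integrable mu g -> square_integrable mu (fun x => f x - g x).
Proof. by move=> hf hg; apply: square_integrableD => //; exact: square_integrableN. Qed.

Lemma integrable_csq mu D f : measurable D -> cmeasurable f ->
  (energy mu D f < +oo)%E -> mu.-integrable D (EFin \o (fun x => csq (f x))).
Proof.
move=> mD mf foo; apply/integrableP; split; first exact: measurable_csqE.
by under eq_integral do rewrite /= ger0_norm ?csq_ge0//.
Qed.

(** Each product of two real coordinates is bounded by completing the square t (p - q/t)^2 >= 0.
    With t free this replaces the Cauchy-Schwarz inequality: a small energy of one factor makes the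
    integral of the product small, and no square roots of energies appear. *)
Lemma young_ReIm (z w : R[i]) (t : R) : 0 < t ->
  `|Re (z * w)| <= t * csq z + t^-1 * csq w /\
  `|Im (z * w)| <= t * csq z + t^-1 * csq w.
Proof.
move=> t0; have ti0 : 0 < t^-1 by rewrite invr_gt0.
have tt : t * t^-1 = 1 by rewrite mulfV// gt_eqF.
rewrite !ReImE /csq; move: (Re z) (Im z) (Re w) (Im w) => a b c e.
have sq (p q : R) : 2 * (p * q) <= t * p ^+ 2 + t^-1 * q ^+ 2.
  rewrite -subr_ge0 (_ : _ - _ = t * (p - t^-1 * q) ^+ 2).
    by rewrite mulr_ge0 ?sqr_ge0// ltW.
  transitivity (t * p ^+ 2 - 2 * (t * t^-1) * (p * q) + (t * t^-1) * t^-1 * q ^+ 2).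
    by rewrite tt; ring.
  by ring.
have nsq (p q : R) : - (2 * (p * q)) <= t * p ^+ 2 + t^-1 * q ^+ 2.
  by have := sq (- p) q; rewrite sqrrN mulNr mulrN.
have pos (p : R) : 0 <= t * p ^+ 2 by rewrite mulr_ge0 ?sqr_ge0// ltW.
have pos' (p : R) : 0 <= t^-1 * p ^+ 2 by rewrite mulr_ge0 ?sqr_ge0// ltW.
rewrite !ler_norml; split; apply/andP; split;
  have := sq a c; have := nsq a c; have := sq b e; have := nsq b e;
  have := sq a e; have := nsq a e; have := sq b c; have := nsq b c;
  have := pos a; have := pos b; have := pos' c; have := pos' e; lra.
Qed.

Lemma cintegrableM mu D f g : measurable D -> cmeasurable f -> cmeasurable g ->
  (energy mu D f < +oo)%E -> (energy mu D g < +oo)%E ->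
  cintegrable mu D (fun x => f x * g x).
Proof.
move=> mD mf mg foo goo.
have [m1 m2] := cmeasurableM mf mg.
(* The coefficients are those of Young's inequality at t = 1. *)
have h := integrable_lin 1 1^-1 mD (integrable_csq mD mf foo) (integrable_csq mD mg goo).
split.
  apply: le_integrable h => //; first exact/measurable_EFinP/measurable_funTS.
  move=> x _ /=; rewrite lee_fin; have [/le_trans + _] := young_ReIm (f x) (g x) ltr01.
  by apply; rewrite ler_norm.
apply: le_integrable h => //; first exact/measurable_EFinP/measurable_funTS.
move=> x _ /=; rewrite lee_fin; have [_ /le_trans] := young_ReIm (f x) (g x) ltr01.
by apply; rewrite ler_norm.
Qed.

Lemma cintegral_young mu D f g (t a b : R) : measurable D -> 0 < t ->
  cmeasurable f -> cmeasurable g ->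
  (energy mu D f <= a%:E)%E -> (energy mu D g <= b%:E)%E ->
  `|Re (cintegral mu D (fun x => f x * g x))| <= t * a + t^-1 * b /\
  `|Im (cintegral mu D (fun x => f x * g x))| <= t * a + t^-1 * b.
Proof.
move=> mD t0 mf mg fa gb.
have foo : (energy mu D f < +oo)%E by rewrite (le_lt_trans fa) ?ltry.
have goo : (energy mu D g < +oo)%E by rewrite (le_lt_trans gb) ?ltry.
have [i1 i2] := cintegrableM mD mf mg foo goo.
have if_ := integrable_csq mD mf foo; have ig := integrable_csq mD mg goo.
have h := integrable_lin t t^-1 mD if_ ig.
have hb : (\int[mu]_(x in D) (t * csq (f x) + t^-1 * csq (g x)))%R <= t * a + t^-1 * b.
  rewrite Rintegral_lin//; apply: lerD; apply: ler_wpM2l.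
  - exact: ltW.
  - by rewrite -lee_fin fineK// ge0_fin_numE ?energy_ge0.
  - by rewrite invr_ge0 ltW.
  - by rewrite -lee_fin fineK// ge0_fin_numE ?energy_ge0.
split; (apply: le_trans hb; apply: le_trans (le_normr_Rintegral mD _) _ => //;
  apply: le_Rintegral => // [|x _]; [exact: integrable_norm| ]).
  by have [] := young_ReIm (f x) (g x) t0.
by have [] := young_ReIm (f x) (g x) t0.
Qed.

Lemma cReJ (z : R[i]) : Re z^* = Re z. Proof. by case: z. Qed.
Lemma cImJ (z : R[i]) : Im z^* = - Im z. Proof. by case: z. Qed.

Lemma csqJ (z : R[i]) : csq z^* = csq z.
Proof. by rewrite /csq cReJ cImJ sqrrN. Qed.

Lemma cmeasurableJ f : cmeasurable f -> cmeasurable (fun x => (f x)^*).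
Proof.
move=> [f1 f2]; split; first by under eq_fun do rewrite cReJ.
by under eq_fun do rewrite cImJ; exact: measurable_funN.
Qed.

Lemma square_integrableJ mu f :
  square_integrable mu f -> square_integrable mu (fun x => (f x)^*).
Proof.
move=> /square_integrableP[mf f2]; apply/square_integrableP.
split; first exact: cmeasurableJ.
by rewrite /energy; under eq_integral do rewrite csqJ.
Qed.

(** The integrand is the real part of f times the conjugate of g, the real inner product on which
    the projection argument relies. *)
Lemma integrable_dot mu f g : square_integrable mu f -> square_integrable mu g ->
  mu.-integrable setT (EFin \o (fun x => Re (f x) * Re (g x) + Im (f x) * Im (g x))).
Proof.
move=> f2 /square_integrableJ/square_integrableP[mg g2].
have /square_integrableP[mf {}f2] := f2.
have [+ _] := cintegrableM measurableT mf mg f2 g2.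
by apply: eq_integrable => // x _ /=; rewrite cReM cReJ cImJ mulrN opprK.
Qed.

End energy.

Section geometric_sums.
Context {R : realType}.

Lemma sum_half (N : nat) : \sum_(0 <= i < N) (2^-1 : R) ^+ i <= 2.
Proof.
suff -> : \sum_(0 <= i < N) (2^-1 : R) ^+ i = 2 - 2 * 2^-1 ^+ N.
  by rewrite gerBl mulr_ge0// exprn_ge0// invr_ge0.
elim: N => [|N ih]; first by rewrite big_geq// expr0; ring.
by rewrite big_nat_recr//= ih exprS; field.
Qed.

Lemma is_cvg_summable_diff (u : R^nat) (S : R) :
  (forall n, `|u n.+1 - u n| <= S * 2^-1 ^+ n) -> cvgn u.
Proof.
move=> uS; have S0 : 0 <= S.
  by have := uS 0%N; rewrite expr0 mulr1; apply: le_trans.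
have h : cvgn (series (telescope u)).
  apply: (@normed_cvg R R^o).
  apply: (@series_le_cvg R _ (geometric S 2^-1)) => [n|n|n|].
  - exact: normr_ge0.
  - by rewrite /geometric /= mulr_ge0// exprn_ge0// invr_ge0.
  - exact: uS.
  - by apply: is_cvg_geometric_series; rewrite ger0_norm ?invr_ge0// invf_lt1// ltr1n.
rewrite telescopeK in h.
rewrite (_ : u = (fun n => (u n - u 0%N) + u 0%N)).
  by apply: is_cvgD => //; exact: is_cvg_cst.
by apply/funext => n; rewrite subrK.
Qed.

End geometric_sums.

(** * Completeness of L^2 and orthogonal projection *)

Section completeness.
Context {R : realType} {d} {T : measurableType d}.
Variable mu : {measure set T -> \bar R}.
Implicit Types (f g : T -> R[i]).

Lemma energy_ae0 f : cmeasurable f -> {ae mu, forall x, f x = 0} ->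
  energy mu setT f = 0%E.
Proof.
move=> mf f0; rewrite /energy (@ge0_ae_eq_integral _ _ _ _ _ _ (cst 0%E))//.
- by rewrite integral0.
- exact: measurable_csqE.
- by move=> x _; rewrite lee_fin csq_ge0.
- by apply: filterS f0 => x -> _; rewrite /csq /= expr0n addr0.
Qed.

(** Riesz-Fischer with an explicit rate. The rate 8^-n leaves room twice: weighted by 4^n it is
    still summable, and divided by a Young weight 2^-n in the projection argument it still tends to
    0. *)
Lemma L2_complete (r : nat -> T -> R[i]) (C : R) : 0 <= C ->
  (forall n, square_integrable mu (r n)) ->
  (forall n m, (energy mu setT (fun x => (r n x - r m x)%R) <=
     (C * (8^-1 ^+ n + 8^-1 ^+ m))%:E)%E) ->
  exists l, square_integrable mu l /\
    forall n, (energy mu setT (fun x => (r n x - l x)%R) <=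
               (C * 2 * 8^-1 ^+ n)%:E)%E.
Proof.
move=> C0 r2 rC.
have mr n : cmeasurable (r n) by have [] := r2 n.
have q0 n : 0 <= (8^-1 : R) ^+ n by rewrite exprn_ge0// invr_ge0.
have q1 n m : (n <= m)%N -> (8^-1 : R) ^+ m <= 8^-1 ^+ n.
  by move=> nm; rewrite ler_wiXn2l ?invr_ge0// invf_le1// ler1n.
(* weighting the squared increments by 4^n still gives a summable series, and
   a <= (2^n a^2 + 2^-n)/2 turns this into geometric decay of the increments *)
pose t n x := ((4 ^+ n * csq (r n.+1 x - r n x))%R%:E : \bar R).
have mt n : measurable_fun setT (t n).
  apply/measurable_EFinP; apply: measurable_funM; first exact: measurable_cst.
  by apply: measurable_csq; exact: cmeasurableB.
have t0 n x : (0 <= t n x)%E by rewrite lee_fin mulr_ge0 ?csq_ge0// exprn_ge0.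
pose s x := (\sum_(0 <= n <oo) t n x)%E.
have ms : measurable_fun setT s by apply: ge0_emeasurable_sum.
have it n : (\int[mu]_x t n x <= (2 * C * 2^-1 ^+ n)%:E)%E.
  rewrite /t; under eq_integral do rewrite EFinM.
  rewrite ge0_integralZl//; try energy_side; try by rewrite lee_fin exprn_ge0.
  apply: le_trans (lee_wpmul2l _ (rC _ _)) _; first by rewrite lee_fin exprn_ge0.
  rewrite -EFinM lee_fin.
  have -> : 2 * C * 2^-1 ^+ n = 4 ^+ n * (C * (2 * 8^-1 ^+ n)).
    rewrite -(_ : 4 ^+ n * 8^-1 ^+ n = (2^-1 ^+ n : R)); first by ring.
    by rewrite -exprMn; congr (_ ^+ _); field.
  rewrite ler_wpM2l ?exprn_ge0// ler_wpM2l//.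
  by have := q1 _ _ (leqnSn n); lra.
have is_ : (\int[mu]_x s x <= (4 * C)%:E)%E.
  rewrite integral_nneseries//; apply: lime_le.
    by apply: is_cvg_nneseries => n _ _; apply: integral_ge0.
  apply: nearW => N; apply: (@le_trans _ _ (\sum_(0 <= n < N) (2 * C * 2^-1 ^+ n)%:E)%E).
    by apply: lee_sum => n _; exact: it.
  rewrite sumEFin lee_fin -mulr_sumr.
  have -> : 4 * C = 2 * C * 2 by ring.
  by rewrite ler_wpM2l ?mulr_ge0// sum_half.
have s0 x : (0 <= s x)%E by apply: nneseries_ge0 => n _ _.
have sint : mu.-integrable setT s.
  apply/integrableP; split => //.
  by under eq_integral do rewrite gee0_abs//; rewrite (le_lt_trans is_)// ltry.
have aes := integrable_ae measurableT sint.
(* The weighted series is finite off a null set. Setting the sequence to 0 elsewhere makes it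
   converge at every point, so that the limit is measurable as a pointwise limit. *)
pose Z := [set x | s x \is a fin_num].
have mZ : measurable Z by have := emeasurable_fin_num measurableT ms; rewrite setTI.
pose f n x : R[i] := (\1_Z x : R)%:C * r n x.
have mf n : cmeasurable (f n) by apply: cmeasurableM => //; exact: cmeasurable_indic.
have fZ n x : Z x -> f n x = r n x.
  by move=> Zx; rewrite /f indicE mem_set// mul1r.
have fNZ n x : ~ Z x -> f n x = 0.
  by move=> Zx; rewrite /f indicE memNset// mul0r.
have tle x n : Z x -> 4 ^+ n * csq (r n.+1 x - r n x) <= fine (s x).
  move=> Zx; rewrite -lee_fin fineK//.
  apply: le_trans (@nneseries_lim_ge _ _ xpredT 0%N n.+1 _); last by move=> k _ _; exact: t0.
  by rewrite big_nat_recr//= leeDr// sume_ge0.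
have dle (a S : R) n : 4 ^+ n * a ^+ 2 <= S -> `|a| <= (S + 1) * 2^-1 ^+ n.
  move=> aS; set w : R := 2 ^+ n; have w0 : 0 < w by rewrite exprn_gt0.
  have e4 : 4 ^+ n = w * w by rewrite -exprMn; congr (_ ^+ _); ring.
  rewrite e4 in aS.
  rewrite exprVn -/w ler_pdivlMr// -(ger0_norm (ltW w0)) -normrM ler_norml.
  have := sqr_ge0 (a * w - 1); have := sqr_ge0 (a * w + 1).
  have := sqr_ge0 (a * w).
  have -> : (a * w) ^+ 2 = w * w * a ^+ 2 by ring.
  rewrite -/w sqrrB sqrrD expr1n mulr1.
  have -> : (a * w) ^+ 2 = w * w * a ^+ 2 by ring.
  by move=> ? ? ?; apply/andP; split; lra.
have cvgRe x : cvgn (fun n => Re (f n x)).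
  have [Zx|Zx] := pselect (Z x); last first.
    by under eq_fun do rewrite fNZ//; exact: is_cvg_cst.
  apply: (@is_cvg_summable_diff _ _ (fine (s x) + 1)) => n; rewrite !fZ//.
  apply: dle; apply: le_trans (tle x n Zx); rewrite ler_wpM2l ?exprn_ge0//.
  by rewrite /csq cReB lerDl sqr_ge0.
have cvgIm x : cvgn (fun n => Im (f n x)).
  have [Zx|Zx] := pselect (Z x); last first.
    by under eq_fun do rewrite fNZ//; exact: is_cvg_cst.
  apply: (@is_cvg_summable_diff _ _ (fine (s x) + 1)) => n; rewrite !fZ//.
  apply: dle; apply: le_trans (tle x n Zx); rewrite ler_wpM2l ?exprn_ge0//.
  by rewrite /csq cImB lerDr sqr_ge0.
pose l x : R[i] := limn (fun n => Re (f n x)) +i* limn (fun n => Im (f n x)).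
have ml : cmeasurable l.
  by apply: (cmeasurable_lim mf) => x; [exact: cvgRe|exact: cvgIm].
have rl n : (energy mu setT (fun x => (r n x - l x)%R) <=
               (C * 2 * 8^-1 ^+ n)%:E)%E.
  have -> : energy mu setT (fun x => r n x - l x) = energy mu setT (fun x => f n x - l x).
    apply: ge0_ae_eq_integral => //; try energy_side.
    by apply: filterS aes => x /(_ I) Zx _; rewrite fZ.
  (* Fatou's lemma in m with n fixed; the Cauchy bound is used for m >= n, where 8^-n + 8^-m is at
     most twice 8^-n. *)
  apply: (@energy_fatou _ _ _ mu _ (fun m x => f n x - f m x)) => //.
  - by move=> m; exact: cmeasurableB.
  - move=> x _; under eq_fun do rewrite cReB; rewrite cReB.
    by apply: cvgB; [exact: cvg_cst|exact: cvgRe].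
  - move=> x _; under eq_fun do rewrite cImB; rewrite cImB.
    by apply: cvgB; [exact: cvg_cst|exact: cvgIm].
  - exists n => // m /= nm; apply: (@le_trans _ _ (energy mu setT (fun x => r n x - r m x))).
      apply: ge0_le_integral => //; try energy_side.
      move=> x _; rewrite lee_fin; have [Zx|Zx] := pselect (Z x).
        by rewrite !fZ.
      by rewrite !fNZ// subrr /csq /= expr0n addr0 csq_ge0.
    apply: le_trans (rC n m) _; rewrite lee_fin -mulrA ler_wpM2l//.
    by have := q1 _ _ nm; lra.
exists l; split=> //.
apply/square_integrableP; split => //.
have -> : l = (fun x => r 0%N x + - (r 0%N x - l x)).
  by apply/funext => x; rewrite opprB addrC subrK.
apply: le_lt_trans (energyD_le _ _ _ _) _ => //.
  by apply: cmeasurableN; exact: cmeasurableB.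
rewrite energyN lte_add_pinfty// lte_mul_pinfty//.
  by have /square_integrableP[] := r2 0%N.
by rewrite (le_lt_trans (rl 0%N))// ltry.
Qed.

End completeness.

Section projection.
Context {R : realType} {d} {T : measurableType d}.
Variable mu : {measure set T -> \bar R}.
Implicit Types (f g h : T -> R[i]).

(** A quadratic polynomial in the real parameter t, whose linear coefficient is twice the real inner
    product of h and f. When t = 0 is almost a minimum, this coefficient is forced to be small. *)
Lemma energyD_scale f h (t : R) : square_integrable mu f -> square_integrable mu h ->
  (energy mu setT (fun x => (f x + t%:C * h x)%R) =
   (fine (energy mu setT f) +
    2 * t * \int[mu]_x (Re (h x) * Re (f x) + Im (h x) * Im (f x)) +
    t ^+ 2 * fine (energy mu setT h))%R%:E)%E.
Proof.
move=> /square_integrableP[mf f2] /square_integrableP[mh h2].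
have i1 := integrable_csq measurableT mf f2.
have i2 := integrable_csq measurableT mh h2.
have i3 : mu.-integrable setT
    (EFin \o (fun x => Re (h x) * Re (f x) + Im (h x) * Im (f x))).
  by apply: integrable_dot; apply/square_integrableP.
rewrite /energy -[fine (integral mu setT (fun x => (csq (f x))%:E))]/(Rintegral mu setT (fun x => csq (f x))).
rewrite -[fine (integral mu setT (fun x => (csq (h x))%:E))]/(Rintegral mu setT (fun x => csq (h x))).
have i4 := integrable_lin (2 * t) (t ^+ 2) measurableT i3 i2.
have i5 := integrable_lin 1 1 measurableT i1 i4.
rewrite -addrA -(Rintegral_lin (2 * t) (t ^+ 2) measurableT i3 i2).
rewrite -[X in (X + _)%R]mul1r -[X in (_ + X)%R]mul1r -Rintegral_lin//.
rewrite /Rintegral fineK; last exact: integrable_fin_num i5.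
apply: eq_integral => x _; congr EFin; rewrite /csq !ReImE /=; ring.
Qed.

(** Projection theorem in dual form. For a sequence h_n in V minimizing the distance to g, the limit
    l of h_n - g is orthogonal to V, so its conjugate annihilates V; the last hypothesis then gives
    l = 0 almost everywhere, which says that h_n tends to g. *)
Lemma L2_orthogonal_dense (V : (T -> R[i]) -> Prop) g :
  V (fun=> 0) -> (forall f h, V f -> V h -> V (fun x => f x + h x)) ->
  (forall c f, V f -> V (fun x => c * f x)) ->
  (forall f, V f -> square_integrable mu f) -> square_integrable mu g ->
  (forall phi, square_integrable mu phi ->
    (forall h, V h -> cintegral mu setT (fun x => h x * phi x) = 0) ->
    {ae mu, forall x, phi x = 0}) ->
  exists h : nat -> T -> R[i], (forall n, V (h n)) /\
    energy mu setT (fun x => (h n x - g x)%R) @[n --> \oo] --> 0%E.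
Proof.
move=> V0 VD VZ V2 g2 orth0.
pose E f := fine (energy mu setT f).
have EK f : square_integrable mu f -> energy mu setT f = (E f)%:E.
  by move=> /square_integrableP[_ foo]; rewrite fineK// ge0_fin_numE// energy_ge0.
have E0 f : 0 <= E f by rewrite fine_ge0// energy_ge0.
pose D := [set E (fun x => h x - g x) | h in V].
have hD : has_inf D.
  split; first by exists (E (fun x => 0 - g x)), (fun=> 0).
  by exists 0 => _ [h _ <-].
have q0 n : 0 < (8^-1 : R) ^+ n by rewrite exprn_gt0// invr_gt0.
have /choice[h hP] n : exists h, V h /\ E (fun x => h x - g x) < inf D + 8^-1 ^+ n.
  by have [_ [h Vh <-] hlt] := inf_adherent (q0 n) hD; exists h.
have Vh n : V (h n) by have [] := hP n.
pose r n x := h n x - g x.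
have r2 n : square_integrable mu (r n) by apply: square_integrableB => //; exact: V2.
have mr n : cmeasurable (r n) by have [] := r2 n.
have Dle f : V f -> inf D <= E (fun x => f x - g x).
  by move=> Vf; apply: ge_inf => //; [case: hD|exists f].
have rC n m : (energy mu setT (fun x => (r n x - r m x)%R) <=
               (2 * (8^-1 ^+ n + 8^-1 ^+ m))%:E)%E.
  have := energy_parallelogram mu measurableT (mr n) (mr m).
  have s1 := square_integrableD (r2 n) (r2 m).
  have s2 := square_integrableB (r2 n) (r2 m).
  rewrite !EK// -!EFinM -!EFinD => -[e]; rewrite lee_fin.
  (* The midpoint of h_n and h_m lies in V, so its squared distance to g is at least inf D.
     Subtracting this in the parallelogram identity leaves only the excesses 8^-n and 8^-m. *)
  have := Dle _ (VZ (2^-1) _ (VD _ _ (Vh n) (Vh m))).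
  have -> : E (fun x => 2^-1 * (h n x + h m x) - g x) = 4^-1 * E (fun x => r n x + r m x).
    rewrite /E; have -> : (fun x => 2^-1 * (h n x + h m x) - g x) = (fun x => (2^-1)%:C * (r n x + r m x)).
      by apply/funext => x; rewrite /r fmorphV rmorphD rmorph1; field.
    rewrite energyZ//; last by have [] := s1.
    by rewrite EK//= /csq /= expr0n addr0; congr (_ * _); field.
  have [_] := hP n; have [_] := hP m; rewrite -/(r n) -/(r m); lra.
have [l [l2 rl]] := L2_complete (ler0n _ 2) r2 rC.
have ml : cmeasurable l by have [] := l2.
(* The pairing is bilinear, so orthogonality to l in the Hermitian sense is annihilation by the
   conjugate of l. *)
pose phi x := (l x)^*.
have phi2 : square_integrable mu phi by exact: square_integrableJ.
have mphi : cmeasurable phi by have [] := phi2.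
pose ip f k := (\int[mu]_x (Re (f x) * Re (k x) + Im (f x) * Im (k x)))%R.
have iphi f : V f -> Re (cintegral mu setT (fun x => f x * phi x)) = ip f l.
  move=> _; apply: eq_Rintegral => x _; by rewrite cReM cReJ cImJ mulrN opprK.
have iphiI f : V f -> Re (cintegral mu setT (fun x => f x * phi x)) = 0.
  move=> Vf; have f2 := V2 _ Vf.
  (* minimality of the distance bounds <f, r_n> and L^2 convergence transfers it to l *)
  have ipr n : `|ip f (r n)| <= (1 + E f) * 2^-1 ^+ n.
    have lo t : - 8^-1 ^+ n <= 2 * t * ip f (r n) + t ^+ 2 * E f.
      have := energyD_scale t (r2 n) f2; rewrite -/(ip f (r n)) -/(E _) -/(E f) => e.
      have := Dle _ (VD _ _ (Vh n) (VZ t%:C _ Vf)).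
      have -> : E (fun x => h n x + t%:C * f x - g x) = E (r n) + 2 * t * ip f (r n) + t ^+ 2 * E f.
        rewrite -[RHS]/(fine (_%:E)) -e; congr (fine (energy _ _ _)).
        by apply/funext => x; rewrite /r; ring.
      by have [_] := hP n; rewrite -/(r n); lra.
    (* The values t = 2^-n and t = -2^-n balance the errors: after division by 2^-n, the excess 8^-n
       becomes 4^-n and the quadratic term becomes 2^-n E f. *)
    set w : R := 2^-1 ^+ n; have w0 : 0 < w by rewrite exprn_gt0// invr_gt0.
    have e8 : (8^-1 : R) ^+ n = w * w * w.
      by rewrite -!exprMn; congr (_ ^+ _); field.
    have := lo w; have := lo (- w); rewrite e8 sqrrN.
    have -> : - (w * w * w) = - (w * (w * w)) by ring.
    have -> : 2 * - w * ip f (r n) + w ^+ 2 * E f = w * (- (2 * ip f (r n)) + w * E f) by ring.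
    have -> : 2 * w * ip f (r n) + w ^+ 2 * E f = w * (2 * ip f (r n) + w * E f) by ring.
    rewrite -!mulrN !ler_pM2l//.
    have ww : w * w <= w.
      by rewrite ger_pMr//; apply: exprn_ile1; rewrite ?invr_ge0// invf_le1// ler1n.
    have wE : 0 <= w * E f by rewrite mulr_ge0// ltW.
    by rewrite ler_norml => ? ?; apply/andP; split; lra.
  have ipl n : `|ip f l - ip f (r n)| <= (4 + E f) * 2^-1 ^+ n.
    have mrl : square_integrable mu (fun x => (l x - r n x)^*).
      by apply: square_integrableJ; exact: square_integrableB.
    (* Young's inequality with weight w = 2^-n: the squared distance of r_n to l is at most 4 w^3,
       so the two terms are w E f and 4 w^2. *)
    set w : R := 2^-1 ^+ n; have w0 : 0 < w by rewrite exprn_gt0// invr_gt0.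
    have e8 : (8^-1 : R) ^+ n = w * w * w.
      by rewrite -!exprMn; congr (_ ^+ _); field.
    have ww : w <= 1 by apply: exprn_ile1; rewrite ?invr_ge0// invf_le1// ler1n.
    have lerl : (energy mu setT (fun x => (l x - r n x)%R^*) <= (4 * (w * w * w))%:E)%E.
      rewrite -e8 (_ : 4 = 2 * 2); last by ring.
      apply: le_trans (rl n); rewrite le_eqVlt; apply/orP; left; apply/eqP.
      by apply: eq_integral => x _; congr EFin; rewrite csqJ -opprB csqN.
    have Ef : (energy mu setT f <= (E f)%:E)%E by rewrite EK.
    have [mf _] := f2; have [mrl' _] := mrl.
    have [+ _] := cintegral_young measurableT w0 mf mrl' Ef lerl.
    have -> : Re (cintegral mu setT (fun x => f x * (l x - r n x)^*)) = ip f l - ip f (r n).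
      rewrite /ip -RintegralB//; try exact: integrable_dot.
      by apply: eq_Rintegral => x _; rewrite cReM cReJ cImJ cReB cImB; ring.
    have -> : w^-1 * (4 * (w * w * w)) = 4 * (w * w).
      by rewrite (_ : 4 * (w * w * w) = w * (4 * (w * w))); [rewrite mulKf// gt_eqF|ring].
    move=> /le_trans; apply.
    have : w * w <= w by rewrite ger_pMr.
    by have := E0 f; lra.
  rewrite iphi//; apply/eqP; rewrite -normr_eq0 eq_le normr_ge0 andbT.
  have cv0 : (5 + 2 * E f) * 2^-1 ^+ n @[n --> \oo] --> (0 : R).
    rewrite -[X in _ --> X](mulr0 (5 + 2 * E f)); apply: cvgMr.
    by apply: cvg_expr; rewrite ger0_norm ?invr_ge0// invf_lt1// ltr1n.
  rewrite -(cvg_lim _ cv0)//; apply: limr_ge; first by apply/cvg_ex; eexists; exact: cv0.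
  apply: nearW => n; rewrite -[ip f l](subrK (ip f (r n))).
  apply: le_trans (ler_normD _ _) _.
  by have := ipr n; have := ipl n; lra.
have phi0 : {ae mu, forall x, phi x = 0}.
  apply: orth0 => // f Vf; apply: complex_eqP; first exact: iphiI.
  (* The imaginary part of the pairing with f is the real part of the pairing with -i f. *)
  have := iphiI _ (VZ (- 'i) _ Vf).
  under eq_fun do rewrite -mulrA.
  rewrite cintegralZ//; last first.
    by apply: cintegrableM => //;
      [have [] := V2 _ Vf|have /square_integrableP[] := V2 _ Vf|have /square_integrableP[] := phi2].
  by rewrite cReM /= oppr0 mul0r sub0r mulN1r opprK.
have El : energy mu setT l = 0%E.
  apply: energy_ae0 => //; apply: filterS phi0 => x.
  by rewrite /phi; case: (l x) => a b /= [-> /eqP]; rewrite oppr_eq0 => /eqP ->.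
exists h; split => //.
have rb n : (energy mu setT (r n) <= (8 * 8^-1 ^+ n)%:E)%E.
  have -> : r n = (fun x => (r n x - l x) + l x) by apply/funext => x; rewrite subrK.
  apply: le_trans (energyD_le _ _ _ _) _ => //; try exact: cmeasurableB.
  rewrite El mule0 adde0 (_ : 8 * _ = 2 * (2 * 2 * 8^-1 ^+ n)); last by ring.
  by rewrite EFinM lee_wpmul2l.
apply: (@squeeze_cvge _ _ _ _ (cst 0%E) _ (fun n => (8 * 8^-1 ^+ n)%:E)).
- by apply: nearW => n; rewrite energy_ge0 rb.
- exact: cvg_cst.
- apply: cvg_EFin; first by near=> n.
  rewrite -[X in _ --> X](mulr0 8); apply: cvgMr.
  by apply: cvg_expr; rewrite ger0_norm ?invr_ge0// invf_lt1// ltr1n.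
Unshelve. all: by end_near.
Qed.

End projection.

(** * Monotone classes and uniqueness of Fourier coefficients *)

Import HBSimple HBNNSimple.

Section monotone_class.
Context {R : realType} {d} {T : measurableType d}.
Implicit Types (f g : T -> R[i]).

Definition bounded_measurable f :=
  cmeasurable f /\ exists K : R, forall x, normc (f x) <= K.

Lemma normcM_le (z w : R[i]) (a b : R) : normc z <= a -> normc w <= b ->
  normc (z * w) <= a * b.
Proof. by move=> za wb; rewrite ComplexField.Normc.normcM ler_pM ?normc_ge0. Qed.

Lemma bounded_measurableD f g : bounded_measurable f -> bounded_measurable g ->
  bounded_measurable (fun x => f x + g x).
Proof.
move=> [mf [K fK]] [mg [L gL]]; split; first exact: cmeasurableD.
exists (K + L) => x; apply: le_trans (le_normcD _ _) _.
exact: lerD.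
Qed.

Lemma bounded_measurableM f g : bounded_measurable f -> bounded_measurable g ->
  bounded_measurable (fun x => f x * g x).
Proof.
move=> [mf [K fK]] [mg [L gL]]; split; first exact: cmeasurableM.
by exists (K * L) => x; exact: normcM_le.
Qed.

Lemma bounded_measurable_cst (c : R[i]) : bounded_measurable (fun=> c).
Proof. by split; [exact: cmeasurable_cst|exists (normc c)]. Qed.

Lemma normc_indic (D : set T) x : normc ((\1_D x : R)%:C) <= 1.
Proof. by rewrite normcC indicE; case: (_ \in _); rewrite ?normr1 ?normr0. Qed.

Lemma bounded_measurable_indic (D : set T) : measurable D ->
  bounded_measurable (fun x => (\1_D x : R)%:C).
Proof.
by move=> mD; split; [exact: cmeasurable_indic|exists 1 => x; exact: normc_indic].
Qed.

Lemma bounded_measurable_sum n (F : nat -> T -> R[i]) :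
  (forall i, bounded_measurable (F i)) ->
  bounded_measurable (fun x => \sum_(i < n) F i x).
Proof.
move=> bF; elim: n => [|n ih].
  by under eq_fun do rewrite big_ord0; exact: bounded_measurable_cst.
by under eq_fun do rewrite big_ord_recr; exact: bounded_measurableD.
Qed.

(** Setting of the functional monotone class theorem. Linearity of [H] is asked only on bounded
    measurable functions, where the integrals defining the intended [H] exist, and stability under
    limits only with a common bound, as in dominated convergence. *)
Variables (G : set (set T)) (H : (T -> R[i]) -> Prop).
Hypotheses (GI : setI_closed G) (mG : @measurable d T = <<s G>>).
Hypothesis H1 : H (fun=> 1).
Hypothesis HG : forall B, G B -> H (fun x => (\1_B x : R)%:C).
Hypothesis HD : forall f g, bounded_measurable f -> bounded_measurable g ->
  H f -> H g -> H (fun x => f x + g x).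
Hypothesis HZ : forall (c : R[i]) f, bounded_measurable f -> H f ->
  H (fun x => c * f x).
Hypothesis Hlim : forall (f : nat -> T -> R[i]) g (K : R),
  (forall n, cmeasurable (f n)) -> (forall n x, normc (f n x) <= K) ->
  (forall x, Re (f n x) @[n --> \oo] --> Re (g x)) ->
  (forall x, Im (f n x) @[n --> \oo] --> Im (g x)) ->
  (forall n, H (f n)) -> H g.

Let bZ (c : R[i]) f : bounded_measurable f -> bounded_measurable (fun x => c * f x).
Proof. by apply: bounded_measurableM; exact: bounded_measurable_cst. Qed.

Let Hsum n (F : nat -> T -> R[i]) :
  (forall i, bounded_measurable (F i)) -> (forall i, H (F i)) ->
  H (fun x => \sum_(i < n) F i x).
Proof.
move=> bF hF; elim: n => [|n ih].
  rewrite (_ : (fun _ => _) = (fun x => 0 * 1)).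
    by apply: HZ => //; exact: bounded_measurable_cst.
  by apply/funext => x; rewrite big_ord0 mul0r.
under eq_fun do rewrite big_ord_recr.
by apply: HD => //; exact: bounded_measurable_sum.
Qed.

Let Hindic B : measurable B -> H (fun x => (\1_B x : R)%:C).
Proof.
move=> mB; apply: (@dynkin_induction d T G (fun B => H (fun x => (\1_B x : R)%:C))) => //.
- by under eq_fun do rewrite indicT.
- move=> S mS HS; rewrite (_ : (fun _ => _) = (fun x => 1 + (-1) * (\1_S x : R)%:C)).
    apply: HD => //; first exact: bounded_measurable_cst.
      by apply: bZ; exact: bounded_measurable_indic.
    by apply: HZ => //; exact: bounded_measurable_indic.
  apply/funext => x; rewrite !indicE in_setC.
  by case: (_ \in _); rewrite /= ?rmorph1 ?rmorph0 ?mulr1 ?mulr0 ?subrr ?addr0.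
- move=> F mF tF HF.
  (* By disjointness the partial sums take only the values 0 and 1 and are eventually constant at
     each point, which provides the common bound required for limits. *)
  pose s n x : R[i] := \sum_(i < n) (\1_(F i) x : R)%:C.
  have s_in k n x : F k x -> s n x = (k < n)%:R.
    move=> Fkx; elim: n => [|n ih]; first by rewrite /s big_ord0.
    rewrite /s big_ord_recr /= -/(s n x) ih ltnS indicE.
    have [->|nk] := eqVneq n k; first by rewrite ltnn leqnn mem_set// add0r.
    rewrite memNset ?rmorph0 ?addr0; first by rewrite [(k <= n)%N]leq_eqVlt [k == n]eq_sym (negbTE nk).
    by move=> Fnx; move/eqP: nk; apply; apply: tF => //; exists x.
  have s_out n x : ~ (\bigcup_k F k) x -> s n x = 0.
    move=> nFx; rewrite /s big1// => i _; rewrite indicE memNset ?rmorph0//.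
    by move=> Fix; apply: nFx; exists i.
  have s_cvg x : \forall n \near \oo, s n x = (\1_(\bigcup_k F k) x : R)%:C.
    have [[k _ Fkx]|nFx] := pselect ((\bigcup_k F k) x); last first.
      by apply: nearW => n; rewrite s_out// indicE memNset// rmorph0.
    exists k.+1 => // n /= kn.
    by rewrite (s_in k)// kn indicE mem_set ?rmorph1//; exists k.
  apply: (Hlim (f := s) (K := 1)).
  - by move=> n; apply: cmeasurable_sum => i; exact: cmeasurable_indic.
  - move=> n x; have [[k _ Fkx]|nFx] := pselect ((\bigcup_k F k) x).
      rewrite (s_in k)//; case: (_ < _)%N; first by rewrite (normcC 1) normr1.
      by rewrite (normcC 0) normr0.
    by rewrite s_out// (normcC 0) normr0.
  - by move=> x; apply: cvg_near_cst; apply: filterS (s_cvg x) => n ->.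
  - by move=> x; apply: cvg_near_cst; apply: filterS (s_cvg x) => n ->.
  - move=> n; apply: (@Hsum n (fun i x => (\1_(F i) x : R)%:C)) => // i.
    exact: bounded_measurable_indic.
- by rewrite -mG.
Qed.

Let Hnneg (h : T -> R) (K : R) : measurable_fun setT h ->
  (forall x, 0 <= h x <= K) -> H (fun x => (h x)%:C).
Proof.
move=> mh hK.
have mh' : measurable_fun setT (EFin \o h) by exact/measurable_EFinP.
pose a := nnsfun_approx measurableT mh'.
have h0 x : setT x -> (0 <= (EFin \o h) x)%E by move=> _; rewrite lee_fin; have /andP[] := hK x.
have acvg x : (a n x : R) @[n --> \oo] --> h x.
  by have /fine_cvgP[_] := cvg_nnsfun_approx measurableT mh' h0 (I : setT x).
have ale n x : a n x <= K.
  apply: (@le_trans _ _ (h x)); last by have /andP[] := hK x.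
  rewrite -(cvg_lim _ (acvg x))//; apply: nondecreasing_cvgn_le.
    by move=> i j ij; have /lefP := nd_nnsfun_approx measurableT mh' ij; exact.
  by apply/cvg_ex; eexists; exact: acvg.
apply: (Hlim (f := fun n x => (a n x : R)%:C) (K := K)).
- by move=> n; apply: cmeasurableC; exact: measurable_funP.
- by move=> n x; rewrite normcC ger0_norm// ?ale//.
- by move=> x /=; exact: acvg.
- by move=> x /=; exact: cvg_cst.
- move=> n.
  pose r : seq R := finmap.enum_fset (fset_set (range (a n))).
  pose F i x := (nth 0 r i)%:C * (\1_(a n @^-1` [set nth 0 r i]) x : R)%:C.
  rewrite (_ : (fun _ => _) = (fun x => \sum_(i < size r) F i x)); last first.
    apply/funext => x; rewrite fimfunE fsbig_finite//= (big_nth 0) big_mkord.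
    by rewrite rmorph_sum; apply: eq_bigr => i _; rewrite rmorphM.
  apply: Hsum => i.
    by apply: bZ; exact: bounded_measurable_indic.
  by apply: HZ; [exact: bounded_measurable_indic|exact: Hindic].
Qed.

Let Hreal (h : T -> R) (K : R) : measurable_fun setT h ->
  (forall x, `|h x| <= K) -> H (fun x => (h x)%:C).
Proof.
move=> mh hK; rewrite (_ : (fun _ => _) = (fun x => (h x + K)%:C + (- K)%:C * 1)).
  have b : measurable_fun setT (fun x => h x + K).
    by apply: measurable_funD => //; exact: measurable_cst.
  have le2 x : 0 <= h x + K <= K + K.
    have := hK x; rewrite ler_norml => /andP[? ?]; apply/andP; split; lra.
  apply: HD.
  - split; first exact: cmeasurableC.
    exists (K + K) => x; have /andP[? ?] := le2 x.
    by rewrite normcC ger0_norm.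
  - by apply: bZ; exact: bounded_measurable_cst.
  - exact: (Hnneg (K := K + K)).
  - by apply: HZ => //; exact: bounded_measurable_cst.
by apply/funext => x; rewrite mulr1 -rmorphD addrK.
Qed.

Lemma monotone_class f : bounded_measurable f -> H f.
Proof.
move=> [[f1 f2] [K fK]].
rewrite (_ : f = (fun x => (Re (f x))%:C + 'i * (Im (f x))%:C)); last first.
  by apply/funext => x; rewrite -complexE.
have b1 x : `|Re (f x)| <= K by exact: le_trans (normr_Re_le _) (fK x).
have b2 x : `|Im (f x)| <= K by exact: le_trans (normr_Im_le _) (fK x).
have B1 : bounded_measurable (fun x => (Re (f x))%:C).
  by split; [exact: cmeasurableC|exists K => x; rewrite normcC].
have B2 : bounded_measurable (fun x => (Im (f x))%:C).
  by split; [exact: cmeasurableC|exists K => x; rewrite normcC].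
apply: HD => //; first exact: bZ.
  exact: Hreal b1.
by apply: HZ => //; exact: Hreal b2.
Qed.

End monotone_class.

Section dominated.
Context {R : realType} {d} {T : measurableType d}.
Variable mu : {measure set T -> \bar R}.
Implicit Types (f g : T -> R[i]) (D : set T).

Lemma normc_le_ReIm (z : R[i]) : normc z <= `|Re z| + `|Im z|.
Proof.
rewrite normc_le_csq ?addr_ge0// /csq -(real_normK (num_real (Re z))).
rewrite -(real_normK (num_real (Im z))) sqrrD addrAC lerDl.
by rewrite mulrn_wge0// mulr_ge0.
Qed.

Lemma integrable_ReIm D f : measurable D -> cintegrable mu D f ->
  mu.-integrable D (EFin \o (fun x => `|Re (f x)| + `|Im (f x)|)).
Proof.
move=> mD [f1 f2].
have := integrable_lin 1 1 mD (integrable_norm f1) (integrable_norm f2).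
by apply: eq_integrable => // x _ /=; rewrite !mul1r.
Qed.

Lemma cintegrable_le D f (g : T -> R) : measurable D -> cmeasurable f ->
  mu.-integrable D (EFin \o g) -> (forall x, D x -> normc (f x) <= g x) ->
  cintegrable mu D f.
Proof.
move=> mD [f1 f2] ig fg; split; apply: le_integrable ig => //.
- exact/measurable_EFinP/measurable_funTS.
- move=> x Dx; rewrite lee_fin; apply: le_trans (normr_Re_le _) _.
  exact: le_trans (fg _ Dx) (ler_norm _).
- exact/measurable_EFinP/measurable_funTS.
- move=> x Dx; rewrite lee_fin; apply: le_trans (normr_Im_le _) _.
  exact: le_trans (fg _ Dx) (ler_norm _).
Qed.

Lemma cintegrable_boundedM D f g (K : R) : measurable D ->
  cmeasurable f -> (forall x, D x -> normc (f x) <= K) ->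
  cmeasurable g -> cintegrable mu D g -> cintegrable mu D (fun x => f x * g x).
Proof.
move=> mD mf fK mg ig.
apply: (@cintegrable_le _ _ (fun x => K * (`|Re (g x)| + `|Im (g x)|))) => //.
- exact: cmeasurableM.
- have := integrableZl mD K (integrable_ReIm mD ig).
  by apply: eq_integrable.
- move=> x Dx; apply: le_trans (normcM_le (fK _ Dx) (lexx _)) _.
  rewrite ler_wpM2l ?normc_le_ReIm//.
  exact: le_trans (normc_ge0 _) (fK _ Dx).
Qed.

Lemma Rintegral_dct D (F : nat -> T -> R) (f g : T -> R) : measurable D ->
  (forall n, measurable_fun D (F n)) ->
  (forall x, D x -> F n x @[n --> \oo] --> f x) ->
  mu.-integrable D (EFin \o g) -> (forall n x, D x -> `|F n x| <= g x) ->
  (\int[mu]_(x in D) F n x)%R @[n --> \oo] --> (\int[mu]_(x in D) f x)%R.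
Proof.
move=> mD mF Ff ig Fg.
have mf : measurable_fun D f by exact: measurable_fun_cvg Ff.
have [i _ h] : [/\ mu.-integrable D (EFin \o f),
    [sequence (\int[mu]_(x in D) `|(F n x)%:E - (f x)%:E|)%E]_n @ \oo --> 0%E &
    [sequence (\int[mu]_(x in D) (F n x)%:E)%E]_n @ \oo -->
    (\int[mu]_(x in D) (f x)%:E)%E].
  apply: dominated_convergence ig _ => //.
  - by move=> n; exact/measurable_EFinP.
  - exact/measurable_EFinP.
  - apply: aeW => x Dx; apply: cvg_EFin; first by near=> n.
    exact: Ff.
  - by apply: aeW => x n Dx; rewrite lee_fin; exact: Fg.
apply: fine_cvg; rewrite /Rintegral fineK//; exact: integrable_fin_num.
Unshelve. all: by end_near.
Qed.

Lemma cintegral_dct D (F : nat -> T -> R[i]) f (g : T -> R) : measurable D ->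
  (forall n, cmeasurable (F n)) ->
  (forall x, D x -> Re (F n x) @[n --> \oo] --> Re (f x)) ->
  (forall x, D x -> Im (F n x) @[n --> \oo] --> Im (f x)) ->
  mu.-integrable D (EFin \o g) -> (forall n x, D x -> normc (F n x) <= g x) ->
  Re (cintegral mu D (F n)) @[n --> \oo] --> Re (cintegral mu D f) /\
  Im (cintegral mu D (F n)) @[n --> \oo] --> Im (cintegral mu D f).
Proof.
move=> mD mF F1 F2 ig Fg; split; apply: (@Rintegral_dct _ _ _ g) => //.
- by move=> n; apply: measurable_funTS; have [] := mF n.
- by move=> n x Dx; exact: le_trans (normr_Re_le _) (Fg n x Dx).
- by move=> n; apply: measurable_funTS; have [] := mF n.
- by move=> n x Dx; exact: le_trans (normr_Im_le _) (Fg n x Dx).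
Qed.

End dominated.

(** * Polynomials converging to a step function *)

Section threshold.
Context {R : realType}.

Lemma bernoulli_ge (z : R) n : -1 <= z -> 1 + n%:R * z <= (1 + z) ^+ n.
Proof.
move=> z1; elim: n => [|n ih]; first by rewrite mul0r addr0 expr0.
have z0 : 0 <= 1 + z by lra.
rewrite exprS; apply: le_trans (ler_wpM2l z0 ih).
have : 0 <= n%:R * z ^+ 2 by rewrite mulr_ge0// sqr_ge0.
by rewrite -natr1 expr2; lra.
Qed.

Lemma cvg_natmul_expr (r : R) : 0 <= r < 1 -> n%:R * r ^+ n @[n --> \oo] --> 0.
Proof.
(* By the arithmetic-geometric mean inequality r <= s^2, so n r^n is at most (n s^n) s^n, and
   Bernoulli's inequality for 1/s bounds n s^n. *)
move=> /andP[r0 r1]; pose s : R := (1 + r) / 2.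
have s0 : 0 < s by rewrite /s; lra.
have s1 : s < 1 by rewrite /s; lra.
have rs : r <= s * s.
  have : 0 <= ((1 - r) / 2) ^+ 2 by rewrite sqr_ge0.
  by rewrite /s; lra.
have v1 : -1 <= s^-1 - 1.
  by have := s0; rewrite -invr_gt0 => ?; lra.
have c0 : 0 < s^-1 - 1 by rewrite subr_gt0 invf_gt1.
have bnd n : 0 <= n%:R * r ^+ n <= (s^-1 - 1)^-1 * s ^+ n.
  rewrite mulr_ge0 ?exprn_ge0//=.
  have h : n%:R * s ^+ n <= (s^-1 - 1)^-1.
    have := bernoulli_ge n v1; rewrite addrCA subrr addr0 exprVn => b.
    rewrite -(ler_pM2r c0) mulVf ?gt_eqF// -mulrA [_ * (_ - 1)]mulrC mulrA.
    rewrite -ler_pdivlMr ?exprn_gt0// mul1r.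
    by apply: le_trans b; rewrite lerDr.
  apply: (@le_trans _ _ (n%:R * s ^+ n * s ^+ n)).
    rewrite -mulrA ler_wpM2l// -exprMn; apply: lerXn2r => //.
    by rewrite nnegrE mulr_ge0// ltW.
  by rewrite ler_wpM2r// exprn_ge0// ltW.
apply: (@squeeze_cvgr _ _ _ _ (cst 0) (fun n => (s^-1 - 1)^-1 * s ^+ n)).
- by apply: nearW => n; exact: bnd.
- exact: cvg_cst.
- rewrite -[X in _ --> X](mulr0 (s^-1 - 1)^-1); apply: cvgMr.
  by apply: cvg_expr; rewrite ger0_norm// ltW.
Qed.

(** The polynomials of elementary proofs of the Stone-Weierstrass theorem. With N = n 2^n,
    Bernoulli's inequality bounds the expression below by 1 - n (2u)^n if u < 1/2, and above by 1/(1
    + N u^n) <= 1/(n+1) if u >= 1/2. The factor n in the exponent settles the borderline u = 1/2,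
    where the exponent 2^n alone would give the limit 1/e. *)
Lemma cvg_threshold (u : R) : 0 <= u <= 1 ->
  (1 - u ^+ n) ^+ (n * 2 ^ n) @[n --> \oo] --> ((u < 2^-1)%R%:R : R).
Proof.
move=> /andP[u0 u1].
have y01 n : 0 <= u ^+ n <= 1 by rewrite exprn_ge0// exprn_ile1.
have [ult|uge] := ltP u 2^-1.
  have h : 1 - n%:R * (2 * u) ^+ n @[n --> \oo] --> (1 : R).
    rewrite -[X in _ --> X]subr0; apply: cvgB; first exact: cvg_cst.
    by apply: cvg_natmul_expr; apply/andP; split; lra.
  apply: squeeze_cvgr h (cvg_cst _); apply: nearW => n.
  have /andP[a b] := y01 n; apply/andP; split.
    have : -1 <= - u ^+ n by lra.
    move=> /(bernoulli_ge (n * 2 ^ n)); apply: le_trans.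
    by rewrite natrM natrX mulrN exprMn mulrA.
  by apply: exprn_ile1; lra.
have h : harmonic n @[n --> \oo] --> (0 : R) by exact: cvg_harmonic.
apply: squeeze_cvgr (cvg_cst _) h; apply: nearW => n.
have /andP[a b] := y01 n; apply/andP; split.
  by rewrite exprn_ge0//; lra.
set N := (n * 2 ^ n)%N; set y := u ^+ n.
have Ny : n%:R <= N%:R * y.
  rewrite natrM natrX -mulrA ler_peMr// -exprMn; apply: exprn_ege1; lra.
have B : 1 + N%:R * y <= (1 + y) ^+ N by apply: bernoulli_ge; exact: le_trans (lerN10 _) a.
have P : (1 - y) ^+ N * (1 + y) ^+ N <= 1.
  rewrite -exprMn; apply: exprn_ile1.
    by rewrite mulr_ge0 ?subr_ge0// addr_ge0.
  by rewrite -subr_sqr expr1n gerBl sqr_ge0.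
rewrite /harmonic /= -[n.+1%:R^-1]mul1r ler_pdivlMr ?ltr0Sn//.
apply: le_trans P; apply: ler_wpM2l; first by rewrite exprn_ge0// subr_ge0.
by apply: le_trans B; rewrite -natr1 addrC lerD2l.
Qed.

End threshold.

(** * Uniqueness of Fourier transforms of complex measures *)

Section characters.
Context {R : realType} {d} {T : measurableType d} {I : zmodType}.
(** The setting covers both dual groups: R^d with characters indexed by R^d, and the torus with
    characters indexed by Z^d. [chi_generates] is what lets characters detect all measurable
    sets. *)
Variable chi : I -> T -> R[i].
Hypothesis chiD : forall i j x, chi (i + j) x = chi i x * chi j x.
Hypothesis chi_norm : forall i x, normc (chi i x) = 1.
Hypothesis mchi : forall i, cmeasurable (chi i).
Hypothesis chi_generates : @measurable d T `<=`
  <<s [set B | exists i a, B = [set x | Re (chi i x) < a] \/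
                           B = [set x | Im (chi i x) < a]] >>.

Let chi_neq0 i x : chi i x != 0.
Proof.
apply/eqP => c0; have := chi_norm i x; rewrite c0 (normcC 0) normr0 => /eqP.
by rewrite eq_sym oner_eq0.
Qed.

Let chi0 x : chi 0 x = 1.
Proof.
by apply: (mulfI (chi_neq0 0 x)); rewrite mulr1 -chiD addr0.
Qed.

Let chiN i x : chi (- i) x = (chi i x)^*.
Proof.
apply: (mulfI (chi_neq0 i x)); rewrite -chiD subrr chi0.
have := normc_sqr (chi i x); rewrite chi_norm expr1n /csq => e.
apply: complex_eqP; rewrite ?cReM ?cImM cReJ cImJ /=.
  by rewrite mulrN opprK -!expr2 -e.
by rewrite mulrN mulrC addNr.
Qed.

Let trig (s : seq (R[i] * I)) x : R[i] := \sum_(p <- s) p.1 * chi p.2 x.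

Let is_trig (f : T -> R[i]) := exists s, f = trig s.

Let trigD f g : is_trig f -> is_trig g -> is_trig (fun x => f x + g x).
Proof.
by move=> [s ->] [t ->]; exists (s ++ t); apply/funext => x; rewrite /trig big_cat.
Qed.

Let trigM f g : is_trig f -> is_trig g -> is_trig (fun x => f x * g x).
Proof.
move=> [s ->] [t ->].
exists [seq (p.1 * q.1, p.2 + q.2) | p <- s, q <- t]; apply/funext => x.
rewrite /trig big_allpairs_dep mulr_suml; apply: eq_bigr => p _.
by rewrite mulr_sumr; apply: eq_bigr => q _ /=; rewrite chiD mulrACA.
Qed.

Let trig_cst c : is_trig (fun=> c).
Proof.
by exists [:: (c, 0)]; apply/funext => x; rewrite /trig big_seq1 chi0 mulr1.
Qed.

Let trig_chi i : is_trig (chi i).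
Proof.
by exists [:: (1, i)]; apply/funext => x; rewrite /trig big_seq1 mul1r.
Qed.

Let trig_measurable f : is_trig f -> cmeasurable f.
Proof.
by move=> [s ->]; apply: cmeasurable_sum => p; exact: cmeasurableZ.
Qed.

Let trigX f n : is_trig f -> is_trig (fun x => f x ^+ n).
Proof.
move=> tf; elim: n => [|n ih]; first exact: trig_cst.
by under eq_fun do rewrite exprS; exact: trigM.
Qed.

Let rtrig (k : T -> R) := is_trig (fun x => (k x)%:C).

Let rtrig_lin (a b : R) k : rtrig k -> rtrig (fun x => a + b * k x).
Proof.
move=> tk; rewrite /rtrig; under eq_fun do rewrite rmorphD rmorphM.
by apply: trigD; [exact: trig_cst|apply: trigM => //; exact: trig_cst].
Qed.

Let rtrigM k l : rtrig k -> rtrig l -> rtrig (fun x => k x * l x).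
Proof. by move=> tk tl; rewrite /rtrig; under eq_fun do rewrite rmorphM; exact: trigM. Qed.

Let rtrigX k n : rtrig k -> rtrig (fun x => k x ^+ n).
Proof. by move=> tk; rewrite /rtrig; under eq_fun do rewrite rmorphXn; exact: trigX. Qed.

Let rtrig_Re i : rtrig (fun x => Re (chi i x)).
Proof.
rewrite /rtrig (_ : (fun _ => _) = (fun x => (2^-1)%:C * (chi i x + chi (- i) x))).
  by apply: trigM; [exact: trig_cst|apply: trigD; exact: trig_chi].
apply/funext => x; rewrite chiN; apply: complex_eqP;
  rewrite ?Re_mulC ?Im_mulC ?cReD ?cImD ?cReJ ?cImJ /=; lra.
Qed.

Let rtrig_Im i : rtrig (fun x => Im (chi i x)).
Proof.
rewrite /rtrig (_ : (fun _ => _) = (fun x => (0 -i* 2^-1) * (chi i x + (-1) * chi (- i) x))).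
  by apply: trigM; [exact: trig_cst|apply: trigD;
    [exact: trig_chi|apply: trigM; [exact: trig_cst|exact: trig_chi]]].
apply/funext => x; rewrite chiN mulN1r; apply: complex_eqP;
  rewrite !ReImE ?cReJ ?cImJ /=; lra.
Qed.

(** The pi-system of the monotone class argument. Values in [0, 1] give stability under
    intersection, by taking products, and also the common bound required for limits. *)
Let G := [set B : set T | exists k : nat -> T -> R,
  [/\ forall n, rtrig (k n), forall n x, 0 <= k n x <= 1 &
      forall x, k n x @[n --> \oo] --> (\1_B x : R)]].

Let rtrig_measurable k : rtrig k -> measurable_fun setT k.
Proof. by move=> /trig_measurable[]. Qed.

Let G_measurable : G `<=` @measurable d T.
Proof.
move=> B [k [tk _ kB]]; apply/(measurable_indicP R).
apply: (measurable_fun_cvg (h := k)) => // n.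
exact: rtrig_measurable.
Qed.

Let GI : setI_closed G.
Proof.
move=> A B [k [tk k01 kA]] [l [tl l01 lB]]; exists (fun n x => k n x * l n x); split.
- by move=> n; exact: rtrigM.
- move=> n x; have /andP[a b] := k01 n x; have /andP[a' b'] := l01 n x.
  by rewrite mulr_ge0//= mulr_ile1.
- move=> x; rewrite indicI; apply: cvgM; [exact: kA|exact: lB].
Qed.

Let G_lt k (a : R) : rtrig k -> (forall x, `|k x| <= 1) -> G [set x | k x < a].
Proof.
(* Since |k - a| <= 1 + |a| < L, the affine image u of k has values in [0, 1], and k < a becomes u <
   1/2. *)
move=> tk k1; pose L : R := `|a| + 2.
have L0 : 0 < L by rewrite ltr_wpDl.
pose u x := (2^-1 - a / (2 * L)) + (2 * L)^-1 * k x.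
have uE x : u x = 2^-1 + (k x - a) / (2 * L).
  by rewrite /u mulrBl [_^-1 * k x]mulrC; ring.
have u01 x : 0 <= u x <= 1.
  have LL : 0 < 2 * L by rewrite mulr_gt0.
  have : - 2^-1 <= (k x - a) / (2 * L) <= 2^-1.
    rewrite ler_pdivlMr// ler_pdivrMr//.
    have := k1 x; rewrite ler_norml => /andP[p q].
    have := ler_norm a; have := ler_norm (- a); rewrite normrN => r s.
    rewrite /L; apply/andP; split; lra.
  by rewrite uE; move: (_ / _) => z /andP[p q]; apply/andP; split; lra.
exists (fun n x => (1 - u x ^+ n) ^+ (n * 2 ^ n)); split.
- move=> n; apply: rtrigX.
  rewrite (_ : (fun _ => _) = (fun x => 1 + (-1) * u x ^+ n)).
    by apply/rtrig_lin/rtrigX/rtrig_lin.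
  by apply/funext => x; rewrite mulN1r.
- move=> n x; have /andP[p q] := u01 x.
  have /andP[a1 b1] : 0 <= u x ^+ n <= 1 by rewrite exprn_ge0// exprn_ile1.
  rewrite exprn_ge0 ?subr_ge0//= exprn_ile1 ?subr_ge0//.
  by rewrite gerBl.
- move=> x; rewrite (_ : \1_[set x | k x < a] x = (u x < 2^-1)%R%:R :> R); first exact: cvg_threshold.
  rewrite indicE uE; congr (_%:R); rewrite gtrDl pmulr_llt0 ?invr_gt0 ?mulr_gt0//.
  by rewrite subr_lt0; congr (nat_of_bool _); apply/idP/idP; rewrite inE.
Qed.

Let mG : @measurable d T = <<s G >>.
Proof.
apply/seteqP; split; last first.
  by apply: smallest_sub; [exact: sigma_algebra_measurable|exact: G_measurable].
apply: subset_trans chi_generates _; apply: smallest_sub.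
  exact: smallest_sigma_algebra.
move=> _ [i [a [] ->]]; apply: sub_gen_smallest.
- apply: (@G_lt (fun x => Re (chi i x))) => // x.
  by rewrite -(chi_norm i x) normr_Re_le.
- apply: (@G_lt (fun x => Im (chi i x))) => // x.
  by rewrite -(chi_norm i x) normr_Im_le.
Qed.

Variable mu : {measure set T -> \bar R}.

(* By [cvg_threshold] the indicator of {Re chi_i < a} is a bounded pointwise limit
   of polynomials in characters, hence of linear combinations of characters, and
   a monotone class argument applies. *)
Lemma characters_separate (w : T -> R[i]) : cmeasurable w ->
  cintegrable mu setT w ->
  (forall i, cintegral mu setT (fun x => chi i x * w x) = 0) ->
  {ae mu, forall x, w x = 0}.
Proof.
move=> mw iw chiw.
have ib f : bounded_measurable f -> cintegrable mu setT (fun x => f x * w x).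
  by move=> [mf [K fK]]; exact: (cintegrable_boundedM (K := K)).
have bchi i : bounded_measurable (chi i) by split => //; exists 1 => x; rewrite chi_norm.
pose H f := cintegral mu setT (fun x => f x * w x) = 0.
have HD f g : bounded_measurable f -> bounded_measurable g -> H f -> H g ->
    H (fun x => f x + g x).
  move=> bf bg Hf Hg; rewrite /H; under eq_fun do rewrite mulrDl.
  by rewrite cintegralD// ?Hf ?Hg ?addr0//; exact: ib.
have HZ c f : bounded_measurable f -> H f -> H (fun x => c * f x).
  move=> bf Hf; rewrite /H; under eq_fun do rewrite -mulrA.
  by rewrite cintegralZ// ?Hf ?mulr0//; exact: ib.
have Hlim (f : nat -> T -> R[i]) g (K : R) :
    (forall n, cmeasurable (f n)) -> (forall n x, normc (f n x) <= K) ->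
    (forall x, Re (f n x) @[n --> \oo] --> Re (g x)) ->
    (forall x, Im (f n x) @[n --> \oo] --> Im (g x)) ->
    (forall n, H (f n)) -> H g.
  move=> mf fK f1 f2 Hf.
  have K0 : 0 <= K.
    by apply: le_trans (fK 0%N point); exact: normc_ge0.
  have [|||||c1 c2] := @cintegral_dct _ _ _ mu setT (fun n x => f n x * w x)
    (fun x => g x * w x) (fun x => K * (`|Re (w x)| + `|Im (w x)|)) measurableT.
  - by move=> n; exact: cmeasurableM.
  - move=> x _; under eq_fun do rewrite cReM; rewrite cReM.
    by apply: cvgB; apply: cvgM => //; exact: cvg_cst.
  - move=> x _; under eq_fun do rewrite cImM; rewrite cImM.
    by apply: cvgD; apply: cvgM => //; exact: cvg_cst.
  - have := integrableZl measurableT K (integrable_ReIm measurableT iw).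
    exact: eq_integrable.
  - move=> n x _; apply: le_trans (normcM_le (fK _ _) (lexx _)) _.
    by rewrite ler_wpM2l ?normc_le_ReIm.
  apply: complex_eqP.
    rewrite -(cvg_lim _ c1)//; under eq_fun do rewrite [cintegral _ _ _]Hf.
    by rewrite lim_cst.
  rewrite -(cvg_lim _ c2)//; under eq_fun do rewrite [cintegral _ _ _]Hf.
  by rewrite lim_cst.
have Htrig f : is_trig f -> H f.
  move=> [s ->]; have bs : bounded_measurable (trig s) /\ H (trig s); last by case: bs.
  elim: s => [|p s [ih1 ih2]].
    rewrite (_ : trig [::] = (fun x => 0 * chi 0 x)); last first.
      by apply/funext => x; rewrite /trig big_nil mul0r.
    split; last by apply: HZ.
    by apply: bounded_measurableM => //; exact: bounded_measurable_cst.
  rewrite (_ : trig _ = (fun x => p.1 * chi p.2 x + trig s x)); last first.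
    by apply/funext => x; rewrite /trig big_cons.
  have b1 : bounded_measurable (fun x => p.1 * chi p.2 x).
    by apply: bounded_measurableM => //; exact: bounded_measurable_cst.
  by split; [exact: bounded_measurableD|apply: HD => //; exact: HZ].
have Hall : forall f, bounded_measurable f -> H f.
  apply: (monotone_class GI mG) => //.
  - by apply: Htrig; exact: trig_cst.
  - move=> B [k [tk k01 kB]]; apply: (Hlim (fun n x => (k n x)%:C) _ 1).
    + by move=> n; exact: trig_measurable (tk n).
    + by move=> n x; have /andP[? ?] := k01 n x; rewrite normcC ger0_norm.
    + exact: kB.
    + by move=> x; exact: cvg_cst.
    + by move=> n; exact: Htrig _ (tk n).
have [w1 w2] := iw; have [mw1 mw2] := mw.
have e1 : ae_eq mu setT (EFin \o (fun x => Re (w x))) (cst 0%E).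
  apply: integral_ae_eq => // E _ mE; rewrite integral0.
  have := Hall _ (bounded_measurable_indic mE) => /(congr1 (fun z => Re z)) /=.
  have -> : (\int[mu]_x Re ((\1_E x : R)%:C * w x) = \int[mu]_(x in E) Re (w x))%R.
    rewrite [RHS]Rintegral_mkcond; apply: eq_Rintegral => x _.
    rewrite Re_mulC patchE indicE; case: (_ \in _); by rewrite ?mul1r ?mul0r.
  move=> h; have {h} := congr1 (@EFin R) h; rewrite /Rintegral fineK//; apply: integrable_fin_num => //.
  exact: (integrableS measurableT mE (@subsetT _ _) w1).
have e2 : ae_eq mu setT (EFin \o (fun x => Im (w x))) (cst 0%E).
  apply: integral_ae_eq => // E _ mE; rewrite integral0.
  have := Hall _ (bounded_measurable_indic mE) => /(congr1 (fun z => Im z)) /=.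
  have -> : (\int[mu]_x Im ((\1_E x : R)%:C * w x) = \int[mu]_(x in E) Im (w x))%R.
    rewrite [RHS]Rintegral_mkcond; apply: eq_Rintegral => x _.
    rewrite Im_mulC patchE indicE; case: (_ \in _); by rewrite ?mul1r ?mul0r.
  move=> h; have {h} := congr1 (@EFin R) h; rewrite /Rintegral fineK//; apply: integrable_fin_num => //.
  exact: (integrableS measurableT mE (@subsetT _ _) w2).
apply: filterS2 e1 e2 => x /(_ Logic.I) [a] /(_ Logic.I) [b].
exact: complex_eqP.
Qed.

End characters.

(** * Weak limits of energy-bounded sequences *)

Section exhaustion.
Context {R : realType} {d} {T : measurableType d}.
Variables (mu : {measure set T -> \bar R}) (E : nat -> set T).
Hypotheses (mE : forall m, measurable (E m)) (Efin : forall m, (mu (E m) < +oo)%E).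
Hypotheses (Eincr : nondecreasing_seq E) (Ecover : \bigcup_m E m = setT).

Lemma energy_exhaustion_gt (f : T -> R[i]) (C : R) : cmeasurable f ->
  (C%:E < energy mu setT f)%E -> exists m, (C%:E < energy mu (E m) f)%E.
Proof.
move=> mf Cf; apply: contrapT => /forallNP h; move: Cf; rewrite ltNge => /negP; apply.
have c : energy mu (E m) f @[m --> \oo] --> energy mu (\bigcup_m E m) f.
  apply: ge0_nondecreasing_set_cvg_integral => // [i|i x _].
    exact: measurable_csqE.
  by rewrite lee_fin csq_ge0.
rewrite -Ecover -(cvg_lim _ c)//.
apply: lime_le; first by apply/cvg_ex; eexists; exact: c.
by apply: nearW => m; rewrite leNgt; apply/negP; exact: h.
Qed.

Lemma energy_bounded_fin m (f : T -> R[i]) (K : R) : 0 <= K -> cmeasurable f ->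
  (forall x, normc (f x) <= K) ->
  (energy mu (E m) f <= (K ^+ 2 * fine (mu (E m)))%:E)%E.
Proof.
move=> K0 mf fK; rewrite EFinM fineK ?ge0_fin_numE//.
rewrite -integral_cst//; apply: ge0_le_integral => //; try energy_side.
by move=> x _; rewrite lee_fin -normc_le_csq.
Qed.

Lemma energy_set_le D (f : T -> R[i]) : measurable D -> cmeasurable f ->
  (energy mu D f <= energy mu setT f)%E.
Proof. by move=> mD mf; apply: ge0_subset_integral => //; energy_side. Qed.

(* Sokal's gliding hump: were the energies unbounded, signs and indices could be
   chosen so that a series [sum_i +-4^-i g_(s i)] has infinite energy; truncating to
   [E m] keeps the tail of the series under control. *)
Lemma energy_uniform_bound (g : nat -> T -> R[i]) (K : R) :
  (forall n, cmeasurable (g n)) -> (forall n x, normc (g n x) <= K) ->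
  (forall (s : nat -> nat) (e : nat -> bool), exists2 p, square_integrable mu p &
    forall x, let u k := \sum_(i < k) ((-1) ^+ e i * 4^-1 ^+ i)%:C * g (s i) x in
      Re (u k) @[k --> \oo] --> Re (p x) /\ Im (u k) @[k --> \oo] --> Im (p x)) ->
  exists C : R, forall n, (energy mu setT (g n) <= C%:E)%E.
Proof.
move=> mg gK hs; apply: contrapT => /forallNP nC.
have unb C : exists n, (C%:E < energy mu setT (g n))%E.
  apply: contrapT => /forallNP h; apply: (nC C) => n.
  by rewrite leNgt; apply/negP; exact: h.
have K0 : 0 <= K by apply: le_trans (gK 0%N point); exact: normc_ge0.
have efin m n : energy mu (E m) (g n) = (fine (energy mu (E m) (g n)))%:E.
  rewrite fineK// ge0_fin_numE ?energy_ge0//.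
  by apply: le_lt_trans (energy_bounded_fin m K0 (mg n) (gK n)) _; rewrite ltry.
(* [t] collects a truncation index m, an index i, and the supremum c over all indices of the
   energies on E m. It is finite because the functions are bounded by K and E m has finite measure;
   g i attains at least half of it. The growth 32^j outweighs the factor 16^-j by which the
   coefficients reduce energies. *)
have step j : exists t : nat * nat * R, [/\ 32 ^+ j <= t.2,
    ((t.2 / 2)%:E <= energy mu (E t.1.1) (g t.1.2))%E &
    forall i, (energy mu (E t.1.1) (g i) <= t.2%:E)%E].
  have [n /(energy_exhaustion_gt (mg n))[m mn]] := unb (32 ^+ j).
  pose A := range (fun i => fine (energy mu (E m) (g i))).
  have supA : has_sup A.
    split; first by exists (fine (energy mu (E m) (g 0%N))), 0%N.
    exists (K ^+ 2 * fine (mu (E m))) => _ [i _ <-].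
    by rewrite -lee_fin -efin; exact: energy_bounded_fin.
  have Aub i : fine (energy mu (E m) (g i)) <= sup A.
    by apply: ub_le_sup; [case: supA|exists i].
  have c32 : 32 ^+ j <= sup A.
    by apply: le_trans (Aub n); rewrite ltW// -lte_fin -efin.
  have c0 : 0 < sup A by apply: lt_le_trans c32; rewrite exprn_gt0.
  have [_ [i _ <-] hi] := sup_adherent (divr_gt0 c0 (ltr0Sn R 1)) supA.
  exists (m, i, sup A); split => //=.
    by rewrite efin lee_fin; move: hi; lra.
  by move=> k; rewrite efin lee_fin.
have [t tP] := choice step.
pose m j := (t j).1.1; pose s j := (t j).1.2; pose c j := (t j).2.
have c32 j : 32 ^+ j <= c j by have [] := tP j.
have cs j : ((c j / 2)%:E <= energy mu (E (m j)) (g (s j)))%E by have [] := tP j.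
have cub j i : (energy mu (E (m j)) (g i) <= (c j)%:E)%E by have [] := tP j.
have c0 j : 0 <= c j by apply: le_trans (c32 j); rewrite exprn_ge0.
pose a (b : bool) j : R := (-1) ^+ b * 4^-1 ^+ j.
have a2 b j : csq (a b j)%:C = 16^-1 ^+ j.
  rewrite /csq /= expr0n addr0 /a exprMn -exprM mulnC exprM sqrrN expr1n expr1n mul1r.
  by rewrite -exprM mulnC exprM; congr (_ ^+ _); field.
pose q j x : R[i] := (a false j)%:C * g (s j) x.
(* The sign is chosen greedily: by the parallelogram identity, one of p + q and p - q has at least
   the energy of q. *)
pose sgn (p : T -> R[i]) j : bool :=
  ~~ `[< (energy mu (E (m j)) (q j) <= energy mu (E (m j)) (fun x => (p x + q j x)%R))%E >].
pose P := fix P k : T -> R[i] := if k is j.+1 then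
  fun x => P j x + (a (sgn (P j) j) j)%:C * g (s j) x else fun=> 0.
pose e j := sgn (P j) j.
have PE k x : P k x = \sum_(i < k) (a (e i) i)%:C * g (s i) x.
  by elim: k => [|k ih]; [rewrite big_ord0|rewrite big_ord_recr /= ih].
have mP k : cmeasurable (P k).
  elim: k => [|k ih]; first exact: cmeasurable_cst.
  by apply: cmeasurableD => //; exact: cmeasurableZ.
have mq j : cmeasurable (q j) by exact: cmeasurableZ.
have Ebig j : (energy mu (E (m j)) (q j) <= energy mu (E (m j)) (P j.+1))%E.
  rewrite /= /sgn; case: asboolP => [|/negP] /=; first by [].
  rewrite -ltNge => lt.
  have -> : (fun x => P j x + (a true j)%:C * g (s j) x) = (fun x => P j x - q j x).
    by apply/funext => x; rewrite /q /a expr0 expr1 mulN1r mul1r rmorphN mulNr.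
  rewrite leNgt; apply/negP => lt2.
  have := energy_parallelogram mu (mE (m j)) (mP j) (mq j).
  have qf : energy mu (E (m j)) (q j) \is a fin_num.
    by rewrite energyZ// efin.
  apply/eqP; rewrite lt_eqF//.
  apply: (@lt_le_trans _ _ (energy mu (E (m j)) (q j) + energy mu (E (m j)) (q j))%E).
    by apply: lteD.
  rewrite -mule2n -mule_natl.
  by rewrite leeDr// mule_ge0// energy_ge0.
have Eq j : energy mu (E (m j)) (q j) = ((16^-1 ^+ j)%:E * energy mu (E (m j)) (g (s j)))%E.
  by rewrite energyZ// a2.
pose tl j N x := \sum_(i < N) (a (e (j + i)%N) (j + i)%N)%:C * g (s (j + i)%N) x.
have mtl j N : cmeasurable (tl j N).
  by apply: cmeasurable_sum => i; exact: cmeasurableZ.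
(* The constant 16/9 is the square of 4/3, the sum of the 4^-i. The recursion with weights 4/3 and 4
   reproduces it, since 4/3 + 4 (16/9)/16 = 16/9. *)
have tlE j0 j N : (energy mu (E (m j0)) (tl j N) <= (16 / 9 * 16^-1 ^+ j * c j0)%:E)%E.
  elim: N j => [|N ih] j.
    rewrite /energy /tl; under eq_integral do rewrite big_ord0 /csq /= expr0n addr0.
    by rewrite integral0 lee_fin !mulr_ge0// ?exprn_ge0// invr_ge0.
  pose v x := (a (e j) j)%:C * g (s j) x.
  have tlS x : tl j N.+1 x = v x + tl j.+1 N x.
    rewrite /tl big_ord_recl addn0; congr (_ + _).
    by apply: eq_bigr => i _; rewrite /= /bump /= add1n addnS.
  have mv : cmeasurable v by exact: cmeasurableZ.
  apply: le_trans (@energy_linear_le _ _ _ mu _ v (tl j.+1 N) (tl j N.+1) (4 / 3) 4 _ _ _ _ _ _ _) _ => //.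
    move=> x _; rewrite tlS; move: (v x) (tl _ _ x) => [w x1] [y z]; rewrite /csq /=.
    rewrite -subr_ge0 (_ : _ - _ = (w - 3 * y) ^+ 2 / 3 + (x1 - 3 * z) ^+ 2 / 3).
      by rewrite addr_ge0// divr_ge0// sqr_ge0.
    by field.
  have h1 : (energy mu (E (m j0)) v <= (16^-1 ^+ j * c j0)%:E)%E.
    by rewrite energyZ// a2 EFinM lee_wpmul2l// lee_fin exprn_ge0// invr_ge0.
  apply: (@le_trans _ _ ((4 / 3)%:E * (16^-1 ^+ j * c j0)%:E +
      4%:E * (16 / 9 * 16^-1 ^+ j.+1 * c j0)%:E)%E).
    by apply: leeD; apply: lee_wpmul2l => //; rewrite lee_fin; lra.
  by rewrite -!EFinM -EFinD lee_fin exprS; lra.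
have [p p2 pcv] := hs s e.
have mp : cmeasurable p by have [] := p2.
have tail j : (energy mu (E (m j)) (fun x => (p x - P j.+1 x)%R) <=
    (16 / 9 * 16^-1 ^+ j.+1 * c j)%:E)%E.
  apply: (@energy_fatou _ _ _ mu _ (fun k x => P k x - P j.+1 x)) => //.
  - by move=> k; exact: cmeasurableB.
  - move=> x _; rewrite cReB; under eq_fun do rewrite cReB; apply: cvgB; last exact: cvg_cst.
    by under eq_fun do rewrite PE; have [] := pcv x.
  - move=> x _; rewrite cImB; under eq_fun do rewrite cImB; apply: cvgB; last exact: cvg_cst.
    by under eq_fun do rewrite PE; have [] := pcv x.
  - exists j.+1 => // k /= jk.
    have [N ->] : exists N, k = (j.+1 + N)%N by exists (k - j.+1)%N; rewrite subnKC.
    rewrite (_ : (fun x => P _ x - P j.+1 x) = tl j.+1 N)//.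
    by apply/funext => x; rewrite !PE big_split_ord /= addrAC subrr add0r.
have /square_integrableP[_ pfin] := p2.
have [B0 EB] : 0 <= fine (energy mu setT p) /\ energy mu setT p = (fine (energy mu setT p))%:E.
  by rewrite fine_ge0 ?energy_ge0// fineK// ge0_fin_numE// energy_ge0.
set B := fine (energy mu setT p) in B0 EB.
(* With y = 16^-j c_j, the partial sum ending at index j has energy at least y/2 on E (m j), while
   it is bounded there by 2B plus 2y/9 coming from the tail. Hence y is at most a multiple of B,
   against y >= 2^j. *)
have bnd j : 2 ^+ j <= 9 * B.
  have : (energy mu (E (m j)) (P j.+1) <= 2%:E * B%:E + 2%:E * (16 / 9 * 16^-1 ^+ j.+1 * c j)%:E)%E.
    rewrite (_ : P j.+1 = fun x => p x + - (p x - P j.+1 x)); last first.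
      by apply/funext => x; rewrite opprB addrC subrK.
    apply: le_trans (energyD_le _ _ _ _) _ => //.
      by apply: cmeasurableN; exact: cmeasurableB.
    rewrite energyN; apply: leeD; apply: lee_wpmul2l => //.
    by rewrite -EB; exact: energy_set_le.
  move=> /(le_trans (Ebig j)); rewrite Eq -!EFinM -EFinD.
  have h : ((16^-1 ^+ j * (c j / 2))%:E <= (16^-1 ^+ j)%:E * energy mu (E (m j)) (g (s j)))%E.
    by rewrite EFinM lee_wpmul2l// lee_fin exprn_ge0// invr_ge0.
  move=> /(le_trans h); rewrite lee_fin exprS.
  have : 2 ^+ j <= 16^-1 ^+ j * c j.
    rewrite (_ : 2 = 16^-1 * 32) ?exprMn ?ler_wpM2l ?exprn_ge0 ?invr_ge0//.
    by field.
  lra.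
have /(_ (Num.truncn (9 * B)).+1) := bnd.
rewrite leNgt => /negP; apply.
apply: lt_le_trans (truncnS_gt _) _.
by rewrite -natrX ler_nat ltnW// ltn_expl.
Qed.

(** Bounded energies and pointwise convergence give weak convergence. phi is cut along E m: on E m
    dominated convergence applies, with the sup bound K; off E m Young's inequality pairs the
    bounded energies with the small energy of the rest of phi. The limits are taken in n, then in m,
    then in t. *)
Lemma weak_limit_orthogonal (g : nat -> T -> R[i]) (h phi : T -> R[i]) (K C : R) :
  (forall n, cmeasurable (g n)) -> (forall n x, normc (g n x) <= K) ->
  (forall n, (energy mu setT (g n) <= C%:E)%E) ->
  (forall x, Re (g n x) @[n --> \oo] --> Re (h x)) ->
  (forall x, Im (g n x) @[n --> \oo] --> Im (h x)) ->
  square_integrable mu phi ->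
  (forall n, cintegral mu setT (fun x => g n x * phi x) = 0) ->
  cintegral mu setT (fun x => h x * phi x) = 0.
Proof.
move=> mg gK gC g1 g2 phi2 gphi.
have /square_integrableP[mphi phifin] := phi2.
have mh : cmeasurable h by exact: cmeasurable_lim g1 g2.
have K0 : 0 <= K by apply: le_trans (gK 0%N point); exact: normc_ge0.
have C0 : 0 <= C by rewrite -lee_fin; apply: le_trans (gC 0%N); exact: energy_ge0.
have hC : (energy mu setT h <= C%:E)%E.
  by apply: (energy_fatou measurableT mg) => //; exact: nearW.
have hK x : normc (h x) <= K.
  exact: cvg_normc_le (fun n => gK n x) (g1 x) (g2 x).
pose dl n x := h x - g n x.
have mdl n : cmeasurable (dl n) by exact: cmeasurableB.
have dlC n : (energy mu setT (dl n) <= (4 * C)%:E)%E.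
  apply: le_trans (energyD_le _ _ _ _) _ => //; first exact: cmeasurableN.
  rewrite energyN; apply: (@le_trans _ _ (2%:E * C%:E + 2%:E * C%:E)%E).
    by apply: leeD; apply: lee_wpmul2l.
  by rewrite -!EFinM -EFinD lee_fin; lra.
have dlK n x : normc (dl n x) <= K + K.
  by apply: le_trans (le_normcD _ _) _; rewrite normcN; exact: lerD.
have gfin n : (energy mu setT (g n) < +oo)%E by rewrite (le_lt_trans (gC n))// ltry.
have hfin : (energy mu setT h < +oo)%E by rewrite (le_lt_trans hC)// ltry.
have dlfin n : (energy mu setT (dl n) < +oo)%E by rewrite (le_lt_trans (dlC n))// ltry.
pose X := cintegral mu setT (fun x => h x * phi x).
have XE n : X = cintegral mu setT (fun x => dl n x * phi x).
  rewrite -[X]subr0 -(gphi n) -cintegralB//.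
  - by congr cintegral; apply/funext => x; rewrite mulrBl.
  - exact: cintegrableM.
  - exact: cintegrableM.
pose p m x := (\1_(E m) x : R)%:C * phi x.
pose r m x := (\1_(~` E m) x : R)%:C * phi x.
have mi m : cmeasurable (fun x => (\1_(E m) x : R)%:C) by exact: cmeasurable_indic.
have mp m : cmeasurable (p m) by exact: cmeasurableM.
have mr m : cmeasurable (r m).
  by apply: cmeasurableM => //; apply: cmeasurable_indic; exact: measurableC.
have prE m x : phi x = p m x + r m x.
  by rewrite /p /r -mulrDl -rmorphD /= !indicE in_setC; case: (_ \in _); rewrite ?addr0 ?add0r mul1r.
have indic_energy m : (energy mu setT (fun x => (\1_(E m) x : R)%:C) < +oo)%E.
  rewrite /energy (_ : (fun x => _) = (fun x => (\1_(E m) x)%:E)).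
    by rewrite integral_indic// setIT.
  apply/funext => x; rewrite /csq /= expr0n addr0 indicE; congr EFin.
  by case: (_ \in _); rewrite ?expr1n ?expr0n.
have ip m : cintegrable mu setT (p m) by exact: cintegrableM.
have csqp_le D x : csq ((\1_D x : R)%:C * phi x) <= csq (phi x).
  rewrite csqM ler_piMl ?csq_ge0// /csq /= expr0n addr0 indicE.
  by case: (_ \in _); rewrite ?expr1n ?expr0n.
have pfin m : (energy mu setT (p m) < +oo)%E.
  apply: le_lt_trans phifin; apply: ge0_le_integral => //; try energy_side.
  by move=> x _; rewrite lee_fin csqp_le.
have rfin m : (energy mu setT (r m) < +oo)%E.
  apply: le_lt_trans phifin; apply: ge0_le_integral => //; try energy_side.
  by move=> x _; rewrite lee_fin csqp_le.
pose A m := fine (energy mu setT (r m)).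
have rA m : (energy mu setT (r m) <= (A m)%:E)%E.
  by rewrite fineK// ge0_fin_numE// energy_ge0.
have A0 : A m @[m --> \oo] --> 0.
  have -> : A = fun m => (\int[mu]_x csq (r m x))%R by [].
  have -> : 0 = (\int[mu]_(x in setT) (cst 0 x) : R)%R by rewrite Rintegral_cst// mul0r.
  apply: (@Rintegral_dct _ _ _ mu setT _ _ (fun x => csq (phi x))) => //.
  - by move=> m; exact: measurable_csq.
  - move=> x _; have [N _ EN] : (\bigcup_m E m) x by rewrite Ecover.
    apply: cvg_near_cst; exists N => // m /= Nm.
    rewrite /r csqM indicE memNset ?csqM; last first.
      by move=> /=; apply; move: EN; apply/subsetPset/Eincr.
    by rewrite /csq /= expr0n !addr0 mul0r.
  - exact: integrable_csq.
  - by move=> m x _; rewrite ger0_norm ?csq_ge0// csqp_le.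
have cv m : Re (cintegral mu setT (fun x => dl n x * p m x)) @[n --> \oo] --> (0 : R) /\
            Im (cintegral mu setT (fun x => dl n x * p m x)) @[n --> \oo] --> (0 : R).
  have z : cintegral mu setT (fun=> 0 : R[i]) = 0.
    by rewrite /cintegral /= Rintegral_cst// mul0r.
  have [|||||] := @cintegral_dct _ _ _ mu setT (fun n x => dl n x * p m x)
    (fun=> 0) (fun x => (K + K) * (`|Re (p m x)| + `|Im (p m x)|)) measurableT.
  - by move=> n; exact: cmeasurableM.
  - move=> x _; under eq_fun do rewrite cReM /dl cReB cImB.
    have -> : Re 0 = (Re (h x) - Re (h x)) * Re (p m x) - (Im (h x) - Im (h x)) * Im (p m x).
      by rewrite !subrr !mul0r subr0.
    by apply: cvgB; apply: cvgM; try exact: cvg_cst; apply: cvgB => //; exact: cvg_cst.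
  - move=> x _; under eq_fun do rewrite cImM /dl cReB cImB.
    have -> : Im 0 = (Re (h x) - Re (h x)) * Im (p m x) + (Im (h x) - Im (h x)) * Re (p m x).
      by rewrite !subrr !mul0r addr0.
    by apply: cvgD; apply: cvgM; try exact: cvg_cst; apply: cvgB => //; exact: cvg_cst.
  - have := integrableZl measurableT (K + K) (integrable_ReIm measurableT (ip m)).
    exact: eq_integrable.
  - move=> n x _; apply: le_trans (normcM_le (dlK _ _) (lexx _)) _.
    by rewrite ler_wpM2l ?normc_le_ReIm// addr_ge0.
  - by rewrite z.
have bound (t : R) m : 0 < t -> `|Re X| <= t * (4 * C) + t^-1 * A m /\
                          `|Im X| <= t * (4 * C) + t^-1 * A m.
  move=> t0; have [c1 c2] := cv m.
  have split_ n : X = cintegral mu setT (fun x => dl n x * p m x) +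
                      cintegral mu setT (fun x => dl n x * r m x).
    rewrite (XE n) -cintegralD//; try exact: cintegrableM.
    by congr cintegral; apply/funext => x; rewrite -mulrDr -prE.
  have yb n := cintegral_young measurableT t0 (mdl n) (mr m) (dlC n) (rA m).
  split.
    have {}c1 : `|Re X - Re (cintegral mu setT (fun x => dl n x * p m x))| @[n --> \oo] --> `|Re X|.
      by apply: cvg_norm; rewrite -[X in _ --> X]subr0; apply: cvgB => //; exact: cvg_cst.
    rewrite -(cvg_lim _ c1)//; apply: limr_le; first by apply/cvg_ex; eexists; exact: c1.
    by apply: nearW => n; rewrite (split_ n) cReD addrAC subrr add0r; have [] := yb n.
  have {}c2 : `|Im X - Im (cintegral mu setT (fun x => dl n x * p m x))| @[n --> \oo] --> `|Im X|.
    by apply: cvg_norm; rewrite -[X in _ --> X]subr0; apply: cvgB => //; exact: cvg_cst.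
  rewrite -(cvg_lim _ c2)//; apply: limr_le; first by apply/cvg_ex; eexists; exact: c2.
  by apply: nearW => n; rewrite (split_ n) cImD addrAC subrr add0r; have [] := yb n.
have zero (y : R) : (forall t m, 0 < t -> `|y| <= t * (4 * C) + t^-1 * A m) -> y = 0.
  move=> yb; have yt t : 0 < t -> `|y| <= t * (4 * C).
    move=> t0; have c : t * (4 * C) + t^-1 * A m @[m --> \oo] --> t * (4 * C).
      rewrite -[X in _ --> X]addr0 -(mulr0 t^-1); apply: cvgD; first exact: cvg_cst.
      exact: cvgMr.
    rewrite -(cvg_lim _ c)//; apply: limr_ge; first by apply/cvg_ex; eexists; exact: c.
    by apply: nearW => m; exact: yb.
  apply/eqP; rewrite -normr_eq0 eq_le normr_ge0 andbT.
  have c4 : 0 < 4 * C + 1 by lra.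
  apply/ler_addgt0Pr => e e0; rewrite add0r.
  apply: le_trans (yt (e / (4 * C + 1)) (divr_gt0 e0 c4)) _.
  by rewrite mulrAC ler_pdivrMr// ler_pM2l// lerDl.
by apply: complex_eqP; apply: zero => t m t0; have [] := bound t m t0.
Qed.

End exhaustion.

(** * Lebesgue measure and Fourier transforms on R^d *)

Section lebesgue_boxes.
Context {R : realType}.

Definition box n (I : set R) : set 'rV[R]_n := [set x | forall i, I (x ord0 i)].

Lemma measurable_preimage_coord n (i : 'I_n) (I : set R) : measurable I ->
  measurable [set x : 'rV[R]_n | I (x ord0 i)].
Proof.
move=> mI; rewrite -[X in measurable X]setTI.
exact: (@measurable_coord _ (measurableTypeR R) n i).
Qed.

Lemma measurable_box n (I : set R) : measurable I -> measurable (@box n I).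
Proof.
move=> mI; rewrite (_ : box I = \bigcap_(i in setT) [set x : 'rV[R]_n | I (x ord0 i)]).
  apply: fin_bigcap_measurable => // i _; exact: measurable_preimage_coord.
by apply/seteqP; split => [x xI i _|x xI i]; [exact: xI|exact: (xI i)].
Qed.

Lemma lebesgue_box n (I : set R) : measurable I ->
  lebesgue_rV n (box I) = (lebesgue_measure I ^+ n)%E.
Proof.
move=> mI; elim: n => [|n ih].
  rewrite expe0 /= diracE mem_set// => -[].
  by [].
rewrite expeS -ih -lebesgue_stepX//; last exact: measurable_box.
congr (lebesgue_step _ _); apply/seteqP; split => x /=.
  by move=> xI; split => // i; rewrite mxE.
move=> [x0 xI] i; case: (unliftP ord0 i) => [j ->|->//].
by have := xI j; rewrite mxE.
Qed.

End lebesgue_boxes.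

Section translation.
Context {R : realType}.

Definition translation1 (c x : measurableTypeR R) : measurableTypeR R := x + c.

Lemma measurable_translation1 c : measurable_fun setT (translation1 c).
Proof. by apply: measurable_funD => //; exact: measurable_cst. Qed.

HB.instance Definition _ c := isMeasurableFun.Build _ _ _ _ (translation1 c)
  (measurable_translation1 c).

Lemma lebesgue_translation1 c (A : set R) : measurable A ->
  pushforward lebesgue_measure (translation1 c) A = lebesgue_measure A.
Proof.
move=> mA; apply/esym/lebesgue_measure_unique => //= _ [[a b]] _ <-.
rewrite /pushforward (_ : translation1 c @^-1` _ = `]a - c, b - c]%classic).
  rewrite !lebesgue_measure_itv/= !lte_fin ltrD2r -!EFinB.
  by congr (if _ then _%:E else _); ring.
apply/seteqP; split => x /=; rewrite !in_itv /= /translation1 ltrBlDr lerBrDr//.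
Qed.

Lemma measurable_addr_rV n (y : 'rV[R]_n) :
  measurable_fun setT (fun x : 'rV[R]_n => x + y).
Proof.
apply: measurable_fun_rVP => i; under eq_fun do rewrite mxE.
apply: measurable_funD; last exact: measurable_cst.
exact: (@measurable_coord _ (measurableTypeR R) n i).
Qed.

Definition translation n (y x : 'rV[R]_n) : 'rV[R]_n := x + y.

HB.instance Definition _ n y := isMeasurableFun.Build _ _ _ _ (@translation n y)
  (measurable_addr_rV y).

(** Induction through the slices of the iterated product: each slice is translated by the remaining
    coordinates of y, and the first coordinate is handled by invariance in dimension one. *)
Lemma lebesgue_rV_translation n (y : 'rV[R]_n) (B : set 'rV[R]_n) : measurable B ->
  lebesgue_rV n (translation y @^-1` B) = lebesgue_rV n B.
Proof.
elim: n y B => [|n ih] y B mB.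
  by congr (lebesgue_rV _ _); apply/funext => x; congr B; apply/rowP => -[].
pose y' : 'rV[R]_n := \row_i y ord0 (lift ord0 i).
pose C := @cons_rV R n @^-1` B.
have mC : measurable C.
  by rewrite -[C]setTI; exact: measurable_cons_rV.
pose F (a : measurableTypeR R) := lebesgue_rV n (xsection C a).
have mF : measurable_fun setT F by exact: (measurable_fun_xsection (lebesgue_rV n) mC).
have e1 : lebesgue_rV n.+1 B = (\int[lebesgue_measure]_a F a)%E by [].
have -> : lebesgue_rV n.+1 (translation y @^-1` B) =
          (\int[lebesgue_measure]_a F (translation1 (y ord0 ord0) a))%E.
  apply: eq_integral => a _; rewrite /F /=.
  rewrite -(ih y'); last exact: measurable_xsection.
  congr (lebesgue_rV _ _); apply/seteqP; split => b; rewrite /xsection/= !inE /C/=;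
    (suff -> : translation y (cons_rV (a, b)) = cons_rV (translation1 (y ord0 ord0) a, translation y' b) by []);
    apply/rowP => i; rewrite !mxE /=; case: (unliftP ord0 i) => [j ->|->]; rewrite ?mxE//.
rewrite e1 -[LHS](@ge0_integral_pushforward _ _ _ _ _ (translation1 (y ord0 ord0)) _ lebesgue_measure setT F)//.
apply: eq_measure_integral => A mA _; exact: lebesgue_translation1.
Qed.

Lemma Rintegral_translation n (y : 'rV[R]_n) (f : 'rV[R]_n -> R) :
  measurable_fun setT f -> (lebesgue_rV n).-integrable setT (EFin \o f) ->
  (\int[lebesgue_rV n]_x f (x + y) = \int[lebesgue_rV n]_x f x)%R.
Proof.
move=> mf intf.
have push A : measurable A ->
    pushforward (lebesgue_rV n) (translation y) A = lebesgue_rV n A.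
  exact: lebesgue_rV_translation.
have mfE : measurable_fun setT (EFin \o f) by exact/measurable_EFinP.
rewrite /Rintegral; congr fine.
rewrite -[LHS](@integral_pushforward _ _ _ _ _ (translation y) _ _ setT (EFin \o f))//.
- by apply: eq_measure_integral => A mA _; exact: push.
- rewrite preimage_setT; apply/integrableP; split.
    by apply: (measurableT_comp mfE); exact: measurable_addr_rV.
  have /integrableP[_ h] := intf.
  have mabs : measurable_fun setT (fun x => `|(EFin \o f) x|%E) by exact: measurableT_comp.
  rewrite -[X in (X < _)%E](@ge0_integral_pushforward _ _ _ _ _ (translation y) _
    (lebesgue_rV n) setT (fun x => `|(EFin \o f) x|%E))//.
  by rewrite (eq_measure_integral (lebesgue_rV n))// => A mA _; exact: push.
Qed.

End translation.

Section test_functions.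
Context {R : realType}.

Lemma normc_cexpi (t : R) : normc (cexpi t) = 1.
Proof. by rewrite /normc/= cos2Dsin2 sqrtr1. Qed.

Lemma cexpiD (s t : R) : cexpi (s + t) = cexpi s * cexpi t.
Proof. by apply: complex_eqP; rewrite !ReImE /= ?cosD ?sinD //; ring. Qed.

Context {d : nat}.
Implicit Types (f g : 'rV[R]_d -> R[i]) (u x y : 'rV[R]_d) (K N : R) (B : set 'rV[R]_d).

Definition cube N : set 'rV[R]_d := box `[- N, N]%classic.

Lemma measurable_cube N : measurable (cube N).
Proof. by apply: measurable_box; exact: measurable_itv. Qed.

Lemma compact_cube N : compact (cube N).
Proof.
apply: (@rV_compact _ _ (fun=> `[- N, N]%classic)) => _; exact: segment_compact.
Qed.

Lemma lebesgue_cube_lty N : (lebesgue_rV d (cube N) < +oo)%E.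
Proof.
rewrite lebesgue_box//.
rewrite lebesgue_measure_itv/=; case: ifP => _; first by rewrite -EFinB -EFin_expe ltry.
by case: d => [|n]; rewrite ?expe0 ?ltry// expeS mul0e.
Qed.

Lemma coord_le_norm x i : `|x ord0 i| <= `|x|.
Proof.
rewrite [leRHS]/Num.norm /= mx_normrE; apply/bigmax_geP; right => /=.
by exists (ord0, i).
Qed.

Lemma cubeP N x : 0 <= N -> cube N x <-> `|x| <= N.
Proof.
move=> N0; split=> [xN|xN i /=]; last first.
  by rewrite in_itv/= -ler_norml (le_trans (coord_le_norm _ _)).
rewrite [leLHS]/Num.norm /= mx_normrE; apply/bigmax_leP; split => //.
move=> [i j] _ /=; rewrite ord1; have := xN j.
by rewrite /= in_itv/= -ler_norml.
Qed.

Lemma subset_cube N N' : N <= N' -> cube N `<=` cube N'.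
Proof.
move=> NN x xN i; have := xN i; rewrite /= !in_itv/= => /andP[a b].
by apply/andP; split; [apply: le_trans a; rewrite lerN2|exact: le_trans NN].
Qed.

(** Membership in the test class with an explicit sup bound and support radius. Sharing K and N
    along a sequence is the mode of bounded convergence under which the functionals are shown to be
    closed. *)
Definition controlled K N f := [/\ cmeasurable f, forall x, normc (f x) <= K &
  forall x, ~ cube N x -> f x = 0].

Lemma CcbP B f : Ccb B f <->
  (exists K N, controlled K N f) /\ forall x, ~ B x -> f x = 0.
Proof.
split=> [[mf [K fK] [N [_ bN]] fB]|[[K [N [mf fK fN]]] fB]].
  split=> //; exists K, (`|N| + 1); split => // x xN; apply/eqP.
  apply: contrapT => /negP f0; apply: xN; apply/cubeP; first by rewrite addr_ge0.
  by apply: bN => //; rewrite (le_lt_trans (ler_norm N))// ltrDl.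
split => //; first by exists K.
exists `|N|; split; first exact: num_real.
move=> M NM x /= fx0; apply: le_trans (ltW NM); apply/cubeP => //.
apply: (subset_cube (ler_norm N)); apply: contrapT => nx.
by move: fx0; rewrite fN// eqxx.
Qed.

Lemma Ccb_sub B B' f : B `<=` B' -> Ccb B f -> Ccb B' f.
Proof. by move=> BB [mf fK bf fB]; split => // x nB; apply: fB => /BB. Qed.

Lemma CcbD B f g : Ccb B f -> Ccb B g -> Ccb B (fun x => f x + g x).
Proof.
move=> /CcbP[[K [N [mf fK fN]]] fB] /CcbP[[K' [N' [mg gK gN]]] gB].
apply/CcbP; split; last by move=> x nx; rewrite fB// gB// addr0.
exists (K + K'), (Num.max N N'); split; first exact: cmeasurableD.
  by move=> x; apply: le_trans (le_normcD _ _) _; exact: lerD.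
move=> x nx; rewrite fN ?gN ?addr0// => xN; apply: nx; apply: subset_cube xN;
  by rewrite le_max lexx ?orbT.
Qed.

Lemma CcbM B f g : bounded_measurable g -> Ccb B f -> Ccb B (fun x => g x * f x).
Proof.
move=> [mg [K' gK]] /CcbP[[K [N [mf fK fN]]] fB].
apply/CcbP; split; last by move=> x nx; rewrite fB// mulr0.
exists (K' * K), N; split; first exact: cmeasurableM.
  by move=> x; exact: normcM_le.
by move=> x nx; rewrite fN// mulr0.
Qed.

Lemma CcbZ B (c : R[i]) f : Ccb B f -> Ccb B (fun x => c * f x).
Proof. by apply: CcbM; exact: bounded_measurable_cst. Qed.

Lemma CcbB B f g : Ccb B f -> Ccb B g -> Ccb B (fun x => f x - g x).
Proof.
move=> Bf Bg; rewrite (_ : (fun _ => _) = (fun x => f x + (-1) * g x)).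
  by apply: CcbD => //; exact: CcbZ.
by apply/funext => x; rewrite mulN1r.
Qed.

Lemma Ccb0 B : Ccb B (fun=> 0).
Proof.
apply/CcbP; split => //; exists 0, 0; split => [|x|//].
  exact: cmeasurable_cst.
by rewrite (normcC 0) normr0.
Qed.

Lemma Ccb_shift x f : Ccb setT f -> Ccb setT (shift_rV x f).
Proof.
move=> /CcbP[[K [N [mf fK fN]]] _]; apply/CcbP; split; last by move=> y /(_ I).
exists K, (`|N| + `|x|); split => [|y|y].
- have [mf1 mf2] := mf; split.
    exact: (measurableT_comp mf1 (measurable_addr_rV (- x))).
  exact: (measurableT_comp mf2 (measurable_addr_rV (- x))).
- exact: fK.
- move=> ny; apply: fN => yN; apply: ny; apply/cubeP; first exact: addr_ge0.
  rewrite -(subrK x y); apply: le_trans (ler_normD _ _) _; rewrite lerD2r.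
  by apply/cubeP => //; exact: subset_cube (ler_norm N) _ yN.
Qed.

Section fourier_transform.

Lemma measurable_coordinate (i : 'I_d) :
  measurable_fun setT (fun x : 'rV[R]_d => x ord0 i).
Proof. exact: (@measurable_coord _ (measurableTypeR R) d i). Qed.

Lemma measurable_dot_pair :
  measurable_fun setT (fun p : 'rV[R]_d * 'rV[R]_d => dot p.1 p.2).
Proof.
apply: measurable_sum => i; apply: measurable_funM.
  exact: (measurableT_comp (measurable_coordinate i) measurable_fst).
exact: (measurableT_comp (measurable_coordinate i) measurable_snd).
Qed.

Lemma cmeasurable_cexpi_comp d' (T : measurableType d') (h : T -> R) :
  measurable_fun setT h -> cmeasurable (fun t => cexpi (h t)).
Proof.
move=> mh; split => /=; (apply: measurableT_comp => //; apply: continuous_measurable_fun).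
  exact: continuous_cos.
exact: continuous_sin.
Qed.

Lemma measurable_dotr u : measurable_fun setT (fun x => dot u x).
Proof. exact: (measurableT_comp measurable_dot_pair (pair1_measurable u)). Qed.

Lemma measurable_dotl x : measurable_fun setT (fun u => dot u x).
Proof. exact: (measurableT_comp measurable_dot_pair (pair2_measurable x)). Qed.

Lemma cmeasurable_kernel u f : cmeasurable f ->
  cmeasurable (fun x => cexpi (- dot u x) * f x).
Proof.
move=> mf; apply: cmeasurableM => //; apply: cmeasurable_cexpi_comp.
by apply: measurable_funN; exact: measurable_dotr.
Qed.

Lemma integrable_cube K N :
  (lebesgue_rV d).-integrable setT (EFin \o (fun x => K * \1_(cube N) x)).
Proof.
have h : (lebesgue_rV d).-integrable setT (EFin \o (\1_(cube N) : 'rV[R]_d -> R)).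
  apply/integrableP; split.
    by apply/measurable_EFinP; apply: measurable_indic; exact: measurable_cube.
  under eq_integral do rewrite gee0_abs ?lee_fin//.
  by rewrite integral_indic// ?setIT ?lebesgue_cube_lty//; exact: measurable_cube.
by have := integrableZl measurableT K h; exact: eq_integrable.
Qed.

Lemma controlled_kernel_le K N f u x : controlled K N f ->
  normc (cexpi (- dot u x) * f x) <= K * \1_(cube N) x.
Proof.
move=> [_ fK fN]; rewrite ComplexField.Normc.normcM normc_cexpi mul1r indicE.
have [xN|xN] := pselect (cube N x); first by rewrite mem_set// mulr1.
by rewrite memNset// fN// mulr0 (normcC 0) normr0.
Qed.

Lemma integrable_kernel K N f u : controlled K N f ->
  cintegrable (lebesgue_rV d) setT (fun x => cexpi (- dot u x) * f x).
Proof.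
move=> cf; have [mf _ _] := cf.
apply: (cintegrable_le measurableT _ (integrable_cube K N)).
  exact: cmeasurable_kernel.
by move=> x _; exact: controlled_kernel_le.
Qed.

Lemma fourierD f g u : Ccb setT f -> Ccb setT g ->
  fourier (fun x => f x + g x) u = fourier f u + fourier g u.
Proof.
move=> /CcbP[[K [N cf]] _] /CcbP[[K' [N' cg]] _].
rewrite /fourier -cintegralD//; [|exact: integrable_kernel cf|exact: integrable_kernel cg].
by congr cintegral; apply/funext => x; rewrite mulrDr.
Qed.

Lemma fourierZ c f u : Ccb setT f ->
  fourier (fun x => c * f x) u = c * fourier f u.
Proof.
move=> /CcbP[[K [N cf]] _]; rewrite /fourier -cintegralZ//; last exact: integrable_kernel cf.
by congr cintegral; apply/funext => x; rewrite mulrCA.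
Qed.

Lemma fourierB f g u : Ccb setT f -> Ccb setT g ->
  fourier (fun x => f x - g x) u = fourier f u - fourier g u.
Proof.
move=> Cf Cg; rewrite -[in RHS]mulN1r -fourierZ// -fourierD//; last exact: CcbZ.
by congr fourier; apply/funext => x; rewrite mulN1r.
Qed.

(** The bound depends on f only through K and N, so it is uniform along controlled sequences, as the
    gliding hump and the weak limit require. The factor 2 accounts for the real and imaginary
    parts. *)
Lemma fourier_bounded K N : exists K', forall f, controlled K N f ->
  forall u, normc (fourier f u) <= K'.
Proof.
exists (2 * (\int[lebesgue_rV d]_x (K * \1_(cube N) x))%R) => f cf u.
apply: le_trans (normc_le_ReIm _) _.
have [i1 i2] := integrable_kernel u cf.
have b1 : `|Re (fourier f u)| <= (\int[lebesgue_rV d]_x (K * \1_(cube N) x))%R.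
  apply: le_trans (le_normr_Rintegral measurableT i1) _.
  apply: le_Rintegral => //; [exact: integrable_norm|exact: integrable_cube|].
  by move=> x _; apply: le_trans (normr_Re_le _) (controlled_kernel_le _ _ cf).
have b2 : `|Im (fourier f u)| <= (\int[lebesgue_rV d]_x (K * \1_(cube N) x))%R.
  apply: le_trans (le_normr_Rintegral measurableT i2) _.
  apply: le_Rintegral => //; [exact: integrable_norm|exact: integrable_cube|].
  by move=> x _; apply: le_trans (normr_Im_le _) (controlled_kernel_le _ _ cf).
by rewrite mulr_natl mulr2n; exact: lerD.
Qed.

(** Tonelli's theorem applied to the positive and the negative part; [Rintegral] is the [fine] part
    of the difference of the two integrals. *)
Lemma measurable_Rintegral_param (k : 'rV[R]_d * 'rV[R]_d -> R) :
  measurable_fun setT k ->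
  measurable_fun setT (fun u => \int[lebesgue_rV d]_x (k (u, x)))%R.
Proof.
move=> mk; have mkE : measurable_fun setT (EFin \o k) by exact/measurable_EFinP.
have m1 := @measurable_fun_fubini_tonelli_F _ _ 'rV[R]_d 'rV[R]_d R (lebesgue_rV d)
  _ (measurable_funepos mkE) (funepos_ge0 _).
have m2 := @measurable_fun_fubini_tonelli_F _ _ 'rV[R]_d 'rV[R]_d R (lebesgue_rV d)
  _ (measurable_funeneg mkE) (funeneg_ge0 _).
rewrite /Rintegral; apply: measurableT_comp; first exact: fine_measurable.
have := emeasurable_funB m1 m2; apply: eq_measurable_fun => u _ /=.
rewrite [RHS]integralE /fubini_F.
by congr (_ - _)%E; apply: eq_integral => x _; rewrite ?funeposE ?funenegE.
Qed.

Lemma cmeasurable_fourier f : cmeasurable f -> cmeasurable (fourier f).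
Proof.
move=> mf; have [m1 m2] : cmeasurable (fun p : 'rV[R]_d * 'rV[R]_d => cexpi (- dot p.1 p.2) * f p.2).
  apply: cmeasurableM.
    apply: cmeasurable_cexpi_comp; apply: measurable_funN; exact: measurable_dot_pair.
  have [f1 f2] := mf; split.
    exact: (measurableT_comp f1 measurable_snd).
  exact: (measurableT_comp f2 measurable_snd).
split; [exact: (measurable_Rintegral_param m1)|exact: (measurable_Rintegral_param m2)].
Qed.

Lemma fourier_cvg (h : nat -> 'rV[R]_d -> R[i]) f K N u :
  (forall n, controlled K N (h n)) ->
  (forall x, Re (h n x) @[n --> \oo] --> Re (f x)) ->
  (forall x, Im (h n x) @[n --> \oo] --> Im (f x)) ->
  Re (fourier (h n) u) @[n --> \oo] --> Re (fourier f u) /\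
  Im (fourier (h n) u) @[n --> \oo] --> Im (fourier f u).
Proof.
move=> ch h1 h2; apply: (cintegral_dct measurableT _ _ _ (integrable_cube K N)).
- by move=> n; apply: cmeasurable_kernel; have [] := ch n.
- move=> x _; under eq_fun do rewrite cReM; rewrite cReM.
  by apply: cvgB; apply: cvgM; try exact: cvg_cst; [exact: h1|exact: h2].
- move=> x _; under eq_fun do rewrite cImM; rewrite cImM.
  by apply: cvgD; apply: cvgM; try exact: cvg_cst; [exact: h2|exact: h1].
- by move=> n x _; exact: controlled_kernel_le.
Qed.

Lemma dotDr u x y : dot u (x + y) = dot u x + dot u y.
Proof. by rewrite /dot -big_split; apply: eq_bigr => i _; rewrite mxE mulrDr. Qed.

Lemma fourier_shift x f u : Ccb setT f ->
  fourier (shift_rV x f) u = cexpi (- dot u x) * fourier f u.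
Proof.
move=> Cf; have /CcbP[[K [N cf]] _] := Cf; have /CcbP[[K' [N' cf']] _] := Ccb_shift x Cf.
have [mf _ _] := cf.
have [m1 m2] := cmeasurable_kernel u (let: And3 m _ _ := cf' in m).
have [i1 i2] := integrable_kernel u cf'.
transitivity (cintegral (lebesgue_rV d) setT (fun y => cexpi (- dot u x) * (cexpi (- dot u y) * f y))).
  have e y : cexpi (- dot u x) * (cexpi (- dot u y) * f y) =
             cexpi (- dot u (y + x)) * shift_rV x f (y + x).
    by rewrite mulrA -cexpiD /shift_rV addrK dotDr opprD addrC.
  under [in RHS]eq_fun do rewrite e.
  by rewrite /fourier /cintegral -(Rintegral_translation x m1 i1) -(Rintegral_translation x m2 i2).
by rewrite cintegralZ//; exact: integrable_kernel cf.
Qed.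

End fourier_transform.

End test_functions.

Section generators.
Context {R : realType} {d : nat}.

Lemma measurable_ray_sub (T : pointedType) (G : set (set T)) (h : T -> R) :
  (forall a, <<s G>> [set x | a < h x]) ->
  forall B : set R, measurable B -> <<s G>> (h @^-1` B).
Proof.
move=> hG B mB.
have mh : measurable_fun setT (h : g_sigma_algebraType G -> R).
  apply: (measurability _ (RGenOInfty.measurableE R)) => _ [_ [a ->] <-].
  rewrite setTI; have := hG a; rewrite (_ : [set _ | _] = h @^-1` `]a, +oo[)//.
  by apply/seteqP; split => x /=; rewrite in_itv/= andbT.
by have := mh measurableT B mB; rewrite setTI.
Qed.

Lemma measurable_rV_sub (G : set (set 'rV[R]_d)) :
  (forall i a, <<s G>> [set x | a < x ord0 i]) ->
  @measurable _ 'rV[R]_d `<=` <<s G>>.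
Proof.
move=> hG; apply: smallest_sub; first exact: smallest_sigma_algebra.
rewrite -bigcup_seq; apply: bigcup_sub => i _ _ [B mB <-]; rewrite setTI.
by apply: measurable_ray_sub => // a; exact: hG.
Qed.

Definition character (x u : 'rV[R]_d) : R[i] := cexpi (- dot u x).

Lemma dot_delta (u : 'rV[R]_d) i (t : R) : dot u (t *: delta_mx ord0 i) = t * u ord0 i.
Proof.
rewrite /dot (bigD1 i)//= big1 ?addr0 => [|j ji].
  by rewrite !mxE !eqxx mulr1 mulrC.
by rewrite !mxE (negbTE ji) andbF !mulr0.
Qed.

(** A single character is periodic and cannot single out a half-space u_i > a. Frequencies tending
    to 0 repair this: the characters at -e_i/(n+1) have real and imaginary parts cos(u_i/(n+1)) and
    sin(u_i/(n+1)), from which the subtraction formula recovers the shifted sines. *)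
Lemma characters_generate : @measurable _ 'rV[R]_d `<=`
  <<s [set B | exists x a, B = [set u | Re (character x u) < a] \/
                           B = [set u | Im (character x u) < a]] >>.
Proof.
set G := [set B | _]; apply: measurable_rV_sub => i a.
pose e n : 'rV[R]_d := (- n.+1%:R^-1) *: delta_mx ord0 i.
have eE n u : character (e n) u = cexpi (u ord0 i / n.+1%:R).
  by rewrite /character dot_delta mulNr opprK mulrC.
have neg_ray (h : 'rV[R]_d -> R) : (forall b, G [set u | h u < b]) ->
    measurable_fun setT (h : g_sigma_algebraType G -> R).
  move=> hG; apply: (measurability _ (RGenInftyO.measurableE R)) => _ [_ [b ->] <-].
  rewrite setTI; apply: sub_gen_smallest; have := hG b.
  by congr G; apply/seteqP; split => u /=; rewrite in_itv.
have mc n : measurable_fun setT (fun u : g_sigma_algebraType G => cos (u ord0 i / n.+1%:R)).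
  have := @neg_ray (fun u => Re (character (e n) u)).
  under eq_fun do rewrite eE; apply => b; exists (e n), b; left.
  by under eq_set do rewrite eE.
have ms n : measurable_fun setT (fun u : g_sigma_algebraType G => sin (u ord0 i / n.+1%:R)).
  have := @neg_ray (fun u => Im (character (e n) u)).
  under eq_fun do rewrite eE; apply => b; exists (e n), b; right.
  by under eq_set do rewrite eE.
(* u_i > a iff sin ((u_i - a) / n) > 0 for all large n *)
pose V n : set (g_sigma_algebraType G) := [set u | 0 < sin ((u ord0 i - a) / n.+1%:R)].
have mV n : measurable (V n).
  have m : measurable_fun setT (fun u : g_sigma_algebraType G =>
      sin (u ord0 i / n.+1%:R) * cos (a / n.+1%:R) - cos (u ord0 i / n.+1%:R) * sin (a / n.+1%:R)).
    by apply: measurable_funB; apply: measurable_funM.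
  have := m measurableT `]0, +oo[%classic (measurable_itv _); rewrite setTI.
  congr measurable; apply/seteqP; split => u /=; by rewrite in_itv/= andbT -sinB -mulrBl.
have small (t : R) : 0 < t -> exists N, forall n, (N <= n)%N -> 0 < t / n.+1%:R < pi.
  move=> t0; exists (Num.truncn (t / pi)) => n Nn; rewrite divr_gt0//=.
  rewrite ltr_pdivrMr// -ltr_pdivrMl ?pi_gt0// mulrC.
  by apply: lt_le_trans (truncnS_gt _) _; rewrite ler_nat ltnS.
have mU : measurable (\bigcup_N \bigcap_(n in [set n | (N <= n)%N]) V n).
  by apply: bigcupT_measurable => N; apply: bigcap_measurable => //; exists N => /=.
apply: (@eq_ind (set 'rV[R]_d) _ (fun B => <<s G>> B) mU); apply/esym.
apply/seteqP; split => [u /= au|u [N _ uN] /=].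
  have [|N hN] := small (u ord0 i - a); first by rewrite subr_gt0.
  by exists N => // n /= /hN; exact: sin_gt0_pi.
rewrite ltNge; apply/negP; rewrite le_eqVlt => /orP[/eqP ua|ua].
  by have := uN N (leqnn N); rewrite /V/= ua subrr mul0r sin0 ltxx.
have [|N' hN] := small (a - u ord0 i); first by rewrite subr_gt0.
have := uN (maxn N N') (leq_maxl _ _); have := hN (maxn N N') (leq_maxr _ _).
move=> /sin_gt0_pi h1; rewrite /V /= -opprB mulNr sinN oppr_gt0 => h2.
by have := lt_trans h1 h2; rewrite ltxx.
Qed.

(** With n+1 above the l^1 norm of u, the phase u.x stays in [-1, 1] on the cube of side 1/(n+1), so
    the real part of the integrand is at least cos 1 > 0 there. Sides of this form leave countably
    many cubes to serve all u. *)
Lemma fourier_nonvanishing (u : 'rV[R]_d) : exists n,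
  fourier (fun x => (\1_(box `]0, n.+1%:R^-1[%classic) x : R)%:C) u != 0.
Proof.
pose n := Num.truncn (\sum_(i < d) `|u ord0 i|).
set I := `]0, n.+1%:R^-1[%classic : set R.
have mI : measurable I by exact: measurable_itv.
have mb : measurable (@box R d I) by exact: measurable_box.
exists n; apply/eqP => /(congr1 (fun z => Re z)).
pose c := cos 1 : R.
have lb x : box I x -> c <= cos (dot u x).
  move=> xI; have ux : `|dot u x| <= 1.
    apply: le_trans (ler_norm_sum _ _ _) _.
    apply: (@le_trans _ _ (\sum_(i < d) `|u ord0 i| * n.+1%:R^-1)).
      apply: ler_sum => i _; rewrite normrM ler_wpM2l//.
      by have := xI i; rewrite /I/= in_itv/= => /andP[a b]; rewrite gtr0_norm// ltW.
    by rewrite -mulr_suml ler_pdivrMr// mul1r ltW// truncnS_gt.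
  rewrite -(cos_norm (dot u x)).
  have [->|/eqP ne] := eqVneq `|dot u x| 1; first by [].
  have lt1 : `|dot u x| < 1 by rewrite lt_neqAle ux andbT; exact/eqP.
  have pi1 : (1 : R) <= pi by apply: le_trans (pi_ge2 R); rewrite ler1n.
  rewrite ltW// ltr_cos ?in_itv/= ?normr_ge0 ?ler01 ?pi1//=.
  exact: le_trans ux pi1.
have vol0 : 0 < fine (lebesgue_rV d (box I)) /\ (lebesgue_rV d (box I) < +oo)%E.
  rewrite lebesgue_box// /I lebesgue_measure_itv/= lte_fin invr_gt0 ltr0Sn.
  by rewrite -EFinB subr0 -EFin_expe ltry /= exprn_gt0// invr_gt0.
have [v0 vfin] := vol0.
have ind : (lebesgue_rV d).-integrable setT (EFin \o (fun x => \1_(box I) x)).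
  apply/integrableP; split; first by apply/measurable_EFinP; exact: measurable_indic.
  under eq_integral do rewrite gee0_abs ?lee_fin//.
  by rewrite integral_indic// setIT.
have cind : controlled 1 n.+1%:R^-1 (fun x : 'rV[R]_d => (\1_(box I) x : R)%:C).
  split; [exact: (cmeasurable_indic mb)|exact: normc_indic|].
  move=> x nx; rewrite indicE memNset// => xI; apply: nx => i.
  have := xI i; rewrite /I/= !in_itv/= => /andP[a b]; apply/andP; split; last exact: ltW.
  by apply: le_trans (ltW a); rewrite oppr_le0 invr_ge0.
have [ik _] := integrable_kernel u cind.
have : c * fine (lebesgue_rV d (box I)) <= Re (fourier (fun x => (\1_(box I) x : R)%:C) u).
  have -> : fine (lebesgue_rV d (box I)) = (\int[lebesgue_rV d]_x \1_(box I) x)%R.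
    by rewrite /Rintegral integral_indic// setIT.
  rewrite -RintegralZl//; apply: le_Rintegral => //.
    by have := integrableZl measurableT c ind; exact: eq_integrable.
  move=> x _; rewrite [cexpi _ * _]mulrC Re_mulC /= cosN indicE.
  have [xI|xI] := pselect (box I x); first by rewrite mem_set// mulr1 mul1r lb.
  by rewrite memNset// mulr0 mul0r.
move=> h e; move: h; rewrite e /= leNgt => /negP; apply.
by rewrite mulr_gt0// cos1_gt0.
Qed.

End generators.

(** * Pairing transforms with phi: stability under bounded limits, and uniqueness *)

Section spectral.
Context {R : realType} {d : nat}.
Variable S : {measure set 'rV[R]_d -> \bar R}.
Hypothesis Stempered : (\int[S]_u ((1 + enorm u) ^- d.+1)%:E < +oo)%E.
Hypothesis Sfinite : forall f, Ccb setT f -> (energy S setT (fourier f) < +oo)%E.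

(** On a cube the tempered weight is bounded below by the positive constant c, so Markov's
    inequality applies. These cubes are the exhaustion by sets of finite measure used in the weak
    limit argument. *)
Lemma spectral_cube_lty m : (S (cube m%:R) < +oo)%E.
Proof.
pose c : R := (1 + Num.sqrt (d%:R * m%:R ^+ 2)) ^- d.+1.
have c0 : 0 < c by rewrite invr_gt0 exprn_gt0// ltr_pwDl// sqrtr_ge0.
have mc : measurable (@cube R d m%:R) by exact: measurable_cube.
have mdot : measurable_fun setT (fun u : 'rV[R]_d => dot u u).
  by apply: measurable_sum => i; apply: measurable_funM; exact: measurable_coordinate.
have mw : measurable_fun setT (fun u : 'rV[R]_d => (1 + enorm u) ^- d.+1).
  have : measurable_fun [set: R] (fun t : R => (1 + Num.sqrt t) ^- d.+1).
    apply: nonincreasing_measurable => // s t st.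
    have p (r : R) : 0 < (1 + Num.sqrt r) ^+ d.+1 by rewrite exprn_gt0// ltr_pwDl// sqrtr_ge0.
    rewrite lef_pV2 ?posrE//; apply: lerXn2r; rewrite ?nnegrE ?addr_ge0 ?sqrtr_ge0//.
    by rewrite lerD2l ler_wsqrtr.
  by move=> h; exact: (measurableT_comp h mdot).
have le_int : (c%:E * S (cube m%:R) <= \int[S]_u ((1 + enorm u) ^- d.+1)%:E)%E.
  have p (u : 'rV[R]_d) : 0 < (1 + enorm u) ^+ d.+1 by rewrite exprn_gt0// ltr_pwDl// sqrtr_ge0.
  rewrite -integral_cst//; apply: (@le_trans _ _ (\int[S]_(u in cube m%:R) ((1 + enorm u) ^- d.+1)%:E)%E).
    apply: ge0_le_integral => //.
    - by move=> u _; rewrite lee_fin ltW.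
    - by apply/measurable_EFinP; exact: measurable_funTS.
    - move=> u uc; rewrite lee_fin /c lef_pV2 ?posrE//.
      apply: lerXn2r; rewrite ?nnegrE ?addr_ge0 ?sqrtr_ge0//.
      rewrite lerD2l /enorm ler_wsqrtr// /dot.
      apply: (@le_trans _ _ (\sum_(i < d) m%:R ^+ 2)).
        apply: ler_sum => i _; rewrite -expr2 -real_normK ?num_real//.
        rewrite lerXn2r ?nnegrE//.
        by have := uc i; rewrite /= in_itv/= -ler_norml.
      by rewrite sumr_const card_ord -[_ *+ d]mulr_natl.
  apply: ge0_subset_integral => //; first by apply/measurable_EFinP.
  by move=> u _; rewrite lee_fin invr_ge0 ltW.
have := le_lt_trans le_int Stempered.
by case: (S _) => [r| |] //; rewrite ?ltry// gt0_muley ?lte_fin// ltxx.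
Qed.

Lemma cube_nondecreasing : nondecreasing_seq (fun m => @cube R d m%:R).
Proof. by move=> m n mn; apply/subsetPset; apply: subset_cube; rewrite ler_nat. Qed.

Lemma cube_cover : \bigcup_m @cube R d m%:R = setT.
Proof.
apply/seteqP; split => // u _; exists (Num.truncn `|u|).+1 => //; apply/cubeP => //.
by rewrite ltW// truncnS_gt.
Qed.

(** This builds the series of the gliding hump on the space side. The weights make the partial sums
    converge under a common bound with supports in one cube, so the sum is again a test function,
    and [Sfinite] applies to its transform. Comparing 4^-n with 2^-n, whose sums are at most 2,
    gives the bound 2K. *)
Lemma series_controlled (h : nat -> 'rV[R]_d -> R[i]) K N (a : nat -> R) :
  (forall n, controlled K N (h n)) -> (forall n, `|a n| <= 4^-1 ^+ n) ->
  let u k x := \sum_(i < k) (a i)%:C * h i x in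
  (forall k, controlled (2 * K) N (u k)) /\
  exists f, [/\ controlled (2 * K) N f,
    forall x, Re (u k x) @[k --> \oo] --> Re (f x) &
    forall x, Im (u k x) @[k --> \oo] --> Im (f x)].
Proof.
move=> ch a4 u.
have K0 : 0 <= K by have [_ /(_ point) + _] := ch 0%N; apply: le_trans; exact: normc_ge0.
have mh n : cmeasurable (h n) by have [] := ch n.
have hK n x : normc (h n x) <= K by have [_ + _] := ch n; exact.
have a2 n : `|a n| <= 2^-1 ^+ n.
  apply: le_trans (a4 n) _; rewrite lerXn2r ?nnegrE ?invr_ge0//.
  by rewrite lef_pV2 ?posrE// ler_nat.
have term n x : normc ((a n)%:C * h n x) <= K * 2^-1 ^+ n.
  by rewrite mulrC; apply: normcM_le => //; rewrite normcC.
have cu k : controlled (2 * K) N (u k).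
  split; first by apply: cmeasurable_sum => i; exact: cmeasurableZ.
  - move=> x; apply: (@le_trans _ _ (\sum_(0 <= i < k) K * 2^-1 ^+ i)).
      rewrite big_mkord /u; elim/big_ind2 : _ => [|z1 b1 z2 b2 h1 h2|i _].
      + by rewrite (normcC 0) normr0.
      + by apply: le_trans (le_normcD _ _) _; exact: lerD.
      + exact: term.
    by rewrite -mulr_sumr [2 * K]mulrC ler_wpM2l// sum_half.
  - move=> x nx; rewrite /u big1// => i _; have [_ _ ->//] := ch i; exact: mulr0.
have diff k x : u k.+1 x - u k x = (a k)%:C * h k x.
  by rewrite /u big_ord_recr/= addrAC subrr add0r.
have cR x : cvgn (fun k => Re (u k x)).
  apply: (@is_cvg_summable_diff _ _ K) => k; rewrite -cReB diff.
  exact: le_trans (normr_Re_le _) (term _ _).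
have cI x : cvgn (fun k => Im (u k x)).
  apply: (@is_cvg_summable_diff _ _ K) => k; rewrite -cImB diff.
  exact: le_trans (normr_Im_le _) (term _ _).
split => //; exists (fun x => limn (fun k => Re (u k x)) +i* limn (fun k => Im (u k x))).
split; [|exact: cR|exact: cI]; split.
- by apply: (cmeasurable_lim (f := u)) => [k|x|x]; [have [] := cu k|exact: cR|exact: cI].
- move=> x; have uK k : normc (u k x) <= 2 * K by have [_ + _] := cu k; exact.
  apply: (@cvg_normc_le _ (fun k => u k x)); [exact: uK|exact: cR|exact: cI].
- move=> x nx; have u0 k : u k x = 0 by have [_ _ ->] := cu k.
  by apply: complex_eqP => /=; (under eq_fun do rewrite u0); exact: lim_cst.
Qed.

Lemma controlled_Ccb (K N : R) (f : 'rV[R]_d -> R[i]) : controlled K N f -> Ccb setT f.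
Proof. by move=> cf; apply/CcbP; split => [|x /(_ I)//]; exists K, N. Qed.

Lemma fourier_sum (h : nat -> 'rV[R]_d -> R[i]) (a : nat -> R) k u :
  (forall n, Ccb setT (h n)) ->
  fourier (fun x => \sum_(i < k) (a i)%:C * h i x) u =
  \sum_(i < k) (a i)%:C * fourier (h i) u.
Proof.
move=> Ch; suff : Ccb setT (fun x => \sum_(i < k) (a i)%:C * h i x) /\
  fourier (fun x => \sum_(i < k) (a i)%:C * h i x) u =
  \sum_(i < k) (a i)%:C * fourier (h i) u by case.
elim: k => [|k [C1 e]].
  rewrite big_ord0; under eq_fun do rewrite big_ord0; split; first exact: Ccb0.
  rewrite (_ : (fun=> 0) = fun x => 0 * h 0%N x); first by rewrite fourierZ// mul0r.
  by apply/funext => x; rewrite mul0r.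
under eq_fun do rewrite big_ord_recr/=.
split; first by apply: CcbD => //; exact: CcbZ.
by rewrite fourierD ?fourierZ ?e ?big_ord_recr//; exact: CcbZ.
Qed.

Lemma fourier_energy_bound (h : nat -> 'rV[R]_d -> R[i]) K N :
  (forall n, controlled K N (h n)) ->
  exists C : R, forall n, (energy S setT (fourier (h n)) <= C%:E)%E.
Proof.
move=> ch; have [K' bK'] := @fourier_bounded R d K N.
have mh n : cmeasurable (h n) by have [] := ch n.
apply: (@energy_uniform_bound _ _ _ S (fun m => cube m%:R) _ _ _ _ _ K').
- by move=> m; exact: measurable_cube.
- exact: spectral_cube_lty.
- exact: cube_nondecreasing.
- exact: cube_cover.
- by move=> n; exact: cmeasurable_fourier.
- by move=> n u; exact: bK'.
- move=> s e.
  have a4 n : `|(-1) ^+ e n * 4^-1 ^+ n : R| <= 4^-1 ^+ n.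
    by rewrite normrM normr_sign mul1r ger0_norm// exprn_ge0// invr_ge0.
  have [cu [f [cf f1 f2]]] := series_controlled (fun n => ch (s n)) a4.
  exists (fourier f).
    apply/square_integrableP; split; first by apply: cmeasurable_fourier; case: cf.
    by apply: Sfinite; exact: controlled_Ccb cf.
  move=> u v; have [g1 g2] := fourier_cvg u cu f1 f2.
  have fE k : fourier (fun x => \sum_(i < k) ((-1) ^+ e i * 4^-1 ^+ i)%:C * h (s i) x) u = v k.
    apply: (@fourier_sum (fun i => h (s i)) (fun i => (-1) ^+ e i * 4^-1 ^+ i)) => n.
    exact: controlled_Ccb (ch _).
  by split; [move: g1|move: g2]; under eq_fun do rewrite fE.
Qed.

(** On smooth test functions this is, by unfolding, the vanishing of the distribution whose support
    is [Sp phi S]; it is also meaningful on the whole bounded measurable class. *)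
Definition annihilates (phi : 'rV[R]_d -> R[i]) f :=
  cintegral S setT (fun u => fourier f u * phi u) = 0.

Variable phi : 'rV[R]_d -> R[i].
Hypothesis phi2 : square_integrable S phi.

Lemma fourier_square_integrable f : Ccb setT f -> square_integrable S (fourier f).
Proof.
move=> Cf; apply/square_integrableP; split; last exact: Sfinite.
by apply: cmeasurable_fourier; have [] := Cf.
Qed.

Lemma cintegrable_fourierM f : Ccb setT f ->
  cintegrable S setT (fun u => fourier f u * phi u).
Proof.
move=> /fourier_square_integrable/square_integrableP[mf ?].
by have /square_integrableP[] := phi2 => *; exact: cintegrableM.
Qed.

Lemma annihilatesD f g : Ccb setT f -> Ccb setT g ->
  annihilates phi f -> annihilates phi g -> annihilates phi (fun x => f x + g x).
Proof.
move=> Cf Cg af ag; rewrite /annihilates.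
under eq_fun do rewrite fourierD// mulrDl.
by rewrite cintegralD ?af ?ag ?addr0//; exact: cintegrable_fourierM.
Qed.

Lemma annihilatesZ c f : Ccb setT f ->
  annihilates phi f -> annihilates phi (fun x => c * f x).
Proof.
move=> Cf af; rewrite /annihilates; under eq_fun do rewrite fourierZ// -mulrA.
by rewrite cintegralZ ?af ?mulr0//; exact: cintegrable_fourierM.
Qed.

Lemma annihilates_lim (h : nat -> 'rV[R]_d -> R[i]) (f : 'rV[R]_d -> R[i]) K N :
  (forall n, controlled K N (h n)) ->
  (forall x, Re (h n x) @[n --> \oo] --> Re (f x)) ->
  (forall x, Im (h n x) @[n --> \oo] --> Im (f x)) ->
  (forall n, annihilates phi (h n)) -> annihilates phi f.
Proof.
move=> ch h1 h2 ah; have [C hC] := fourier_energy_bound ch.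
have [K' bK'] := @fourier_bounded R d K N.
apply: (@weak_limit_orthogonal _ _ _ S (fun m => cube m%:R) _ _ _ _ (fun n => fourier (h n)) _ _ K' C) => //.
- by move=> m; exact: measurable_cube.
- exact: spectral_cube_lty.
- exact: cube_nondecreasing.
- exact: cube_cover.
- by move=> n; apply: cmeasurable_fourier; have [] := ch n.
- by move=> n u; exact: bK'.
- by move=> u; have [] := fourier_cvg u ch h1 h2.
- by move=> u; have [] := fourier_cvg u ch h1 h2.
Qed.

(** When S is infinite phi may fail to be integrable, so uniqueness of Fourier transforms is applied
    to f^ phi, a product of two square integrable functions; translating f multiplies f^ by a
    character. Only countably many f are used, so the exceptional null sets can be united. *)
Lemma annihilates_all_ae0 : (forall f, Ccb setT f -> annihilates phi f) ->
  {ae S, forall u, phi u = 0}.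
Proof.
move=> aall.
pose b n (x : 'rV[R]_d) : R[i] := (\1_(box `]0, n.+1%:R^-1[%classic) x : R)%:C.
have mb n : measurable (@box R d `]0, n.+1%:R^-1[%classic).
  by apply: measurable_box; exact: measurable_itv.
have Cb n : Ccb setT (b n).
  apply: (@controlled_Ccb 1 1); split.
  - exact: cmeasurable_indic.
  - exact: normc_indic.
  - move=> x nx; rewrite /b indicE memNset// => xI; apply: nx => i.
    have := xI i; rewrite /= !in_itv/= => /andP[p q]; apply/andP; split.
      by apply: le_trans (ltW p); rewrite oppr_le0.
    by apply: le_trans (ltW q) _; rewrite invf_le1// ler1n.
have ae n : {ae S, forall u, fourier (b n) u * phi u = 0}.
  have [mF _] := fourier_square_integrable (Cb n); have [mphi _] := phi2.
  apply: (@characters_separate _ _ _ _ character) => //.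
  - by move=> x y u; rewrite /character dotDr opprD cexpiD.
  - by move=> x u; exact: normc_cexpi.
  - move=> x; apply: cmeasurable_cexpi_comp; apply: measurable_funN.
    exact: measurable_dotl.
  - exact: characters_generate.
  - exact: cmeasurableM.
  - exact: cintegrable_fourierM.
  - move=> x; have := aall _ (Ccb_shift x (Cb n)); rewrite /annihilates => <-.
    by congr cintegral; apply/funext => u; rewrite fourier_shift// mulrA.
have : {ae S, forall u, forall n, fourier (b n) u * phi u = 0}.
  by apply/ae_foralln.
apply: filterS => u hu; have [n nz] := fourier_nonvanishing u.
by have /eqP := hu n; rewrite mulf_eq0 (negbTE nz) => /eqP.
Qed.

End spectral.

(** * Smooth bump functions *)

Section flat_function.
Context {R : realType}.

Lemma cvg_is_derive (V : normedModType R) (f : V -> R) (x v : V) (l : R) :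
  h^-1 *: (f (h *: v + x) - f x) @[h --> 0^'] --> l -> is_derive x v f l.
Proof.
move=> fl; have fl' : h^-1 *: ((f \o shift x) (h *: v) - f x) @[h --> 0^'] --> l by [].
by apply: DeriveDef; [apply/cvg_ex; exists l|exact/cvg_lim].
Qed.

Variable s : R.
Hypothesis s0 : 0 < s.

(** The powers t^-k make the family stable under differentiation up to linear combinations, so that
    smoothness becomes an induction. The scale s stays free because letting s tend to 0 turns the
    bumps into indicators. *)
Definition flat k (t : R) : R := if 0 < t then t^-1 ^+ k * expR (- s * t^-1) else 0.

(** The term y^(k+2)/(k+2)! of the exponential series at y = s/t absorbs t^-k and leaves t^2, so
    that difference quotients at 0 tend to 0. *)
Lemma flat_le k (t : R) : `|flat k t| <= (k.+2)`!%:R / s ^+ k.+2 * t ^+ 2.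
Proof.
have F0 : 0 < (k.+2)`!%:R :> R by rewrite ltr0n fact_gt0.
have c0 : 0 < (k.+2)`!%:R / s ^+ k.+2 by rewrite divr_gt0// exprn_gt0.
rewrite /flat; case: ifPn => t0; last first.
  by rewrite normr0; apply: mulr_ge0; [exact: ltW|exact: sqr_ge0].
have ti0 : 0 < t^-1 by rewrite invr_gt0.
rewrite ger0_norm; last by rewrite mulr_ge0 ?expR_ge0// exprn_ge0// ltW.
set y := s * t^-1; have y0 : 0 <= y by rewrite mulr_ge0// ltW.
rewrite mulNr expRN -/y ler_pdivrMr ?expR_gt0//.
have h : y ^+ k.+2 / (k.+2)`!%:R <= expR y.
  by apply: le_trans (expR_ge1Dxn k.+1 y0); rewrite lerDr.
apply: le_trans (ler_wpM2l _ h); last by apply: mulr_ge0; [exact: ltW|exact: sqr_ge0].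
have e : t^-1 ^+ k.+2 = t^-1 ^+ k * t^-1 ^+ 2 by rewrite -exprD addn2.
rewrite /y exprMn e !exprVn le_eqVlt; apply/orP; left; apply/eqP.
by field; rewrite !gt_eqF// exprn_gt0.
Qed.

Lemma is_derive_flat k (t : R) :
  is_derive t (1 : R) (flat k) (s * flat k.+2 t - k%:R * flat k.+1 t).
Proof.
have [t0|t0|<-] := ltgtP 0 t; last first.
- have z j : flat j 0 = 0 by rewrite /flat ltxx.
  apply: cvg_is_derive; rewrite !z !mulr0 subr0.
  have C0 : 0 < (k.+2)`!%:R / s ^+ k.+2.
    by rewrite divr_gt0 ?exprn_gt0// ltr0n fact_gt0.
  apply/cvgrPdist_le => e e0; near=> h.
  have hn0 : h != 0 by near: h; exact: nbhs_dnbhs_neq.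
  rewrite sub0r normrN subr0 addr0 [h%:A]mulr1 normrM.
  apply: le_trans (ler_wpM2l (normr_ge0 _) (flat_le k h)) _.
  rewrite mulrCA -[h ^+ 2]real_normK ?num_real// normfV expr2 mulKf ?normr_eq0//.
  rewrite -ler_pdivlMl//; near: h.
  by apply: dnbhs0_le; rewrite mulr_gt0// invr_gt0.
- apply: (near_eq_is_derive (f := cst 0)).
    near=> x; rewrite /flat ifF//; apply/negbTE; rewrite -leNgt ltW//; near: x.
    exact: lt_nbhsl.
  rewrite /flat !ifF ?mulr0 ?subr0; last 2 first.
  + by apply/negbTE; rewrite -leNgt ltW.
  + by apply/negbTE; rewrite -leNgt ltW.
  exact: is_derive_cst.
- pose f := ((fun x : R => x^-1) ^+ k * (expR \o (fun x : R => - s * x^-1)))%R.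
  apply: (near_eq_is_derive (f := f)).
    have : \forall x \near t, x \in `]0, +oo[%R.
      by apply: (@near_in_itvoy R 0); rewrite in_itv/= andbT.
    apply: filterS => x; rewrite /flat in_itv/= andbT => ->.
    by rewrite /f fctE exprfctE.
  have tn0 : t != 0 by rewrite gt_eqF.
  have dV : is_derive t (1 : R) (fun x : R => x^-1) (- t ^- 2).
    by have := @is_deriveV _ id t 1 1 tn0 (is_derive_id _ _); rewrite [_ *: _]mulr1.
  have dE : is_derive t (1 : R) (expR \o (fun x : R => - s * x^-1)) (expR (- s * t^-1) * (- s * (- t ^- 2))).
    exact: is_derive1_comp.
  have dX := is_deriveX k dV.
  apply: (is_derive_eq (is_deriveM dX dE)).
  rewrite /flat t0 /= !fctE /GRing.scale /=.
  rewrite -!exprVn; move: (expR _) => E; case: (k) => [|j] /=.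
    by rewrite !expr0 !expr1; ring.
  by rewrite !exprS; ring.
Unshelve. all: by end_near.
Qed.

End flat_function.

Section smooth_functions.
Context {R : realType} {d : nat}.
Implicit Types (F G : 'rV[R]_d -> R).

(** C^n by recursion on n, with the derivatives as existential witnesses, so that sums and products
    go through by induction. The iterated operators in [smooth] are recovered only at the end, each
    partial derivative consuming one order. *)
Fixpoint smooth_upto n F : Prop := continuous F /\
  if n is m.+1 then forall i : 'I_d, exists F',
    (forall x, is_derive x (delta_mx ord0 i) F (F' x)) /\ smooth_upto m F'
  else True.

Lemma smooth_upto_continuous n F : smooth_upto n F -> continuous F.
Proof. by case: n => [|n] []. Qed.

Lemma smooth_upto_lt n F : smooth_upto n.+1 F -> smooth_upto n F.
Proof.
elim: n F => [|n ih] F [cF dF]; first by split.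
by split => // i; have [F' [dF' sF']] := dF i; exists F'; split => //; exact: ih.
Qed.

Lemma smooth_upto_cst n (c : R) : smooth_upto n (fun=> c).
Proof.
elim: n c => [|n ih] c; (split; first exact: cst_continuous) => //.
by move=> i; exists (fun=> 0); split => // x; exact: is_derive_cst.
Qed.

Lemma smooth_uptoD n F G : smooth_upto n F -> smooth_upto n G ->
  smooth_upto n (fun x => F x + G x).
Proof.
elim: n F G => [|n ih] F G [cF dF] [cG dG];
  (split; first by move=> x; exact: (continuousD (cF x) (cG x))) => //.
move=> i; have [F' [dF' sF']] := dF i; have [G' [dG' sG']] := dG i.
by exists (fun x => F' x + G' x); split; [move=> x; exact: is_deriveD|exact: ih].
Qed.

Lemma smooth_uptoM n F G : smooth_upto n F -> smooth_upto n G ->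
  smooth_upto n (fun x => F x * G x).
Proof.
elim: n F G => [|n ih] F G sF sG.
  case: sF => cF _; case: sG => cG _.
  by split => // x; exact: (continuousM (cF x) (cG x)).
have cF : continuous F by exact: smooth_upto_continuous sF.
have cG : continuous G by exact: smooth_upto_continuous sG.
split; first by move=> x; exact: (continuousM (cF x) (cG x)).
move=> i; have [F' [dF' sF']] := sF.2 i; have [G' [dG' sG']] := sG.2 i.
exists (fun x => F x * G' x + G x * F' x); split.
  by move=> x; exact: is_deriveM.
by apply: smooth_uptoD; apply: ih => //; exact: smooth_upto_lt.
Qed.

Lemma smooth_uptoZ n (c : R) F : smooth_upto n F -> smooth_upto n (fun x => c * F x).
Proof. by apply: smooth_uptoM; exact: smooth_upto_cst. Qed.

Lemma smooth_upto_prod n (I : Type) (r : seq I) (F : I -> 'rV[R]_d -> R) :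
  (forall i, smooth_upto n (F i)) -> smooth_upto n (fun x => \prod_(i <- r) F i x).
Proof.
move=> sF; elim: r => [|i r ih].
  by under eq_fun do rewrite big_nil; exact: smooth_upto_cst.
by under eq_fun do rewrite big_cons; exact: smooth_uptoM.
Qed.

Lemma smooth_upto_smooth F : (forall n, smooth_upto n F) -> smooth F.
Proof.
move=> sF s.
have h n : smooth_upto n (partial s F).
  elim: s n => [|i s ih] n; first exact: sF.
  have [_ /(_ i)[F' [dF' sF']]] := ih n.+1.
  rewrite (_ : partial (i :: s) F = F')//; apply/funext => x.
  by rewrite /= -/(partial s F); have := dF' x => -[_ ->].
split; first exact: smooth_upto_continuous (h 0%N).
by move=> i x; have [_ /(_ i)[F' [dF' _]]] := h 1%N; have [] := dF' x.
Qed.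

Lemma is_derive_coord (g : R -> R) (x : 'rV[R]_d) (i j : 'I_d) (l : R) :
  is_derive (x ord0 i) (1 : R) g l ->
  is_derive x (delta_mx ord0 j) (fun y : 'rV[R]_d => g (y ord0 i)) ((i == j)%:R * l).
Proof.
move=> [gd gl]; apply: cvg_is_derive.
have [<-|ij] := eqVneq i j.
  rewrite mul1r -gl.
  rewrite (_ : (fun h => _) = (fun h : R => h^-1 *: ((g \o shift (x ord0 i)) (h *: (1 : R)) - g (x ord0 i)))).
    exact: gd.
  by apply/funext => h; rewrite !mxE !eqxx.
rewrite mul0r (_ : (fun h => _) = (fun h : R => 0)); first exact: cvg_cst.
by apply/funext => h; rewrite !mxE (negbTE ij) andbF mulr0 add0r subrr scaler0.
Qed.

Variable s : R.
Hypothesis s0 : 0 < s.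

(** All k are treated in one induction on n, since differentiation raises k. The sign sg is 1 for
    the lower and -1 for the upper faces of a box. *)
Lemma smooth_upto_flat n k (sg c : R) (i : 'I_d) :
  smooth_upto n (fun x : 'rV[R]_d => flat s k (sg * x ord0 i + c)).
Proof.
have daff (t : R) : is_derive t (1 : R) (fun t : R => sg * t + c) sg.
  have h := is_deriveD (is_deriveZ sg (is_derive_id t (1 : R))) (is_derive_cst c t (1 : R)).
  by apply: (is_derive_eq h); rewrite addr0 [_ *: _]mulr1.
have dflat m (t : R) : is_derive t (1 : R) (flat s m \o (fun t : R => sg * t + c))
    ((s * flat s m.+2 (sg * t + c) - m%:R * flat s m.+1 (sg * t + c)) * sg).
  by apply: is_derive1_comp; exact: is_derive_flat.
have cflat m : continuous (fun x : 'rV[R]_d => flat s m (sg * x ord0 i + c)).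
  move=> x; apply: (@continuous_comp _ _ _ (fun x : 'rV[R]_d => x ord0 i) (flat s m \o (fun t => sg * t + c))).
    exact: coord_continuous.
  by apply/differentiable_continuous/derivable1_diffP; have [] := dflat m (x ord0 i).
elim: n k => [|n ih] k; split => // j.
exists (fun x => (i == j)%:R * sg * s * flat s k.+2 (sg * x ord0 i + c) +
                 - ((i == j)%:R * sg * k%:R) * flat s k.+1 (sg * x ord0 i + c)).
split; last by apply: smooth_uptoD; apply: smooth_uptoZ.
move=> x; have := is_derive_coord j (dflat k (x ord0 i)).
by move/is_derive_eq; apply; ring.
Qed.

Definition obox (a b : 'rV[R]_d) : set 'rV[R]_d :=
  [set x | forall i, a ord0 i < x ord0 i < b ord0 i].

Definition cbox (a b : 'rV[R]_d) : set 'rV[R]_d :=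
  [set x | forall i, a ord0 i <= x ord0 i <= b ord0 i].

(** For s > 0 this is positive exactly on the open box and at most 1, and it increases to the
    indicator of the box as s decreases to 0. The unreduced forms [1 * x] and [-1 * x] are instances
    of the affine form in [smooth_upto_flat]. *)
Definition box_bump (a b x : 'rV[R]_d) : R :=
  \prod_(i < d) (flat s 0 (1 * x ord0 i + - a ord0 i) * flat s 0 (-1 * x ord0 i + b ord0 i)).

Lemma smooth_bump a b : smooth (box_bump a b).
Proof.
apply: smooth_upto_smooth => n; apply: smooth_upto_prod => i.
by apply: smooth_uptoM; exact: smooth_upto_flat.
Qed.

Lemma flat0_ge0_le1 t : 0 <= flat s 0 t <= 1.
Proof.
rewrite /flat expr0 mul1r; case: ifPn => [t0|_]; last by rewrite lexx ler01.
by rewrite expR_ge0 -expR0 ler_expR mulNr oppr_le0 divr_ge0// ltW.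
Qed.

Lemma bump_ge0_le1 a b x : 0 <= box_bump a b x <= 1.
Proof.
have h t := flat0_ge0_le1 t; rewrite /box_bump; apply/andP; split.
  by apply: prodr_ge0 => i _; rewrite mulr_ge0//;
    [have /andP[] := h (1 * x ord0 i + - a ord0 i)|have /andP[] := h (-1 * x ord0 i + b ord0 i)].
apply: prodr_ile1 => i _; rewrite mulr_ge0 ?mulr_ile1//;
  by [have /andP[] := h (1 * x ord0 i + - a ord0 i)|have /andP[] := h (-1 * x ord0 i + b ord0 i)].
Qed.

Lemma bump_out a b x : ~ obox a b x -> box_bump a b x = 0.
Proof.
move=> nx; have [i hi] : exists i, ~~ (a ord0 i < x ord0 i < b ord0 i).
  by apply: contrapT => /forallNP h; apply: nx => i; have /negP := h i; rewrite negbK.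
rewrite /box_bump (bigD1 i)//=; move: hi; rewrite negb_and => /orP[] hi.
  have -> : flat s 0 (1 * x ord0 i + - a ord0 i) = 0; last by rewrite !mul0r.
  by rewrite mul1r /flat subr_gt0 (negbTE hi).
have -> : flat s 0 (-1 * x ord0 i + b ord0 i) = 0; last by rewrite mulr0 mul0r.
by rewrite mulN1r addrC /flat subr_gt0 (negbTE hi).
Qed.

Lemma closed_cbox a b : closed (cbox a b).
Proof.
rewrite (_ : cbox a b = \bigcap_i [set x : 'rV[R]_d | a ord0 i <= x ord0 i <= b ord0 i]).
  apply: closed_bigI => i _.
  rewrite (_ : [set _ | _] = (fun x : 'rV[R]_d => x ord0 i) @^-1` `[a ord0 i, b ord0 i]%classic).
    apply: closed_comp; last exact: itv_closed.
    by move=> x _; exact: coord_continuous.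
  by apply/seteqP; split => x /=; rewrite in_itv.
by apply/seteqP; split => [x xI i _|x xI i]; [exact: xI|exact: (xI i I)].
Qed.

Lemma compact_cbox a b : compact (cbox a b).
Proof.
rewrite (_ : cbox a b = [set x : 'rV[R]_d | forall i, `[a ord0 i, b ord0 i]%classic (x ord0 i)]).
  by apply: (rV_compact (A := fun i => `[a ord0 i, b ord0 i]%classic)) => i; exact: segment_compact.
by apply/seteqP; split => x xI i; have := xI i; rewrite /= in_itv.
Qed.

Lemma test_function_bump a b (U : set 'rV[R]_d) : cbox a b `<=` U ->
  test_function U (fun x => (box_bump a b x)%:C).
Proof.
move=> bU.
have sub : closure [set x | (box_bump a b x)%:C != 0] `<=` cbox a b.
  have /closure_id -> := @closed_cbox a b; apply: closureS.
  move=> x /= nz i; have xo : obox a b x.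
    by apply: contrapT => /bump_out e; move: nz; rewrite e eqxx.
  by have /andP[p q] := xo i; rewrite !ltW.
split.
- exact: smooth_bump.
- by apply: smooth_upto_smooth => n; exact: smooth_upto_cst.
- exact: (subclosed_compact (@closed_closure _ _) (@compact_cbox a b) sub).
- exact: subset_trans bU.
Qed.

Lemma measurable_bump a b : measurable_fun setT (box_bump a b).
Proof.
apply: measurable_prod => i _; apply: measurable_funM;
  (apply: (measurableT_comp (continuous_measurable_fun _));
   [move=> t; apply/differentiable_continuous/derivable1_diffP; by have [] := is_derive_flat s0 0 t|];
   apply: measurable_funD; last exact: measurable_cst;
   apply: measurable_funM; first exact: measurable_cst;
   exact: measurable_coordinate).
Qed.

End smooth_functions.

Lemma bump_cvg {R : realType} {d : nat} (a b x : 'rV[R]_d) :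
  box_bump n.+1%:R^-1 a b x @[n --> \oo] --> (\1_(obox a b) x : R).
Proof.
have [xo|nxo] := pselect (obox a b x); last first.
  rewrite indicE memNset//; apply: cvg_near_cst; apply: nearW => n.
  by rewrite bump_out// invr_gt0.
rewrite indicE mem_set//.
have fl (t : R) : 0 < t -> flat n.+1%:R^-1 0 t @[n --> \oo] --> (1 : R).
  move=> t0; have h : - n.+1%:R^-1 * t^-1 @[n --> \oo] --> (0 : R).
    rewrite -[X in _ --> X](mul0r t^-1); apply: cvgM; last exact: cvg_cst.
    by rewrite -[X in _ --> X]oppr0; apply: cvgN; exact: cvg_harmonic.
  have e : expR (- n.+1%:R^-1 * t^-1) @[n --> \oo] --> expR (0 : R).
    by apply: continuous_cvg => //; exact: continuous_expR.
  rewrite expR0 in e; apply: cvg_trans e; apply: near_eq_cvg; apply: nearW => n.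
  by rewrite /flat t0 expr0 mul1r.
have xi i : flat n.+1%:R^-1 0 (1 * x ord0 i + - a ord0 i) *
            flat n.+1%:R^-1 0 (-1 * x ord0 i + b ord0 i) @[n --> \oo] --> (1 : R).
  have /andP[p q] := xo i; rewrite -[X in _ --> X](mulr1 1); apply: cvgM; apply: fl.
    by rewrite mul1r subr_gt0.
  by rewrite mulN1r addrC subr_gt0.
rewrite /box_bump; elim: (index_enum _) => [|i r ih].
  by under eq_fun do rewrite big_nil; exact: cvg_cst.
have h := cvgM (xi i) ih; rewrite mulr1 in h.
by under eq_fun do rewrite big_cons; exact: h.
Qed.

(** * Localization outside the spectrum *)

Section euclidean_topology.
Context {R : realType} {d : nat}.
Implicit Types (x y a b : 'rV[R]_d).

Lemma measurable_obox a b : measurable (obox a b).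
Proof.
rewrite (_ : obox a b = \bigcap_(i in setT) [set x : 'rV[R]_d | `]a ord0 i, b ord0 i[%classic (x ord0 i)]).
  apply: fin_bigcap_measurable => // i _; apply: measurable_preimage_coord.
  exact: measurable_itv.
apply/seteqP; split => [x xI i _|x xI i]; first by rewrite /= in_itv; exact: xI.
by have := xI i I; rewrite /= in_itv.
Qed.

(** Corners of the box with rational centre p.1 and half-side 1/(p.2+1). The index type is
    countable, so these boxes give a countable base enumerated by [unpickle]. *)
Definition rat_lower (p : 'rV[rat]_d * nat) : 'rV[R]_d :=
  \row_i (ratr (p.1 ord0 i) - p.2.+1%:R^-1).
Definition rat_upper (p : 'rV[rat]_d * nat) : 'rV[R]_d :=
  \row_i (ratr (p.1 ord0 i) + p.2.+1%:R^-1).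

Lemma open_rat_box (U : set 'rV[R]_d) x : open U -> U x ->
  exists p, obox (rat_lower p) (rat_upper p) x /\
            cbox (rat_lower p) (rat_upper p) `<=` U.
Proof.
rewrite openE => oU /oU /nbhs_ballP[e /= e0 xU].
(* Since 2r < e, the closed box of half-side r around a rational point within r of x stays in the
   ball of radius e around x. *)
pose k := Num.truncn (2 / e); pose r : R := k.+1%:R^-1.
have r0 : 0 < r by rewrite invr_gt0.
have re : r + r < e.
  have h : 2 / e < k.+1%:R by exact: truncnS_gt.
  have : 2 * r < e by rewrite ltr_pdivrMr// mulrC -ltr_pdivrMr.
  by rewrite mulr_natl mulr2n.
have /choice[c cP] i : exists q : rat, x ord0 i - r < ratr q < x ord0 i + r.
  have lt2 : x ord0 i - r < x ord0 i + r by rewrite ltrD2l gt0_cp.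
  by have [q] := rat_in_itvoo lt2; rewrite in_itv/=; exists q.
exists (\row_i c i, k); split=> [i|y yI].
  by rewrite !mxE -/r; have /andP[p q] := cP i; apply/andP; split; lra.
apply: xU; split => // i j; rewrite ord1.
have := yI j; rewrite !mxE -/r => /andP[p q]; have /andP[p' q'] := cP j.
by rewrite /ball /= ltr_distlC; apply/andP; split; lra.
Qed.

(** The sigma-algebra comes from the coordinates and the topology from the norm; countably many
    rational boxes connect the two. This gives measurability of the complement of the spectrum and
    of smooth functions. *)
Lemma open_measurable_rV (U : set 'rV[R]_d) : open U -> measurable U.
Proof.
move=> oU; pose Q (n : nat) : set 'rV[R]_d :=
  if (unpickle n : option ('rV[rat]_d * nat)) is Some p then
    if `[< cbox (rat_lower p) (rat_upper p) `<=` U >] then obox (rat_lower p) (rat_upper p) else set0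
  else set0.
rewrite (_ : U = \bigcup_n Q n).
  apply: bigcupT_measurable => n; rewrite /Q; case: (unpickle n) => // p.
  by case: asboolP => _ //; exact: measurable_obox.
apply/seteqP; split => [x Ux|x [n _]].
  have [p [xp pU]] := open_rat_box oU Ux.
  by exists (pickle p) => //; rewrite /Q pickleK; case: asboolP.
rewrite /Q; case: (unpickle n) => // p; case: asboolP => // pU xp; apply: pU => i.
by have /andP[? ?] := xp i; rewrite !ltW.
Qed.

Lemma continuous_measurable_rV (f : 'rV[R]_d -> R) : continuous f ->
  measurable_fun setT f.
Proof.
move=> cf; apply: (measurability _ (RGenOInfty.measurableE R)) => _ [_ [a ->] <-].
rewrite setTI; apply: open_measurable_rV; apply: open_comp => [x _|]; first exact: cf.
exact: interval_open.
Qed.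

Lemma test_function_Ccb (U : set 'rV[R]_d) psi : test_function U psi -> Ccb U psi.
Proof.
move=> [sR sI cK KU].
have mpsi : cmeasurable psi.
  by split; apply: continuous_measurable_rV; [have [] := sR [::]|have [] := sI [::]].
have supp x : psi x != 0 -> closure [set x | psi x != 0] x by exact: (@subset_closure _ [set x | psi x != 0]).
split => //.
- have cN : compact ((fun x => csq (psi x)) @` closure [set x | psi x != 0]).
    apply: continuous_compact => //; apply: continuous_subspaceT => x.
    have c1 : continuous (fun x => Re (psi x)) by have [] := sR [::].
    have c2 : continuous (fun x => Im (psi x)) by have [] := sI [::].
    rewrite /csq (_ : (fun _ => _) = (fun x => Re (psi x) * Re (psi x) + Im (psi x) * Im (psi x))).
      exact: (continuousD (continuousM (c1 x) (c1 x)) (continuousM (c2 x) (c2 x))).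
    by apply/funext => y; rewrite !expr2.
  have [M [_ bM]] := compact_bounded cN; exists (Num.sqrt (`|M| + 1)) => x.
  rewrite normc_le_csq ?sqrtr_ge0// sqr_sqrtr ?addr_ge0//.
  have [->|nz] := eqVneq (psi x) 0.
    by rewrite /csq /= expr0n addr0 addr_ge0.
  apply: le_trans (ler_norm _) _; apply: (bM (`|M| + 1)).
    by rewrite (le_lt_trans (ler_norm M))// ltrDl.
  by exists x => //; exact: supp.
- have [M [Mr bM]] := compact_bounded cK; exists M; split => // N MN x /= nz.
  by apply: bM => //; exact: supp.
- move=> x nU; apply/eqP; apply: contrapT => /negP nz; apply: nU; apply: KU.
  exact: supp.
Qed.

End euclidean_topology.

Section localization.
Context {R : realType} {d : nat}.
Variable S : {measure set 'rV[R]_d -> \bar R}.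
Hypothesis Stempered : (\int[S]_u ((1 + enorm u) ^- d.+1)%:E < +oo)%E.
Hypothesis Sfinite : forall f, Ccb setT f -> (energy S setT (fourier f) < +oo)%E.
Variable phi : 'rV[R]_d -> R[i].
Hypothesis phi2 : square_integrable S phi.

Let indic_box (a b : 'rV[R]_d) (x : 'rV[R]_d) : R[i] := (\1_(obox a b) x : R)%:C.

Let controlled_box (a b : 'rV[R]_d) (f : 'rV[R]_d -> R[i]) K : cmeasurable f ->
  (forall x, normc (f x) <= K) -> (forall x, ~ obox a b x -> f x = 0) ->
  controlled K (`|a| + `|b|) f.
Proof.
move=> mf fK fab; split => // x nx; apply: fab => xab; apply: nx => i.
have := coord_le_norm a i; have := coord_le_norm b i.
have /andP[] := xab i; rewrite /= in_itv/= -ler_norml !ler_norml.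
move=> p q /andP[r1 r2] /andP[r3 r4].
by have := normr_ge0 a; have := normr_ge0 b => ? ?; apply/andP; split; lra.
Qed.

Let Ccb_indic_box a b : Ccb setT (indic_box a b).
Proof.
apply: controlled_Ccb; apply: (@controlled_box a b _ 1).
- by apply: cmeasurable_indic; exact: measurable_obox.
- exact: normc_indic.
- by move=> x nx; rewrite /indic_box indicE memNset.
Qed.

Lemma annihilates_obox (a b : 'rV[R]_d) (U : set 'rV[R]_d) : cbox a b `<=` U ->
  (forall psi, test_function U psi -> annihilates S phi psi) ->
  annihilates S phi (indic_box a b).
Proof.
move=> bU aU.
have s0 n : 0 < n.+1%:R^-1 :> R by rewrite invr_gt0.
have L := annihilates_lim Stempered Sfinite phi2
  (h := fun n x => (box_bump n.+1%:R^-1 a b x)%:C) (f := indic_box a b) (K := 1) (N := `|a| + `|b|).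
apply: L.
- move=> n; apply: (@controlled_box a b).
  + by apply: cmeasurableC; exact: measurable_bump.
  + by move=> x; have /andP[p q] := bump_ge0_le1 (s0 n) a b x; rewrite normcC ger0_norm.
  + by move=> x nx; rewrite bump_out.
- by move=> x; exact: bump_cvg.
- by move=> x; exact: cvg_cst.
- by move=> n; apply: aU; exact: test_function_bump.
Qed.

(** The factor [indic_box] keeps all supports in one bounded set, so that bounded limits are
    available, and it makes the constant 1 an admissible function. Open boxes form the pi-system:
    intersected with the given box they are again open boxes, with closed boxes inside U. *)
Lemma annihilates_in_obox (a b : 'rV[R]_d) (U : set 'rV[R]_d) : cbox a b `<=` U ->
  (forall psi, test_function U psi -> annihilates S phi psi) ->
  forall f, bounded_measurable f -> annihilates S phi (fun x => f x * indic_box a b x).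
Proof.
move=> bU aU.
pose G := [set B : set 'rV[R]_d | exists p q, B = obox p q].
pose mx (p q : 'rV[R]_d) : 'rV[R]_d := \row_i Num.max (p ord0 i) (q ord0 i).
pose mn (p q : 'rV[R]_d) : 'rV[R]_d := \row_i Num.min (p ord0 i) (q ord0 i).
have oboxI p q p' q' : obox p q `&` obox p' q' = obox (mx p p') (mn q q').
  apply/seteqP; split => [x [x1 x2] i|x xI].
    have /andP[a1 b1] := x1 i; have /andP[a2 b2] := x2 i.
    by rewrite !mxE gt_max lt_min a1 a2 b1 b2.
  by split => i; have := xI i; rewrite !mxE gt_max lt_min => /andP[/andP[? ?] /andP[? ?]]; apply/andP.
have GI : setI_closed G.
  by move=> _ _ [p [q ->]] [p' [q' ->]]; exists (mx p p'), (mn q q').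
have mG : @measurable _ 'rV[R]_d = <<s G>>.
  apply/seteqP; split; last first.
    apply: smallest_sub; first exact: sigma_algebra_measurable.
    by move=> _ [p [q ->]]; exact: measurable_obox.
  apply: measurable_rV_sub => i t.
  (* The half-space x_i > t is the union of the boxes with lower corner t in coordinate i and -n
     elsewhere, and upper corner n. *)
  pose lo n : 'rV[R]_d := \row_j (if j == i then t else - n%:R).
  pose hi n : 'rV[R]_d := \row_j n%:R.
  have mU : <<s G>> (\bigcup_n obox (lo n) (hi n)).
    apply: sigma_algebra_bigcup => n.
    by apply: sub_gen_smallest; exists (lo n), (hi n).
  apply: (@eq_ind (set 'rV[R]_d) _ (fun B => <<s G>> B) mU).
  apply/seteqP; split => [x [n _ /(_ i)]|x /= tx]; first by rewrite !mxE eqxx => /andP[].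
  exists (Num.truncn `|x|).+1 => // j; rewrite !mxE.
  have xj : `|x ord0 j| < (Num.truncn `|x|).+1%:R.
    exact: le_lt_trans (coord_le_norm x j) (truncnS_gt _).
  move: xj; rewrite ltr_norml => /andP[p q]; rewrite q andbT.
  by have [->|//] := eqVneq j i.
have CQ f : bounded_measurable f -> Ccb setT (fun x => f x * indic_box a b x).
  by move=> bf; exact: CcbM.
apply: (monotone_class GI mG (H := fun f => annihilates S phi (fun x => f x * indic_box a b x))).
- rewrite /annihilates; under eq_fun do under eq_fun do rewrite mul1r.
  exact: (annihilates_obox bU aU).
- move=> _ [p [q ->]].
  have -> : (fun x => (\1_(obox p q) x : R)%:C * indic_box a b x) = indic_box (mx p a) (mn q b).
    by apply/funext => x; rewrite /indic_box -oboxI indicI rmorphM.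
  apply: (annihilates_obox (U := U)) => // x xI; apply: bU => i; have := xI i.
  by rewrite !mxE ge_max le_min => /andP[/andP[_ ->] /andP[_ ->]].
- move=> f g bf bg af ag.
  rewrite (_ : (fun _ => _) = (fun x => f x * indic_box a b x + g x * indic_box a b x)).
    by apply: annihilatesD => //; exact: CQ.
  by apply/funext => x; rewrite mulrDl.
- move=> c f bf af.
  rewrite (_ : (fun _ => _) = (fun x => c * (f x * indic_box a b x))).
    by apply: annihilatesZ => //; exact: CQ.
  by apply/funext => x; rewrite mulrA.
- move=> f g K mf fK f1 f2 af.
  apply: (annihilates_lim Stempered Sfinite phi2
    (h := fun n x => f n x * indic_box a b x) (K := K * 1) (N := `|a| + `|b|)) => //.
  + move=> n; apply: (@controlled_box a b).
    * by apply: cmeasurableM => //; have [] := Ccb_indic_box a b.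
    * by move=> x; apply: normcM_le => //; exact: normc_indic.
    * by move=> x nx; rewrite /indic_box indicE memNset// mulr0.
  + move=> x; under eq_fun do rewrite cReM; rewrite cReM.
    by apply: cvgB; apply: cvgM; try exact: cvg_cst; [exact: f1|exact: f2].
  + move=> x; under eq_fun do rewrite cImM; rewrite cImM.
    by apply: cvgD; apply: cvgM; try exact: cvg_cst; [exact: f1|exact: f2].
Qed.

(** W is covered by countably many rational boxes on each of which the functional vanishes. Since
    indicators are admissible multipliers by now, f is cut along these boxes in place of a smooth
    partition of unity, and the pieces are reassembled by a bounded limit. *)
Lemma annihilates_off_support (W : set 'rV[R]_d) :
  (forall x, W x -> exists U, [/\ open U, U x &
     forall psi, test_function U psi -> annihilates S phi psi]) ->
  forall f, Ccb setT f -> (forall x, ~ W x -> f x = 0) -> annihilates S phi f.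
Proof.
move=> loc f Cf fW.
pose good (p : 'rV[rat]_d * nat) := exists2 U : set 'rV[R]_d,
  cbox (rat_lower p) (rat_upper p) `<=` U &
  forall psi, test_function U psi -> annihilates S phi psi.
pose Q (n : nat) : set 'rV[R]_d :=
  if (unpickle n : option ('rV[rat]_d * nat)) is Some p then
    if `[< good p >] then obox (rat_lower p) (rat_upper p) else set0
  else set0.
have mQ n : measurable (Q n).
  rewrite /Q; case: (unpickle n) => // p.
  by case: asboolP => _ //; exact: measurable_obox.
have aQ n g : bounded_measurable g ->
    annihilates S phi (fun x => g x * (\1_(Q n) x : R)%:C).
  move=> bg; have z : annihilates S phi (fun x => g x * (\1_(@set0 'rV[R]_d) x : R)%:C).
    rewrite (_ : (fun _ => _) = (fun x => 0 * f x)); last first.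
      by apply/funext => x; rewrite indic0 mulr0 mul0r.
    rewrite /annihilates; under eq_fun do rewrite fourierZ// mul0r mul0r.
    by rewrite /cintegral /= Rintegral_cst// mul0r.
  rewrite /Q; case: (unpickle n) => [p|]; last exact: z.
  case: asboolP => [[U pU aU]|_]; last exact: z.
  exact: (annihilates_in_obox pU aU).
have cover x : W x -> exists n, Q n x.
  move=> /loc[U [oU Ux aU]]; have [p [xp pU]] := open_rat_box oU Ux.
  exists (pickle p); rewrite /Q pickleK; case: asboolP => // ng.
  by exfalso; apply: ng; exists U.
pose V n : set 'rV[R]_d := \big[setU/set0]_(i < n) Q i.
have mV n : measurable (V n) by exact: bigsetU_measurable.
have VE n x : V n x <-> exists2 i, (i < n)%N & Q i x.
  rewrite /V -(bigcup_mkord n Q); split => [[i /= ? ?]|[i ? ?]]; by exists i.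
have /CcbP[[K [N [mf fK fN]]] _] := Cf.
have bf : bounded_measurable f by split => //; exists K.
pose h n x := (\1_(V n) x : R)%:C * f x.
have Ch n : Ccb setT (h n) by apply: CcbM => //; exact: bounded_measurable_indic.
apply: (annihilates_lim Stempered Sfinite phi2 (h := h) (K := 1 * K) (N := N)).
- move=> n; split.
  + by have [] := Ch n.
  + by move=> x; apply: normcM_le => //; exact: normc_indic.
  + by move=> x nx; rewrite /h fN// mulr0.
- move=> x; apply: cvg_near_cst; have [Wx|nW] := pselect (W x); last first.
    by apply: nearW => n; rewrite /h fW// mulr0.
  have [k Qk] := cover _ Wx; exists k.+1 => // n /= kn.
  by rewrite /h indicE mem_set ?mul1r//; apply/VE; exists k.
- move=> x; apply: cvg_near_cst; have [Wx|nW] := pselect (W x); last first.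
    by apply: nearW => n; rewrite /h fW// mulr0.
  have [k Qk] := cover _ Wx; exists k.+1 => // n /= kn.
  by rewrite /h indicE mem_set ?mul1r//; apply/VE; exists k.
- elim=> [|n ih].
    rewrite (_ : h 0%N = (fun x => (fun=> 0) x * (\1_(Q 0%N) x : R)%:C)).
      by apply: aQ; exact: bounded_measurable_cst.
    by apply/funext => x; rewrite /h /V big_ord0 indic0 !mul0r.
  (* Passing from V n to V n.+1 adds the part of f on Q n outside V n, a bounded function cut to a
     single box. *)
  rewrite (_ : h n.+1 = (fun x => h n x + ((\1_(~` V n) x : R)%:C * f x) * (\1_(Q n) x : R)%:C)).
    have bg : bounded_measurable (fun x => (\1_(~` V n) x : R)%:C * f x).
      apply: bounded_measurableM => //; apply: bounded_measurable_indic.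
      exact: measurableC.
    have Cg : Ccb setT (fun x => ((\1_(~` V n) x : R)%:C * f x) * (\1_(Q n) x : R)%:C).
      rewrite (_ : (fun _ => _) = (fun x => (\1_(Q n) x : R)%:C * ((\1_(~` V n) x : R)%:C * f x))).
        by apply: CcbM; [exact: bounded_measurable_indic|apply: CcbM => //;
          apply: bounded_measurable_indic; exact: measurableC].
      by apply/funext => x; rewrite mulrC.
    exact: (annihilatesD Sfinite phi2 (Ch n) Cg ih (aQ n _ bg)).
  apply/funext => x; rewrite /h {1}/V big_ord_recr/= -/(V n) !indicE in_setU in_setC.
  by case: (x \in V n); case: (x \in Q n); rewrite /= ?rmorph1 ?rmorph0 ?mul1r ?mul0r ?mulr1 ?mulr0 ?add0r ?addr0.
Qed.

End localization.

(** * Random measures on R^d *)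

Section almost_everywhere.
Context {R : realType} {d} {T : measurableType d}.
Variable mu : {measure set T -> \bar R}.
Implicit Types (f g h phi : T -> R[i]).

Lemma cintegral_ae_eq f g : cmeasurable f -> cmeasurable g ->
  {ae mu, forall x, f x = g x} -> cintegral mu setT f = cintegral mu setT g.
Proof.
move=> [f1 f2] [g1 g2] fg; rewrite /cintegral /Rintegral.
congr (fine _ +i* fine _); (apply: ae_eq_integral => //; first exact/measurable_EFinP).
- exact/measurable_EFinP.
- by apply: filterS fg => x /= -> _.
- exact/measurable_EFinP.
- by apply: filterS fg => x /= -> _.
Qed.

Lemma energy_ae_eq f g : cmeasurable f -> cmeasurable g ->
  {ae mu, forall x, f x = g x} -> energy mu setT f = energy mu setT g.
Proof.
move=> mf mg fg; apply: ae_eq_integral => //; try exact: measurable_csqE.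
by apply: filterS fg => x /= -> _.
Qed.

Lemma cintegral_limit0 (h : nat -> T -> R[i]) f phi :
  square_integrable mu phi -> square_integrable mu f ->
  (forall n, square_integrable mu (h n)) ->
  energy mu setT (fun x => h n x - f x)%R @[n --> \oo] --> 0%E ->
  (forall n, cintegral mu setT (fun x => h n x * phi x) = 0) ->
  cintegral mu setT (fun x => f x * phi x) = 0.
Proof.
move=> phi2 f2 h2 hf h0.
have /square_integrableP[mphi phioo] := phi2; have /square_integrableP[mf foo] := f2.
have key n : cintegral mu setT (fun x => (h n x - f x) * phi x) =
    - cintegral mu setT (fun x => f x * phi x).
  have /square_integrableP[mh hoo] := h2 n.
  under eq_fun do rewrite mulrBl.
  by rewrite cintegralB// ?h0 ?sub0r//; exact: cintegrableM.
set z := cintegral _ _ _ in key *.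
pose b := fine (energy mu setT phi).
have phib : (energy mu setT phi <= b%:E)%E by rewrite /b fineK// ge0_fin_numE ?energy_ge0.
have b0 : 0 <= b by rewrite /b fine_ge0 ?energy_ge0.
have small e : 0 < e -> `|Re z| <= e /\ `|Im z| <= e.
  (* This t makes the term b/t less than e/2, with b + 1 in place of b to allow b = 0; then a is
     chosen so that t a = e/2. *)
  move=> e0; pose t : R := 2 * (b + 1) / e.
  have t0 : 0 < t by rewrite divr_gt0// mulr_gt0// ltr_wpDl.
  pose a : R := e / 2 / t.
  have a0 : 0 < a by apply: divr_gt0 => //; apply: divr_gt0.
  have [n hn] : exists n, (energy mu setT (fun x => h n x - f x)%R <= a%:E)%E.
    have /fine_cvgP[[N _ fin] /cvgrPdist_lt/(_ a a0)[N' _ lt]] := hf.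
    exists (N + N')%N; rewrite -[leLHS]fineK ?fin//= ?leq_addr// lee_fin.
    have := lt (N + N')%N (leq_addl _ _); rewrite /= sub0r normrN => /ltW.
    exact: le_trans (ler_norm _).
  have /square_integrableP[mh _] := h2 n.
  have [r1 r2] := cintegral_young measurableT t0 (cmeasurableB mh mf) mphi hn phib.
  have te : t * a + t^-1 * b <= e.
    have -> : t * a = e / 2 by rewrite /a mulrCA mulfV ?mulr1// gt_eqF.
    have -> : t^-1 * b = e / 2 * (b / (b + 1)).
      by rewrite /t !invfM invrK; ring.
    rewrite [leRHS](splitr e) lerD2l ler_piMr ?divr_ge0 ?ltW//.
    by rewrite ltr_pdivrMr ?ltr_wpDl// mul1r ltrDl.
  move: r1 r2; rewrite key cReN cImN !normrN => r1 r2.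
  by split; [exact: le_trans r1 te|exact: le_trans r2 te].
have z0 (x : R) : (forall e, 0 < e -> `|x| <= e) -> x = 0.
  move=> xe; apply/eqP; rewrite -normr_le0; apply/ler_addgt0Pl => e e0.
  by rewrite addr0; exact: xe.
by apply: complex_eqP; apply: z0 => e /small[].
Qed.

End almost_everywhere.

Section probability_space.
Context {R : realType} {d} {T : measurableType d} (P : probability T R).
Implicit Types (X Y : T -> R[i]).

Lemma square_integrable_cst (c : R[i]) : square_integrable P (fun=> c).
Proof.
apply/square_integrableP; split; first exact: cmeasurable_cst.
rewrite /energy integral_cst//; apply: lte_mul_pinfty => //.
  by rewrite lee_fin csq_ge0.
by rewrite [X in (X < _)%E](_ : _ = P setT)// probability_setT ltry.
Qed.

Lemma square_integrable_cintegrable X : square_integrable P X -> cintegrable P setT X.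
Proof.
move=> /square_integrableP[mX Xoo].
have /square_integrableP[m1 oo1] := square_integrable_cst 1.
by have := cintegrableM measurableT mX m1 Xoo oo1; under eq_fun do rewrite mulr1.
Qed.

Lemma expectationCB X Y : square_integrable P X -> square_integrable P Y ->
  expectationC P (fun w => X w - Y w) = expectationC P X - expectationC P Y.
Proof. by move=> *; apply: cintegralB => //; exact: square_integrable_cintegrable. Qed.

Lemma varianceC_lty X : square_integrable P X -> (varianceC P X < +oo)%E.
Proof.
move=> X2; rewrite /varianceC sqnormL2E.
by have /square_integrableP[] := square_integrableB X2 (square_integrable_cst (expectationC P X)).
Qed.

End probability_space.

Lemma cvge_scale0 {R : realType} (c : R) (u : nat -> \bar R) : c != 0 ->
  (c%:E * u n @[n --> \oo] --> 0 <-> u n @[n --> \oo] --> 0)%E.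
Proof.
move=> c0; split => H; last by have := @cvgeZl _ _ _ _ _ c%:E isT H; rewrite mule0.
have := @cvgeZl _ _ _ _ _ c^-1%:E isT H; rewrite mule0.
by under eq_fun do rewrite muleA -EFinM mulVf// mul1e.
Qed.

Lemma twopi_powV_gt0 (R : realType) n : 0 < (2 * pi) ^- n :> R.
Proof. by rewrite invr_gt0; apply: exprn_gt0; apply: mulr_gt0 => //; exact: pi_gt0. Qed.

Section random_measure.
Context {R : realType} {d : nat} {dO} {Omega : measurableType dO}.
Variable P : probability Omega R.
Variable M : ('rV[R]_d -> R[i]) -> Omega -> R[i].
Variable S : {measure set 'rV[R]_d -> \bar R}.
Hypothesis MP : weakly_stationary_measure P M.
Hypothesis MS : spectral_measure P M S.

Let M2 f : Ccb setT f -> square_integrable P (M f).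
Proof. by have [+ _ _] := MP; exact. Qed.

(** A finite variance forces a finite energy because the normalizing constant is positive. On R^d
    this is the source of the square integrability of transforms. *)
Lemma spectral_energy_lty f : Ccb setT f -> (energy S setT (fourier f) < +oo)%E.
Proof.
move=> Cf; have [_ _ /(_ f Cf)] := MS; rewrite sqnormL2E => vE.
have := varianceC_lty (M2 Cf); rewrite vE.
case: (energy _ _ _) => [r _| |] //; first exact: ltry.
by rewrite gt0_muley// lte_fin twopi_powV_gt0.
Qed.

(** [M] is a bare map on functions, and its additivity comes from the complex measures that it
    almost surely induces: f and g are placed in one compact cube, on which [M] is given by
    integrals. *)
Lemma random_measureB f g : Ccb setT f -> Ccb setT g ->
  {ae P, forall w, M (fun x => f x - g x) w = M f w - M g w}.
Proof.
move=> Cf Cg; have /CcbP[[K [N cf]] _] := Cf; have /CcbP[[K' [N' cg]] _] := Cg.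
pose L := Num.max N N'.
have Lf : Ccb (cube L) f.
  apply/CcbP; split; first by exists K, N.
  have [_ _ f0] := cf; move=> x nx; apply: f0 => xN; apply: nx.
  by apply: subset_cube xN; rewrite le_max lexx.
have Lg : Ccb (cube L) g.
  apply/CcbP; split; first by exists K', N'.
  have [_ _ g0] := cg; move=> x nx; apply: g0 => xN; apply: nx.
  by apply: subset_cube xN; rewrite le_max lexx orbT.
have mL : measurable (@cube R d L) by exact: measurable_cube.
have [_ + _] := MP; apply: filterS => w /(_ _ (@compact_cube R d L)).
move=> [mu1 [mu2 [mu3 [mu4 ME]]]].
rewrite !ME//; last exact: CcbB.
have ci (mu : {finite_measure set 'rV[R]_d -> \bar R}) K0 N0 h :
    controlled K0 N0 h -> cintegrable mu (cube L) h.
  move=> [mh hK _]; apply: (cintegrable_le mL mh _ (fun x _ => hK x)).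
  exact: (finite_measure_integrable_cst mu K0 mL).
rewrite !cintegralB//; try by [exact: ci cf|exact: ci cg].
by ring.
Qed.

(** By almost sure additivity the left side is the variance of M(f - g). The variance formula thus
    turns approximation in L^2(P) into approximation of transforms in L^2(S). *)
Lemma centering_energy f g : Ccb setT f -> Ccb setT g ->
  sqnormL2 P (fun w => centering P M f w - centering P M g w) =
  (((2 * pi) ^- d)%:E * energy S setT (fun u => fourier f u - fourier g u)%R)%E.
Proof.
move=> Cf Cg; have Cfg := CcbB Cf Cg.
have [_ _ /(_ _ Cfg)] := MS; rewrite sqnormL2E /varianceC sqnormL2E.
rewrite (_ : fourier _ = (fun u => fourier f u - fourier g u)); last first.
  by apply/funext => u; rewrite fourierB.
move=> <-; rewrite sqnormL2E /centering.
have /square_integrableP[mfg _] := M2 Cfg.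
have /square_integrableP[mf _] := M2 Cf.
have /square_integrableP[mg _] := M2 Cg.
have MB := random_measureB Cf Cg.
have e : expectationC P (M (fun x => f x - g x)) = expectationC P (M f) - expectationC P (M g).
  rewrite -expectationCB//; try exact: M2.
  by apply: cintegral_ae_eq => //; exact: cmeasurableB.
rewrite e; apply: energy_ae_eq.
- by apply: cmeasurableB; apply: cmeasurableB => //; exact: cmeasurable_cst.
- by apply: cmeasurableB => //; exact: cmeasurable_cst.
- by apply: filterS MB => w ->; ring.
Qed.

Lemma interpolation_energy_cvg (h : nat -> 'rV[R]_d -> R[i]) f :
  (forall n, Ccb setT (h n)) -> Ccb setT f ->
  (sqnormL2 P (fun w => centering P M (h n) w - centering P M f w) @[n --> \oo] --> 0%E <->
   energy S setT (fun u => fourier (h n) u - fourier f u)%R @[n --> \oo] --> 0%E).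
Proof.
move=> Ch Cf; under eq_fun do rewrite centering_energy//.
by apply: cvge_scale0; rewrite gt_eqF// twopi_powV_gt0.
Qed.

End random_measure.

Section euclidean_interpolation.
Context {R : realType} {d : nat} {dO} {Omega : measurableType dO}.
Variable P : probability Omega R.
Variable M : ('rV[R]_d -> R[i]) -> Omega -> R[i].
Variable S : {measure set 'rV[R]_d -> \bar R}.
Variable A : set 'rV[R]_d.
Hypothesis MP : weakly_stationary_measure P M.
Hypothesis MS : spectral_measure P M S.

Let Stempered : (\int[S]_u ((1 + enorm u) ^- d.+1)%:E < +oo)%E.
Proof. by case: MS. Qed.

Let Sfinite f : Ccb setT f -> (energy S setT (fourier f) < +oo)%E.
Proof. exact: (spectral_energy_lty MP MS). Qed.

Lemma notin_Sp phi x : ~ Sp phi S x -> exists U, [/\ open U, U x &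
  forall psi, test_function U psi -> annihilates S phi psi].
Proof.
move=> /existsNP[U /not_implyP[oU /not_implyP[Ux nU]]]; exists U; split => // psi tpsi.
by apply/eqP; apply: contrapT => /negP nz; apply: nU; exists psi.
Qed.

Lemma open_setC_Sp phi : open (~` Sp phi S).
Proof.
rewrite openE => x /notin_Sp[U [oU Ux aU]].
have : nbhs x U by exact: open_nbhs_nbhs.
apply: filterS => y Uy /(_ U oU Uy)[psi /aU D0] /eqP; exact.
Qed.

Lemma interpolable_Sp_neq0 : perfectly_interpolable P Ccb (centering P M) A ->
  forall phi : 'rV[R]_d -> R[i], nonzeroL2 S phi -> Sp phi S `&` A !=set0.
Proof.
move=> interp phi [phi2 phin0]; apply/set0P/eqP => SpA; apply: phin0.
apply: (annihilates_all_ae0 Sfinite phi2) => f Cf.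
pose W := ~` Sp phi S.
have mW : measurable W by apply: open_measurable_rV; exact: open_setC_Sp.
have AW : A `<=` W by move=> x Ax Sx; have : (Sp phi S `&` A) x by []; rewrite SpA.
have aW g : Ccb W g -> annihilates S phi g.
  move=> Cg; have [_ _ _ g0] := Cg.
  apply: (annihilates_off_support Stempered Sfinite phi2 (@notin_Sp phi) _ g0).
  exact: Ccb_sub (@subsetT _ _) Cg.
have CW B (mB : measurable B) : Ccb B (fun x => (\1_B x : R)%:C * f x).
  have /CcbP[cf _] := CcbM (bounded_measurable_indic mB) Cf.
  by apply/CcbP; split => // x nx; rewrite indicE memNset// mul0r.
(* The cut is made along W, which is open and hence measurable, rather than along A. The part off W
   vanishes on A because A is contained in W. *)
rewrite (_ : f = (fun x => (\1_W x : R)%:C * f x + (\1_(~` W) x : R)%:C * f x)); last first.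
  apply/funext => x; rewrite -mulrDl -rmorphD !indicE in_setC.
  by case: (x \in W); rewrite /= ?addr0 ?add0r ?rmorph1 mul1r.
have mW' := measurableC mW.
have C1 := Ccb_sub (@subsetT _ _) (CW _ mW).
have C2 := Ccb_sub (@subsetT _ _) (CW _ mW').
apply: (annihilatesD Sfinite phi2 C1 C2); first exact/aW/CW.
have C3 : Ccb (~` A) (fun x => (\1_(~` W) x : R)%:C * f x).
  by apply: Ccb_sub (CW _ mW'); exact: subsetC.
have [h [hA hcvg]] := interp _ C3.
have hT n : Ccb setT (h n) by exact: Ccb_sub (@subsetT _ _) (hA n).
have /(interpolation_energy_cvg MP MS hT C2) fcvg := hcvg.
apply: (cintegral_limit0 phi2 _ _ fcvg).
- exact: fourier_square_integrable.
- by move=> n; exact: fourier_square_integrable.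
- by move=> n; apply: aW; exact: Ccb_sub AW (hA n).
Qed.

(** At a point of Sp(phi S) in A, the open set A is itself an admissible neighbourhood, so it
    carries a test function on which the functional does not vanish. Hence no nonzero phi
    annihilates the transforms of all functions supported in A, and the projection theorem
    applies. *)
Lemma Sp_neq0_interpolable : open A ->
  (forall phi : 'rV[R]_d -> R[i], nonzeroL2 S phi -> Sp phi S `&` A !=set0) ->
  perfectly_interpolable P Ccb (centering P M) A.
Proof.
move=> oA SpA f Cf; have CfT := Ccb_sub (@subsetT _ _) Cf.
pose V (k : 'rV[R]_d -> R[i]) := exists2 h, Ccb A h & k = fourier h.
have CT h : Ccb A h -> Ccb setT h by exact: Ccb_sub (@subsetT _ _).
have [||||||k [Vk kf]] := @L2_orthogonal_dense _ _ _ S V (fourier f).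
- exists (fun x => 0 * (fun=> 0) x); first by apply: CcbZ; exact: Ccb0.
  apply/funext => u; rewrite fourierZ ?mul0r//; exact: Ccb0.
- move=> _ _ [h Ah ->] [g Ag ->]; exists (fun x => h x + g x); first exact: CcbD.
  by apply/funext => u; rewrite fourierD//; exact: CT.
- move=> c _ [h Ah ->]; exists (fun x => c * h x); first exact: CcbZ.
  by apply/funext => u; rewrite fourierZ//; exact: CT.
- by move=> _ [h Ah ->]; apply: fourier_square_integrable => //; exact: CT.
- exact: fourier_square_integrable.
- move=> phi phi2 orth; apply: contrapT => phin0.
  have [x [Sx Ax]] := SpA phi (conj phi2 phin0).
  have [psi tpsi /eqP] := Sx A oA Ax; apply; apply: orth.
  by exists psi => //; exact: test_function_Ccb.
have /choice[h hk] n : exists h, Ccb A h /\ k n = fourier h.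
  by have [h Ah ->] := Vk n; exists h.
exists h; split; first by move=> n; have [] := hk n.
have hT n : Ccb setT (h n) by apply: CT; have [] := hk n.
apply/(interpolation_energy_cvg MP MS hT CfT).
rewrite (_ : (fun n => _) = (fun n => energy S setT (fun u => k n u - fourier f u)%R)) //.
by apply/funext => n; have [_ ->] := hk n.
Qed.

End euclidean_interpolation.

(** * Random fields on Z^d *)

Section torus.
Context {R : realType} {d : nat}.
Implicit Types (z : circle R) (k l : 'rV[int]_d) (u : 'rV[circle R]_d).

Lemma circle_neq0 z : circle_val z != 0.
Proof.
apply/eqP => z0; have := circleP z; rewrite z0 (normcC 0) normr0 eq_sym.
by rewrite oner_eq0.
Qed.

Lemma normc_expz (z : R[i]) n : normc z = 1 -> normc (z ^ n) = 1.
Proof.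
move=> z1; have nat_case (m : nat) : normc (z ^+ m) = 1.
  elim: m => [|m ih]; first by rewrite expr0 ComplexField.Normc.normc1.
  by rewrite exprS ComplexField.Normc.normcM z1 ih mulr1.
case: n => m; first exact: nat_case.
by rewrite -[z ^ _]/((z ^+ m.+1)^-1) ComplexField.Normc.normcV nat_case invr1.
Qed.

Lemma invr_circle (z : R[i]) : normc z = 1 -> z^-1 = z^*.
Proof.
move=> z1; have z0 : z != 0.
  by apply/eqP => z0; move: z1; rewrite z0 (normcC 0) normr0 => /eqP; rewrite eq_sym oner_eq0.
apply: (mulfI z0); rewrite mulfV//.
have := normc_sqr z; rewrite z1 expr1n /csq => e.
apply: complex_eqP; rewrite ?cReM ?cImM cReJ cImJ /=.
  by rewrite mulrN opprK -!expr2 -e.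
by rewrite mulrN mulrC addNr.
Qed.

Lemma normc_torus_exp u k : normc (torus_exp u k) = 1.
Proof.
rewrite /torus_exp; elim/big_ind : _ => [|a b a1 b1|j _].
- exact: ComplexField.Normc.normc1.
- by rewrite ComplexField.Normc.normcM a1 b1 mulr1.
- by apply: normc_expz; apply/eqP; exact: circleP.
Qed.

Lemma torus_expD u k l : torus_exp u (k + l) = torus_exp u k * torus_exp u l.
Proof.
rewrite /torus_exp -big_split; apply: eq_bigr => j _ /=.
by rewrite mxE expfzDr// circle_neq0.
Qed.

Lemma cmeasurable_circle_val : cmeasurable (@circle_val R).
Proof.
split=> _ B mB; rewrite setTI; apply: sub_gen_smallest; [left|right];
  by exists B => //; rewrite setTI.
Qed.

Lemma cmeasurable_torus_exp k : cmeasurable (fun u => torus_exp u k).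
Proof.
have mcoord j : cmeasurable (fun u : 'rV[circle R]_d => circle_val (u ord0 j)).
  have [m1 m2] := cmeasurable_circle_val; split.
    exact: (measurableT_comp m1 (measurable_coord j)).
  exact: (measurableT_comp m2 (measurable_coord j)).
have mX j n : cmeasurable (fun u : 'rV[circle R]_d => circle_val (u ord0 j) ^+ n).
  elim: n => [|n ih].
    by under eq_fun do rewrite expr0; exact: cmeasurable_cst.
  by under eq_fun do rewrite exprS; exact: cmeasurableM.
have mz j (n : int) : cmeasurable (fun u : 'rV[circle R]_d => circle_val (u ord0 j) ^ n).
  case: n => n; first exact: mX.
  rewrite (_ : (fun _ => _) = (fun u : 'rV[circle R]_d => (circle_val (u ord0 j) ^+ n.+1)^*)).
    exact: cmeasurableJ.
  apply/funext => u; rewrite -invr_circle//.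
  have := @normc_expz (circle_val (u ord0 j)) (Posz n.+1); apply.
  by apply/eqP; exact: circleP.
rewrite /torus_exp; elim: (index_enum _) => [|j s ih].
  by under eq_fun do rewrite big_nil; exact: cmeasurable_cst.
by under eq_fun do rewrite big_cons; exact: cmeasurableM.
Qed.

(** The exponent e_i gives the coordinate u_i itself, whose real and imaginary parts generate the
    Borel sets of the circle. *)
Lemma torus_exp_generate : @measurable _ 'rV[circle R]_d `<=`
  <<s [set B | exists k a, B = [set u | Re (torus_exp u k) < a] \/
                           B = [set u | Im (torus_exp u k) < a]] >>.
Proof.
set G := [set B | _].
apply: smallest_sub; first exact: smallest_sigma_algebra.
rewrite -bigcup_seq; apply: bigcup_sub => i _ _ [B mB <-]; rewrite setTI.
have neg_ray (h : 'rV[circle R]_d -> R) : (forall b, G [set u | h u < b]) ->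
    measurable_fun setT (h : g_sigma_algebraType G -> R).
  move=> hG; apply: (measurability _ (RGenInftyO.measurableE R)) => _ [_ [b ->] <-].
  rewrite setTI; apply: sub_gen_smallest; have := hG b.
  by congr G; apply/seteqP; split => u /=; rewrite in_itv.
pose e : 'rV[int]_d := delta_mx ord0 i.
have eE u : torus_exp u e = circle_val (u ord0 i).
  rewrite /torus_exp (bigD1 i)//= big1 ?mulr1 => [|j ji].
    by rewrite mxE !eqxx expr1z.
  by rewrite mxE (negbTE ji) andbF expr0z.
have m1 : measurable_fun setT (fun u : g_sigma_algebraType G => Re (circle_val (u ord0 i))).
  apply: neg_ray => b; exists e, b; left; by under [RHS]eq_set do rewrite eE.
have m2 : measurable_fun setT (fun u : g_sigma_algebraType G => Im (circle_val (u ord0 i))).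
  apply: neg_ray => b; exists e, b; right; by under [RHS]eq_set do rewrite eE.
have cE : @measurable _ (circle R) = <<s
    preimage_set_system setT (fun z : circle R => Re (circle_val z)) (@measurable _ (measurableTypeR R)) `|`
    preimage_set_system setT (fun z : circle R => Im (circle_val z)) (@measurable _ (measurableTypeR R)) >>.
  by [].
have mi : measurable_fun setT (fun u : g_sigma_algebraType G => u ord0 i : circle R).
  apply: (measurability _ cE) => _ [_ [[C mC <-]|[C mC <-]] <-].
    rewrite !setTI -[X in measurable X]setTI; exact: m1.
  rewrite !setTI -[X in measurable X]setTI; exact: m2.
by have := mi measurableT B mB; rewrite setTI.
Qed.

End torus.

Section lattice_combinations.
Context {R : realType} {d : nat} {d'} {T : measurableType d'}.
Variable X : 'rV[int]_d -> T -> R[i].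
Implicit Types (f g : 'rV[int]_d -> R[i]) (B : set 'rV[int]_d).

(** Common form of [field_measure], with X the random field, and of [fourier_lattice], with X the
    characters of the torus. *)
Definition combination f : T -> R[i] := fun x => \sum_(k \in setT) X k x * f k.

(** Any finite set containing the support may carry the sum, so that two functions can be summed
    over the union of their supports. *)
Lemma combinationE (D : set 'rV[int]_d) f x : finite_set D ->
  [set k | f k != 0] `<=` D ->
  combination f x = \sum_(k <- finmap.enum_fset (fset_set D)) X k x * f k.
Proof.
move=> finD fD; rewrite -fsbig_finite// /combination; apply/esym/fsbig_widen => //.
move=> k [_ nDk] /=; suff -> : f k = 0 by rewrite mulr0.
by apply/eqP; apply: contrapT => /negP /fD.
Qed.

Lemma Ccb_lattice_lin B (c : R[i]) f g : Ccb_lattice B f -> Ccb_lattice B g ->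
  Ccb_lattice B (fun k => f k + c * g k).
Proof.
move=> [finf f0] [fing g0]; split; last by move=> k nB; rewrite f0// g0// mulr0 addr0.
have finU : finite_set ([set k | f k != 0] `|` [set k | g k != 0]) by rewrite finite_setU.
apply: sub_finite_set finU => k /=; have [->|fk] := eqVneq (f k) 0; last by left.
by rewrite add0r => cg; right; apply: contra_neq cg => ->; rewrite mulr0.
Qed.

Lemma Ccb_lattice_sub B B' f : B `<=` B' -> Ccb_lattice B f -> Ccb_lattice B' f.
Proof. by move=> BB [finf f0]; split => // k nB; apply: f0 => /BB. Qed.

Lemma combination_lin (c : R[i]) f g x : Ccb_lattice setT f -> Ccb_lattice setT g ->
  combination (fun k => f k + c * g k) x = combination f x + c * combination g x.
Proof.
move=> [finf _] [fing _]; set D := [set k | f k != 0] `|` [set k | g k != 0].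
have finD : finite_set D by rewrite finite_setU.
rewrite !(combinationE _ finD).
- rewrite mulr_sumr -big_split; apply: eq_bigr => k _ /=; ring.
- by move=> k ?; right.
- by move=> k ?; left.
- move=> k /=; rewrite /D /=; have [->|fk] := eqVneq (f k) 0; last by left.
  by rewrite add0r => cg; right; apply: contra_neq cg => ->; rewrite mulr0.
Qed.

Variable mu : {measure set T -> \bar R}.

Lemma combination_square_integrable f : (forall k, square_integrable mu (X k)) ->
  Ccb_lattice setT f -> square_integrable mu (combination f).
Proof.
move=> X2 [finf _]; rewrite (_ : combination f =
    (fun x => \sum_(k <- finmap.enum_fset (fset_set [set k | f k != 0])) f k * X k x)); last first.
  by apply/funext => x; rewrite (combinationE _ finf)//; apply: eq_bigr => k _; rewrite mulrC.
elim: (finmap.enum_fset _) => [|k s ih].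
  rewrite (_ : (fun _ => _) = (fun x => 0 * X 0 x)); last first.
    by apply/funext => x; rewrite big_nil mul0r.
  exact: square_integrableZ.
under eq_fun do rewrite big_cons.
by apply: square_integrableD => //; exact: square_integrableZ.
Qed.

(** Serves twice: for the centred variables of the field, and for the products of the characters
    with phi. *)
Lemma cintegral_combination0 f : (forall k, cintegrable mu setT (X k)) ->
  Ccb_lattice setT f -> (forall k, f k != 0 -> cintegral mu setT (X k) = 0) ->
  cintegral mu setT (combination f) = 0.
Proof.
move=> iX [finf _] X0; rewrite (_ : combination f =
    (fun x => \sum_(k <- finmap.enum_fset (fset_set [set k | f k != 0])) f k * X k x)); last first.
  by apply/funext => x; rewrite (combinationE _ finf)//; apply: eq_bigr => k _; rewrite mulrC.
set s := finmap.enum_fset _.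
suff [] : cintegrable mu setT (fun x => \sum_(k <- s) f k * X k x) /\
          cintegral mu setT (fun x => \sum_(k <- s) f k * X k x) = 0 by [].
elim: s => [|k s [ih1 ih2]].
  rewrite (_ : (fun _ => _) = (fun x => 0 * X 0 x)); last first.
    by apply/funext => x; rewrite big_nil mul0r.
  by split; [exact: cintegrableZ|rewrite cintegralZ// mul0r].
have iZ : cintegrable mu setT (fun x => f k * X k x) by exact: cintegrableZ.
under eq_fun do rewrite big_cons.
split; [exact: cintegrableD|rewrite cintegralD// ih2 addr0 cintegralZ//].
by have [->|/X0 ->] := eqVneq (f k) 0; rewrite ?mul0r ?mulr0.
Qed.

End lattice_combinations.

Section lattice_interpolation.
Context {R : realType} {d : nat} {dO} {Omega : measurableType dO}.
Variable P : probability Omega R.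
Variable M : 'rV[int]_d -> Omega -> R[i].
Variable S : {measure set 'rV[circle R]_d -> \bar R}.
Hypothesis MP : weakly_stationary_field P M.
Hypothesis MS : spectral_measure_lattice P M S.

Let expo k (u : 'rV[circle R]_d) := torus_exp u k.

Let expo2 k : square_integrable S (expo k).
Proof.
apply/square_integrableP; split; first exact: cmeasurable_torus_exp.
rewrite /energy; under eq_integral do rewrite -normc_sqr normc_torus_exp expr1n.
by rewrite integral_cst// mul1e; have [] := MS.
Qed.

Lemma fourier_lattice_square_integrable f : Ccb_lattice setT f -> square_integrable S (fourier_lattice f).
Proof. exact: (combination_square_integrable expo2). Qed.

Lemma field_energy f g : Ccb_lattice setT f -> Ccb_lattice setT g ->
  sqnormL2 P (fun w => field_measure M f w - field_measure M g w) =
  (((2 * pi) ^- d)%:E *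
   energy S setT (fun u => fourier_lattice f u - fourier_lattice g u)%R)%E.
Proof.
move=> Cf Cg; have Cfg := Ccb_lattice_lin (-1) Cf Cg.
have [M2 M0 _] := MP; have [_ _ /(_ _ Cfg)] := MS.
rewrite /varianceC !sqnormL2E [expectationC _ _](_ : _ = 0); last first.
  apply: (cintegral_combination0 (X := M)) => // k; last by move=> _; exact: M0.
  exact: square_integrable_cintegrable.

rewrite (_ : fourier_lattice _ = (fun u => fourier_lattice f u - fourier_lattice g u)); last first.
  by apply/funext => u; rewrite [LHS](combination_lin expo _ _ Cf Cg) mulN1r.
move=> <-; congr energy; apply/funext => w.
by rewrite subr0 [RHS](combination_lin M _ _ Cf Cg) mulN1r.
Qed.

Lemma field_energy_cvg (h : nat -> 'rV[int]_d -> R[i]) f :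
  (forall n, Ccb_lattice setT (h n)) -> Ccb_lattice setT f ->
  (sqnormL2 P (fun w => field_measure M (h n) w - field_measure M f w) @[n --> \oo] --> 0%E <->
   energy S setT (fun u => fourier_lattice (h n) u - fourier_lattice f u)%R @[n --> \oo] --> 0%E).
Proof.
move=> Ch Cf; under eq_fun do rewrite field_energy//.
by apply: cvge_scale0; rewrite gt_eqF// twopi_powV_gt0.
Qed.

Variable phi : 'rV[circle R]_d -> R[i].
Hypothesis phi2 : square_integrable S phi.

Let iexpo k : cintegrable S setT (fun u => expo k u * phi u).
Proof.
have /square_integrableP[? ?] := phi2; have /square_integrableP[? ?] := expo2 k.
exact: cintegrableM.
Qed.

Lemma fourier_lattice_annihilated f : Ccb_lattice setT f ->
  (forall k, f k != 0 -> cintegral S setT (fun u => torus_exp u k * phi u) = 0) ->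
  cintegral S setT (fun u => fourier_lattice f u * phi u) = 0.
Proof.
move=> Cf f0; rewrite (_ : (fun u => _) = combination (fun k u => expo k u * phi u) f).
  by apply: cintegral_combination0.
apply/funext => u; have [finf _] := Cf.
rewrite (combinationE _ _ finf)// [fourier_lattice f u](combinationE expo _ finf)// mulr_suml.
by apply: eq_bigr => k _; rewrite mulrAC.
Qed.

Definition delta (m : 'rV[int]_d) : 'rV[int]_d -> R[i] := fun k => (k == m)%:R.

Lemma Ccb_delta m (B : set 'rV[int]_d) : B m -> Ccb_lattice B (delta m).
Proof.
move=> Bm; split; last first.
  by move=> k nB; rewrite /delta; case: eqP => // km; rewrite km in nB.
apply: sub_finite_set (finite_set1 m) => k /=; rewrite /delta.
by case: (k =P m) => // _; rewrite eqxx.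
Qed.

Lemma fourier_delta m u : fourier_lattice (delta m) u = torus_exp u m.
Proof.
rewrite [LHS](combinationE expo _ (finite_set1 m)).
  by rewrite fset_set1 finmap.big_seq_fset1 /delta eqxx mulr1.
by move=> k /=; rewrite /delta; case: (k =P m) => // _; rewrite eqxx.
Qed.

(** Since S is finite here, phi is integrable, being its own product with the trivial character, and
    uniqueness of Fourier coefficients applies to phi directly. *)
Lemma torus_coefficients_ae0 :
  (forall k, cintegral S setT (fun u => torus_exp u k * phi u) = 0) ->
  {ae S, forall u, phi u = 0}.
Proof.
move=> phi0; have /square_integrableP[mphi phioo] := phi2.
apply: (characters_separate (chi := expo)) => //.
- by move=> k l u; exact: torus_expD.
- by move=> k u; exact: normc_torus_exp.
- by move=> k; exact: cmeasurable_torus_exp.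
- exact: torus_exp_generate.
- rewrite (_ : phi = (fun u => expo 0 u * phi u)); first exact: iexpo.
  apply/funext => u; rewrite /expo /torus_exp big1 ?mul1r// => j _.
  by rewrite mxE expr0z.
Qed.

End lattice_interpolation.

Section lattice_theorem.
Context {R : realType} {d : nat} {dO} {Omega : measurableType dO}.
Variable P : probability Omega R.
Variable M : 'rV[int]_d -> Omega -> R[i].
Variable S : {measure set 'rV[circle R]_d -> \bar R}.
Variable A : set 'rV[int]_d.
Hypothesis MP : weakly_stationary_field P M.
Hypothesis MS : spectral_measure_lattice P M S.

Lemma lattice_interpolable_iff : perfectly_interpolable P Ccb_lattice (field_measure M) A <->
  forall phi : 'rV[circle R]_d -> R[i], nonzeroL2 S phi -> Sp_lattice phi S `&` A !=set0.
Proof.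
split=> [interp phi [phi2 phin0]|SpA f Cf].
  apply/set0P/eqP => SpA; apply: phin0.
  have cA k : A k -> cintegral S setT (fun u => torus_exp u k * phi u) = 0.
    move=> Ak; apply/eqP; apply: contrapT => /negP nz.
    by have : (Sp_lattice phi S `&` A) k by []; rewrite SpA.
  apply: (torus_coefficients_ae0 MS phi2) => m.
  have [/cA//|nAm] := pselect (A m).
  have Cm : Ccb_lattice (~` A) (@delta R d m) by exact: Ccb_delta.
  have [h [hA hcvg]] := interp _ Cm.
  have hT n : Ccb_lattice setT (h n) by exact: Ccb_lattice_sub (@subsetT _ _) (hA n).
  have CmT : Ccb_lattice setT (@delta R d m) by exact: Ccb_delta.
  have /(field_energy_cvg MP MS hT CmT) fcvg := hcvg.
  under eq_fun do rewrite -fourier_delta.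
  apply: (cintegral_limit0 phi2 _ _ fcvg).
  - exact: fourier_lattice_square_integrable MS _ _.
  - by move=> n; exact: fourier_lattice_square_integrable MS _ (hT n).
  - move=> n; apply: (fourier_lattice_annihilated MS phi2 (hT n)) => k hk; apply: cA.
    by apply: contrapT => nA; have [_ /(_ k nA) h0] := hA n; rewrite h0 eqxx in hk.
have CfT : Ccb_lattice setT f by exact: Ccb_lattice_sub (@subsetT _ _) Cf.
have CT (h : 'rV[int]_d -> R[i]) : Ccb_lattice A h -> Ccb_lattice setT h by exact: Ccb_lattice_sub (@subsetT _ _).
pose V (k : 'rV[circle R]_d -> R[i]) := exists2 h, Ccb_lattice A h & k = fourier_lattice h.
have lin (c : R[i]) (h g : 'rV[int]_d -> R[i]) : Ccb_lattice A h -> Ccb_lattice A g ->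
    fourier_lattice (fun k => h k + c * g k) = (fun u => fourier_lattice h u + c * fourier_lattice g u).
  move=> Ah Ag; apply/funext => u.
  exact: (combination_lin (fun k (u : 'rV[circle R]_d) => torus_exp u k) c u (CT _ Ah) (CT _ Ag)).
have C0 : Ccb_lattice A (fun=> 0 : R[i]).
  by split => //; rewrite (_ : [set _ | _] = set0)//; apply/seteqP; split => k //=; rewrite eqxx.
have F0 : fourier_lattice (fun=> 0) = (fun=> 0) :> ('rV[circle R]_d -> R[i]).
  by apply/funext => u; rewrite /fourier_lattice fsbig1// => k _; rewrite mulr0.
have [||||||k [Vk kf]] := @L2_orthogonal_dense _ _ _ S V (fourier_lattice f).
- by exists (fun=> 0).
- move=> _ _ [h Ah ->] [g Ag ->]; exists (fun x => h x + 1 * g x); first exact: Ccb_lattice_lin.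
  by rewrite lin//; apply/funext => u; rewrite mul1r.
- move=> c _ [h Ah ->]; exists (fun x => 0 + c * h x); first exact: Ccb_lattice_lin.
  by rewrite lin// F0; apply/funext => u; rewrite add0r.
- by move=> _ [h Ah ->]; apply: fourier_lattice_square_integrable MS _ (CT _ Ah).
- exact: fourier_lattice_square_integrable MS _ CfT.
- move=> phi phi2 orth; apply: contrapT => phin0.
  have [m [Sm Am]] := SpA phi (conj phi2 phin0).
  move/eqP: Sm; apply; have := orth (fourier_lattice (delta m)).
  under eq_fun do rewrite fourier_delta.
  by apply; exists (delta m) => //; exact: Ccb_delta.
have /choice[h hk] n : exists h, Ccb_lattice A h /\ k n = fourier_lattice h.
  by have [h Ah ->] := Vk n; exists h.
exists h; split; first by move=> n; have [] := hk n.
have hT n : Ccb_lattice setT (h n) by apply: CT; have [] := hk n.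
apply/(field_energy_cvg MP MS hT CfT).
rewrite (_ : (fun n => _) = (fun n => energy S setT (fun u => k n u - fourier_lattice f u)%R)) //.
by apply/funext => n; have [_ ->] := hk n.
Qed.

End lattice_theorem.

Theorem theorem1 (R : realType) (d : nat) (d_gt0 : (0 < d)%N)
    (dO : measure_display) (Omega : measurableType dO)
    (P : probability Omega R) :
  (forall (M : ('rV[R]_d -> R[i]) -> Omega -> R[i])
      (S : {measure set 'rV[R]_d -> \bar R}) (A : set 'rV[R]_d),
    weakly_stationary_measure P M -> spectral_measure P M S ->
    (perfectly_interpolable P Ccb (centering P M) A ->
     forall phi : 'rV[R]_d -> R[i], nonzeroL2 S phi ->
       Sp phi S `&` A !=set0) /\
    (open A ->
     (forall phi : 'rV[R]_d -> R[i], nonzeroL2 S phi ->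
       Sp phi S `&` A !=set0) ->
     perfectly_interpolable P Ccb (centering P M) A)) /\
  (forall (M : 'rV[int]_d -> Omega -> R[i])
      (S : {measure set 'rV[circle R]_d -> \bar R}) (A : set 'rV[int]_d),
    weakly_stationary_field P M -> spectral_measure_lattice P M S ->
    (perfectly_interpolable P Ccb_lattice (field_measure M) A <->
     forall phi : 'rV[circle R]_d -> R[i], nonzeroL2 S phi ->
       Sp_lattice phi S `&` A !=set0)).
Proof.
split=> [M S A MP MS|M S A MP MS]; last exact: lattice_interpolable_iff MP MS.
by split; [exact: interpolable_Sp_neq0 MP MS|exact: Sp_neq0_interpolable MP MS].
Qed.
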